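(* Let $\mathcal{C}$ be a class of graphs that is closed under induced subgraphs. If $\mathcal{C}^*_{\mathrm{prim}}$ admits $\mathrm{FP{+}C}$-definable canonization or $\mathrm{FP{+}C}$-definable parameterized canonization, then $\mathcal{C}$ admits $\mathrm{FP{+}C}$-definable canonization (without parameters).
   Context: Graphs are finite, simple, undirected, with nonempty vertex set. A module of $G=(V,E)$ is a nonempty $M\subseteq V$ such that every vertex outside $M$ is adjacent to all or none of $M$; $G$ is prime if its only modules are $V$ and the singletons. An LO-colored graph is a structure $(U,V,E,M,\trianglelefteq,L)$ over the vocabulary $\{V,E,M,\trianglelefteq,L\}$ where $(V,E)$ is a graph (the underlying graph), $M$ is a nonempty finite set disjoint from $V$, $U=V\,\dot\cup\, M$ is the universe, $\trianglelefteq\subseteq M^2$ is a linear order on $M$, and $L\subseteq V\times M^2$ (assigning to each vertex $v$ the color $\{(d,d')\mid (v,d,d')\in L\}$). $\mathcal{C}^*_{\mathrm{prim}}$ is the class of all LO-colored graphs whose underlying graph is a prime graph in $\mathcal{C}$ with at least $4$ vertices. $\mathrm{FP{+}C}$ is inflationary fixed-point logic with counting in the standard two-sorted setting (each structure $A$ is augmented with a number sort $N(A)=[0,|U(A)|]$ ordered naturally). A parameterized $\mathrm{FP{+}C}[\tau_1,\tau_2]$-transduction $\Theta(\bar X)$ is a tuple of $\mathrm{FP{+}C}[\tau_1]$-formulas $(\theta_{\mathrm{dom}}(\bar X),\theta_U(\bar X,\bar u),\theta_\approx(\bar X,\bar u,\bar u'),(\theta_R(\bar X,\bar u_{R,1},\dots,\bar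 u_{R,\mathrm{ar}(R)}))_{R\in\tau_2})$; its domain consists of the pairs $(A,\bar P)$ with $A\models\theta_{\mathrm{dom}}[\bar P]$ and $\theta_U[A,\bar P;\bar u]\ne\emptyset$, and then $\Theta[A,\bar P]$ is the $\tau_2$-structure with universe $\theta_U[A,\bar P;\bar u]/{\approx}$ and relations $R=(\theta_R[A,\bar P;\dots]\cap\theta_U[A,\bar P;\bar u]^{\mathrm{ar}(R)})/{\approx}$, where $\approx$ is the equivalence relation generated by $\theta_\approx[A,\bar P;\bar u,\bar u']$. For a vocabulary $\tau$ not containing $\le$, an ordered copy of a $\tau$-structure $A$ is a $\tau\cup\{\le\}$-structure with $\le$ a linear order on its universe whose $\tau$-reduct is isomorphic to $A$. A parameterized $\mathrm{FP{+}C}[\tau,\tau\cup\{\le\}]$-transduction $\Theta(\bar x)$ ($\bar x$ individual variables) canonizes $A$ if some $\bar p$ has $(A,\bar p)$ in its domain and for all such $\bar p$, $\Theta[A,\bar p]$ is an ordered copy of $A$. A class admits $\mathrm{FP{+}C}$-definable parameterized canonization if some such transduction canonizes all its members, and $\mathrm{FP{+}C}$-definable canonization if this holds with $\bar x$ the empty tuple. *)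

(* Defs.v *)
From HB Require Import structures.
From mathcomp Require Import all_boot.

Unset Implicit Arguments.
Unset Strict Implicit.
Unset Printing Implicit Defensive.

(* A vocabulary is a list of arities [ar R_0; ar R_1; ...]; relation symbol  *)
(* R_i is the index i.  A structure has a finite carrier (its universe) and  *)
(* interprets every index i by a predicate on tuples (sequences); only the   *)
(* tuples of length ar R_i for i < size voc are ever looked at.              *)

Record structure := Structure {
  car : finType;
  srel : nat -> seq car -> bool }.
Arguments srel : clear implicits.

Definition arity (voc : seq nat) (i : nat) := nth 0 voc i.

Definition iso (tau : seq nat) (B A : structure) : Prop :=
  exists f : car B -> car A, bijective f /\
    forall i, i < size tau -> forall s : seq (car B), size s = arity tau i ->
      srel B i s = srel A i (map f s).

(* B is an ordered copy of the tau-structure A: B is a (tau ++ [:: 2])-structure,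
   the relation with index size tau (the symbol <=) is a linear order on the
   universe of B, and the tau-reduct of B is isomorphic to A. *)
Definition ordered_copy (tau : seq nat) (B A : structure) : Prop :=
  let le := fun x y : car B => srel B (size tau) [:: x; y] in
  iso tau B A /\
  (forall x, le x x) /\
  (forall x y, le x y -> le y x -> x = y) /\
  (forall x y z, le x y -> le y z -> le x z) /\
  (forall x y, le x y \/ le y x).

(* the two sorts: elements of the universe, and numbers *)
Inductive sort := SE | SN.
Definition sort_eqb (a b : sort) :=
  match a, b with SE, SE | SN, SN => true | _, _ => false end.
Lemma sort_eqP : Equality.axiom sort_eqb.
Proof. by case; case; constructor. Qed.
HB.instance Definition _ := hasDecEq.Build sort sort_eqP.

Definition var := (sort * nat)%type.

Inductive nterm :=
  | TVar of nat
  | TCount of nat & formula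
with formula :=
  | FEqE of nat & nat
  | FEqN of nterm & nterm
  | FLeN of nterm & nterm
  | FRel of nat & seq nat
  | FRVar of nat & seq var
  | FNot of formula
  | FAnd of formula & formula
  | FOr of formula & formula
  | FExE of nat & formula
  | FExN of nat & formula
  | FIfp of nat & seq var & formula & seq var.
      (* FIfp X us phi ws  ==  [ifp_{X, us} phi](ws) *)

Fixpoint fv_t (t : nterm) : seq var :=
  match t with
  | TVar p => [:: (SN, p)]
  | TCount x f => filter (predC1 (SE, x)) (fv f)
  end
with fv (f : formula) : seq var :=
  match f with
  | FEqE x y => [:: (SE, x); (SE, y)]
  | FEqN s t => fv_t s ++ fv_t t
  | FLeN s t => fv_t s ++ fv_t t
  | FRel _ xs => map (pair SE) xs
  | FRVar _ vs => vs
  | FNot g => fv g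
  | FAnd g h => fv g ++ fv h
  | FOr g h => fv g ++ fv h
  | FExE x g => filter (predC1 (SE, x)) (fv g)
  | FExN p g => filter (predC1 (SN, p)) (fv g)
  | FIfp _ us g ws => filter (fun v => v \notin us) (fv g) ++ ws
  end.

Section Semantics.
Variables (tau : seq nat) (A : structure).

Local Notation n := #|car A|.
Definition value := (car A + 'I_n.+1)%type.

Definition matches (s : sort) (v : value) :=
  match s, v with SE, inl _ | SN, inr _ => true | _, _ => false end.
Definition wsort (ss : seq sort) (t : seq value) :=
  (size t == size ss) && all2 matches ss t.

Record env := Env {
  elt : nat -> option (car A);
  num : nat -> option 'I_n.+1;
  rv  : nat -> seq value -> bool }.

Definition env0 := Env (fun _ => None) (fun _ => None) (fun _ _ => false).

Definition set_elt (e : env) x a :=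
  Env (fun y => if y == x then Some a else elt e y) (num e) (rv e).
Definition set_num (e : env) p i :=
  Env (elt e) (fun q => if q == p then Some i else num e q) (rv e).
Definition set_rv (e : env) X (P : seq value -> bool) :=
  Env (elt e) (num e) (fun Y => if Y == X then P else rv e Y).

Definition lookup (e : env) (v : var) : option value :=
  match v with
  | (SE, x) => omap inl (elt e x)
  | (SN, p) => omap inr (num e p)
  end.

Definition assign1 (e : env) (v : var) (a : value) :=
  match v, a with
  | (SE, x), inl b => set_elt e x b
  | (SN, p), inr i => set_num e p i
  | _, _ => e
  end.

Definition assign (e : env) (vs : seq var) (t : seq value) :=
  foldl (fun e' va => assign1 e' va.1 va.2) e (zip vs t).

Definition oeq {T : eqType} (a b : option T) :=
  match a, b with Some x, Some y => x == y | _, _ => false end.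

Fixpoint teval (t : nterm) (e : env) : option 'I_n.+1 :=
  match t with
  | TVar p => num e p
  | TCount x f => Some (inord #|[pred a : car A | eval f (set_elt e x a)]|)
  end
with eval (f : formula) (e : env) : bool :=
  match f with
  | FEqE x y => oeq (elt e x) (elt e y)
  | FEqN s t => oeq (teval s e) (teval t e)
  | FLeN s t =>
      match teval s e, teval t e with
      | Some i, Some j => (i <= j)%N | _, _ => false end
  | FRel i xs =>
      let vs := map (elt e) xs in
      [&& i < size tau, size xs == arity tau i, all isSome vs & srel A i (pmap id vs)]
  | FRVar X vs =>
      let ls := map (lookup e) vs in all isSome ls && rv e X (pmap id ls)
  | FNot g => ~~ eval g e
  | FAnd g h => eval g e && eval h e
  | FOr g h => eval g e || eval h e
  | FExE x g => [exists a : car A, eval g (set_elt e x a)]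
  | FExN p g => [exists i : 'I_n.+1, eval g (set_num e p i)]
  | FIfp X us g ws =>
      (* inflationary stages  X_0 = {},  X_{j+1} = X_j \cup {t | g(X_j, t)};
         the stages are increasing subsets of the (n+1)^|us| well-sorted tuples,
         so stage (n+1)^|us| is the inflationary fixed point. *)
      let step := fun (P : seq value -> bool) (t : seq value) =>
         P t || (wsort (map fst us) t && eval g (assign (set_rv e X P) us t)) in
      let Fix := iter (n.+1 ^ size us) step (fun _ => false) in
      let ls := map (lookup e) ws in all isSome ls && Fix (pmap id ls)
  end.

(* a query: a formula together with the list of its designated free variables *)
Definition query := (seq var * formula)%type.

Definition qeval (q : query) (t : seq value) : bool :=
  wsort (map fst q.1) t && eval q.2 (assign env0 q.1 t).

End Semantics.

Definition wf_query (q : query) (ss : seq sort) : Prop :=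
  map fst q.1 = ss /\ uniq q.1 /\ {subset fv q.2 <= q.1}.

Record transduction := Transduction {
  t_par : seq sort;
  t_srt : seq sort;
  t_dom : query;
  t_U   : query;
  t_eq  : query;
  t_rel : seq query }.

Definition dflt_query : query := ([::], FEqE 0 0).

(* Theta is an FP+C[tau1, tau2]-transduction (symbols outside tau1 evaluate
   to false, so they add nothing) *)
Definition wf_transduction (tau2 : seq nat) (T : transduction) : Prop :=
  [/\ wf_query (t_dom T) (t_par T),
      wf_query (t_U T) (t_par T ++ t_srt T),
      wf_query (t_eq T) (t_par T ++ t_srt T ++ t_srt T),
      size (t_rel T) = size tau2 &
      forall i, i < size tau2 ->
        wf_query (nth dflt_query (t_rel T) i)
                 (t_par T ++ flatten (nseq (arity tau2 i) (t_srt T)))].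

Section Output.
Variables (tau : seq nat) (T : transduction) (A : structure) (p : seq (value A)).

Definition dom_t := (size (t_srt T)).-tuple (value A).

Definition Uset : {set dom_t} := [set t : dom_t | qeval tau A (t_U T) (p ++ t)].

Definition eqstep : rel dom_t := fun a b =>
  [&& a \in Uset, b \in Uset &
      qeval tau A (t_eq T) (p ++ a ++ b) || qeval tau A (t_eq T) (p ++ b ++ a)].

Definition eqgen : rel dom_t := connect eqstep.

Definition classes : {set {set dom_t}} := [set [set b | eqgen a b] | a in Uset].

Definition out_car := {c : {set dom_t} | c \in classes}.

Definition out_rel (i : nat) (s : seq out_car) : bool :=
  [exists ts : (size s).-tuple dom_t,
     all2 (fun (c : out_car) (t : dom_t) => t \in val c) s ts &&
     qeval tau A (nth dflt_query (t_rel T) i) (p ++ flatten (map val ts))].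

Definition out_struct : structure := @Structure out_car out_rel.

Definition in_domain : bool :=
  [&& wsort A (t_par T) p, qeval tau A (t_dom T) p & Uset != set0].

End Output.

Definition canonizes (tau : seq nat) (T : transduction) (A : structure) : Prop :=
  (exists p, in_domain tau T A p) /\
  forall p, in_domain tau T A p -> ordered_copy tau (out_struct tau T A p) A.

Definition admits_param_canonization (tau : seq nat) (K : structure -> Prop) :=
  exists T, wf_transduction (tau ++ [:: 2]) T /\ forall A, K A -> canonizes tau T A.

Definition admits_canonization (tau : seq nat) (K : structure -> Prop) :=
  exists T, [/\ wf_transduction (tau ++ [:: 2]) T, t_par T = [::] &
                forall A, K A -> canonizes tau T A].

Definition graph_voc : seq nat := [:: 2].

Definition adj (G : structure) (x y : car G) := srel G 0 [:: x; y].

Definition is_graph (G : structure) : Prop :=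
  [/\ 0 < #|car G|, (forall x y, adj G x y = adj G y x) & (forall x, ~~ adj G x x)].

Definition is_module (G : structure) (M : {set car G}) : Prop :=
  M != set0 /\
  forall v, v \notin M -> (forall m, m \in M -> adj G v m) \/ (forall m, m \in M -> ~~ adj G v m).

Definition prime_graph (G : structure) : Prop :=
  forall M : {set car G}, is_module G M -> M = setT \/ exists v, M = [set v].

Definition graph_class (C : structure -> Prop) : Prop :=
  forall G, C G -> is_graph G.

Definition closed_induced_subgraphs (C : structure -> Prop) : Prop :=
  forall G H, C G -> is_graph H ->
    (exists f : car H -> car G, injective f /\ forall x y, adj H x y = adj G (f x) (f y)) ->
    C H.

(* LO-colored graphs: vocabulary {V, E, M, <|, L} = indices 0,1,2,3,4.       *)

Definition lo_voc : seq nat := [:: 1; 2; 1; 2; 3].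

Section LO.
Variable A : structure.
Definition loV (x : car A) := srel A 0 [:: x].
Definition loE (x y : car A) := srel A 1 [:: x; y].
Definition loM (x : car A) := srel A 2 [:: x].
Definition loLe (x y : car A) := srel A 3 [:: x; y].
Definition loL (v d d' : car A) := srel A 4 [:: v; d; d'].

Definition is_LO_colored : Prop :=
  (forall x, loV x != loM x) /\ (exists x, loV x) /\ (exists x, loM x) /\
  (forall x y, loE x y -> loV x && loV y) /\
  (forall x y, loE x y = loE y x) /\ (forall x, ~~ loE x x) /\
  [/\ forall d d', loLe d d' -> loM d && loM d',
      forall d, loM d -> loLe d d,
      forall d d', loLe d d' -> loLe d' d -> d = d',
      forall d d' d'', loLe d d' -> loLe d' d'' -> loLe d d'' &
      forall d d', loM d -> loM d' -> loLe d d' \/ loLe d' d] /\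
  (forall v d d', loL v d d' -> [&& loV v, loM d & loM d']).

Definition under_car := {x : car A | loV x}.
Definition under_graph : structure :=
  @Structure under_car (fun i s => (i == 0) && srel A 1 (map val s)).
End LO.

Definition C_prim_star (C : structure -> Prop) (A : structure) : Prop :=
  [/\ is_LO_colored A, C (under_graph A), prime_graph (under_graph A) &
      4 <= #|car (under_graph A)|].

(* Main.v *)
Require Import Defs.
From mathcomp Require Import all_boot zify.
From Stdlib Require Import FunctionalExtensionality.
Import Defs.
(* Start from the partition of the vertices with a single class and refine it
   repeatedly: a class whose induced subgraph is disconnected splits into its
   components, one that is co-disconnected into its co-components, and any other
   one into its maximal proper modules.  After n steps all classes are singletons.
   Going back up, each class receives a canon, an isomorphic copy of its induced
   subgraph on an initial segment of the numbers.  The canon of a class is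
   concatenated from the canons of its blocks.  For components and co-components
   these are ordered lexicographically, ties being harmless because tied blocks
   have equal canons.  Otherwise the quotient is prime with at least 4 vertices and
   isomorphic to an induced subgraph; coloring each block with the edge relation of
   its canon turns it into a member of C*_prim, interpreted in G, and the given
   transduction orders the blocks while retaining the canon of each as its color.
   If it has parameters, those giving the least canon are used.  Throughout, it is
   not needed that isomorphic classes receive equal canons. *)

(** What has to be exhibited is a formula, yet hardly anything below manipulates formulas: a
    predicate on structures, relation variables and contexts is definable if some formula computes
    it, and everything is built from closure properties of this notion. Two obstacles shape the
    construction. Inflationary fixed points are the only recursion available, and their bodies need
    not be monotone; so a recursion along the numbers is simulated by rows that are written only
    when the previous row is complete, and the decomposition is organised by the number of
    refinement steps instead of a tree. Secondly, the transduction speaks about quotients, which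
    exist inside the graph only through codes: an element has several codes, and a quotient with its
    colours has more elements than the graph has numbers, so counting and number terms have to be
    translated with care. The bound 4 on the size of a prime quotient arises because, in a connected
    and co-connected class, every block has both an adjacent and a non-adjacent block. *)

Set Implicit Arguments.
Unset Strict Implicit.
Unset Printing Implicit Defensive.

(** * Semantic definability *)

Arguments matches {A}.
Arguments wsort {A} : simpl never.
Arguments elt {A}.
Arguments num {A}.
Arguments rv {A}.
Arguments set_elt {A}.
Arguments set_num {A}.
Arguments set_rv {A}.
Arguments lookup {A} : simpl nomatch.
Arguments assign1 {A}.
Arguments assign {A}.
Arguments env0 {A}.

Arguments eval : simpl never.
Arguments teval : simpl never.

Section EvalEquations.
Variables (tau : seq nat) (A : structure).
Implicit Types (e : env A) (f g : formula) (s t : nterm).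
Local Notation eval := (eval tau A).
Local Notation teval := (teval tau A).

Lemma eval_eqE x y e : eval (FEqE x y) e = oeq (elt e x) (elt e y).
Proof. by []. Qed.
Lemma eval_eqN s t e : eval (FEqN s t) e = oeq (teval s e) (teval t e).
Proof. by []. Qed.
Lemma eval_leN s t e : eval (FLeN s t) e =
  match teval s e, teval t e with Some i, Some j => (i <= j)%N | _, _ => false end.
Proof. by []. Qed.
Lemma eval_rel i xs e : eval (FRel i xs) e =
  let vs := map (elt e) xs in
  [&& i < size tau, size xs == arity tau i, all isSome vs & srel A i (pmap id vs)].
Proof. by []. Qed.
Lemma eval_rvar X vs e : eval (FRVar X vs) e =
  let ls := map (lookup e) vs in all isSome ls && rv e X (pmap id ls).
Proof. by []. Qed.
Lemma eval_not g e : eval (FNot g) e = ~~ eval g e. Proof. by []. Qed.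
Lemma eval_and f g e : eval (FAnd f g) e = eval f e && eval g e. Proof. by []. Qed.
Lemma eval_or f g e : eval (FOr f g) e = eval f e || eval g e. Proof. by []. Qed.
Lemma eval_exE x g e : eval (FExE x g) e = [exists a : car A, eval g (set_elt e x a)].
Proof. by []. Qed.
Lemma eval_exN p g e :
  eval (FExN p g) e = [exists i : 'I_#|car A|.+1, eval g (set_num e p i)].
Proof. by []. Qed.
Lemma teval_var p e : teval (TVar p) e = num e p. Proof. by []. Qed.
Lemma teval_count x f e :
  teval (TCount x f) e = Some (inord #|[pred a : car A | eval f (set_elt e x a)]|).
Proof. by []. Qed.

Definition ifp_step X us g e (P : seq (value A) -> bool) (t : seq (value A)) :=
  P t || (wsort (map fst us) t && eval g (assign (set_rv e X P) us t)).
Lemma eval_ifp X us g ws e : eval (FIfp X us g ws) e =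
  let ls := map (lookup e) ws in
  all isSome ls &&
  iter (#|car A|.+1 ^ size us) (ifp_step X us g e) (fun _ => false) (pmap id ls).
Proof. by []. Qed.
End EvalEquations.

Definition evalE := (eval_eqE, eval_eqN, eval_leN, eval_rel, eval_rvar, eval_not,
  eval_and, eval_or, eval_exE, eval_exN, teval_var, teval_count).

Definition rvs (A : structure) := nat -> seq (value A) -> bool.
Definition ctx (A : structure) := nat -> value A.

(** * Environments, contexts and variable names *)

Section Contexts.
Variable A : structure.
Implicit Types (c : ctx A) (e : env A) (ss us : seq sort) (t : seq (value A)).

(** Drop, take, push and prepend for infinite sequences. A context is total, so reading a variable
    never fails; which entries are meaningful is recorded by the list of sorts alone. *)
Fixpoint sh {T : Type} k (c : nat -> T) : nat -> T :=
  if k is k'.+1 then sh k' (fun i => c i.+1) else c.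
Fixpoint tk {T : Type} k (c : nat -> T) : seq T :=
  if k is k'.+1 then c 0 :: tk k' (fun i => c i.+1) else [::].
Definition scons {T : Type} (v : T) (c : nat -> T) : nat -> T :=
  fun i => if i is i'.+1 then c i' else v.
Fixpoint catc {T : Type} (ts : seq T) (c : nat -> T) : nat -> T :=
  if ts is t :: ts' then scons t (catc ts' c) else c.

Lemma shE T k (c : nat -> T) i : sh k c i = c (k + i).
Proof. by elim: k c => //= k IH c; rewrite IH addSn. Qed.
Lemma tkE T k (c : nat -> T) : tk k c = [seq c i | i <- iota 0 k].
Proof.
elim: k c => //= k IH c; rewrite IH; congr cons.
by rewrite -[in RHS]addn1 addnC iotaDl -map_comp; apply: eq_map.
Qed.
Lemma size_tk T k (c : nat -> T) : size (tk k c) = k.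
Proof. by rewrite tkE size_map size_iota. Qed.
Lemma tk_catc T (ts : seq T) (c : nat -> T) : tk (size ts) (catc ts c) = ts.
Proof. by elim: ts => //= t ts ->. Qed.
Lemma sh_catc T (ts : seq T) (c : nat -> T) : sh (size ts) (catc ts c) = c.
Proof. by elim: ts => //= t ts. Qed.
Lemma shD T a b (c : nat -> T) : sh (a + b) c = sh b (sh a c).
Proof. by elim: a c => //= a IH c. Qed.

Definition nv (v : value A) : nat := if v is inr i then i : nat else 0.
Definition ev (v : value A) : option (car A) := if v is inl x then Some x else None.
Definition nz : value A := inr ord0.
Definition nval (k : nat) : value A := inr (inord k).

(** A name is the height above the bottom of the context: index i of a block over [k] older
    variables is named [size us + k - i]. Prepending variables therefore never renames the older
    ones, and the name 0 stays free. *)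
Fixpoint stdb us (k : nat) : seq var :=
  if us is u :: us' then (u, (size us' + k).+1) :: stdb us' k else [::].

Lemma map_fst_stdb us k : map fst (stdb us k) = us.
Proof. by elim: us => //= u us ->. Qed.
Lemma size_stdb us k : size (stdb us k) = size us.
Proof. by rewrite -(size_map fst) map_fst_stdb. Qed.
Lemma stdb_cat us vs k : stdb (us ++ vs) k = stdb us (size vs + k) ++ stdb vs k.
Proof. by elim: us => //= u us ->; rewrite size_cat addnA. Qed.
Lemma stdb_bound us k v : v \in stdb us k -> k < v.2 <= size us + k.
Proof.
elim: us => //= u us IH; rewrite inE => /orP [/eqP -> /=|/IH]; first by lia.
by move=> /andP [-> h] /=; lia.
Qed.
Lemma uniq_stdb us k : uniq (stdb us k).
Proof.
elim: us => //= u us ->; rewrite andbT; apply/negP => /stdb_bound /=.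
by lia.
Qed.
Lemma nth_stdb us k i d : i < size us -> nth d (stdb us k) i = (nth SE us i, (size us + k - i)).
Proof.
elim: us i => //= u us IH [|i] h /=; first by rewrite subn0.
by rewrite IH // addSn subSS.
Qed.

Fixpoint ematch ss e c : Prop :=
  if ss is s :: ss' then
    [/\ matches s (c 0), lookup e (s, (size ss').+1) = Some (c 0) &
        ematch ss' e (fun i => c i.+1)]
  else num e 0 = Some ord0.

Definition rmatch (rs : seq (seq sort)) (ns : seq nat) e (r : rvs A) :=
  forall k, k < size rs -> forall ts, wsort (nth [::] rs k) ts ->
    rv e (nth 0 ns k) (nz :: ts) = r k ts.

Lemma wsort_cons s us v t : wsort (s :: us) (v :: t) = matches s v && wsort us t.
Proof. by rewrite /wsort /= eqSS andbCA. Qed.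
Lemma wsort_size us t : wsort us t -> size t = size us.
Proof. by case/andP => /eqP. Qed.
Lemma wsort_cat us us' t t' : size t = size us ->
  wsort (us ++ us') (t ++ t') = wsort us t && wsort us' t'.
Proof.
elim: us t => [|u us IH] [|v t] //= [h].
by rewrite !wsort_cons IH // andbA.
Qed.

Lemma ematch_num0 ss e c : ematch ss e c -> num e 0 = Some ord0.
Proof. by elim: ss c => //= s ss IH c [_ _ /IH]. Qed.

Lemma ematch_ext ss e e' c :
  num e 0 = num e' 0 ->
  (forall v : var, 0 < v.2 <= size ss -> lookup e v = lookup e' v) ->
  ematch ss e c -> ematch ss e' c.
Proof.
move=> h0; elim: ss c => [|s ss IH] c h /=; first by rewrite h0.
case=> h1 h2 h3; split=> //.
  by rewrite -h //= ltnSn.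
apply: IH => // v hv; apply: h; move: hv => /=; lia.
Qed.

Lemma lookup_assign1 e v w (a : value A) : w != v -> lookup (assign1 e w a) v = lookup e v.
Proof.
case: w => [[] x]; case: a => a; case: v => [[] y] //= h; case: eqP => // E;
  by rewrite E eqxx in h.
Qed.
Lemma num0_assign1 e w (a : value A) : 0 < w.2 -> num (assign1 e w a) 0 = num e 0.
Proof. by case: w => [[] [|x]]; case: a => a. Qed.
Lemma ematch_assign1 ss e c w a : size ss < w.2 -> ematch ss e c -> ematch ss (assign1 e w a) c.
Proof.
move=> h; apply: ematch_ext; first by rewrite num0_assign1 //; lia.
move=> v hv; rewrite lookup_assign1 //; apply/eqP => E; subst; lia.
Qed.

Lemma assign_cons e v vs a t : assign e (v :: vs) (a :: t) = assign (assign1 e v a) vs t.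
Proof. by []. Qed.
Lemma lookup_assign e vs v t : v \notin vs -> lookup (assign e vs t) v = lookup e v.
Proof.
elim: vs t e => [|w vs IH] [|a t] e //=; rewrite inE negb_or => /andP [h1 h2].
by rewrite assign_cons IH // lookup_assign1 // eq_sym.
Qed.
Lemma lookup_assign1_eq e w (a : value A) : matches w.1 a -> lookup (assign1 e w a) w = Some a.
Proof. by case: w => [[] x]; case: a => a //= _; rewrite eqxx. Qed.

Lemma rv_assign1 e w (a : value A) : rv (assign1 e w a) = rv e.
Proof. by case: w => [[] x]; case: a => a. Qed.
Lemma rv_assign e vs t : rv (assign e vs t) = rv e.
Proof.
by elim: vs t e => [|w vs IH] [|a t] e //=; rewrite /assign /= IH rv_assign1.
Qed.

Lemma ematch_assign ss e c us t : ematch ss e c -> wsort us t ->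
  ematch (us ++ ss) (assign e (stdb us (size ss)) t) (catc t c).
Proof.
elim: us t e => [|u us IH] [|a t] e h //.
rewrite wsort_cons => /andP [ha ht] /=.
rewrite size_cat; split=> //; last first.
  apply: (IH t) => //; apply: ematch_assign1 => //=; lia.
rewrite assign_cons lookup_assign.
  by apply: lookup_assign1_eq.
by apply/negP => /stdb_bound /=; lia.
Qed.

Lemma ematch_rv ss e c X P : ematch ss e c -> ematch ss (set_rv e X P) c.
Proof. by apply: ematch_ext => // [[[] y]]. Qed.

Lemma ematch_lookup ss e c i : ematch ss e c -> i < size ss ->
  matches (nth SE ss i) (c i) /\ lookup e (nth SE ss i, size ss - i) = Some (c i).
Proof.
elim: ss c i => //= s ss IH c [|i] [h1 h2 h3] hi; first by rewrite subn0.
by rewrite subSS; apply: (IH (fun i => c i.+1)).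
Qed.

Lemma rmatch_eq rs ns e e' r : rv e = rv e' -> rmatch rs ns e r -> rmatch rs ns e' r.
Proof. by move=> h H k hk ts hts; rewrite -h H. Qed.
Definition fresh (ns : seq nat) := (\max_(n <- ns) n).+1.
Lemma fresh_nth ns k : k < size ns -> nth 0 ns k != fresh ns.
Proof.
move=> hk; rewrite neq_ltn /fresh ltnS.
by rewrite (big_nth 0) big_mkord (leq_bigmax (Ordinal hk)).
Qed.
Lemma rmatch_push us rs ns e r P Q : size ns = size rs -> rmatch rs ns e r ->
  (forall ts, wsort us ts -> P (nz :: ts) = Q ts) ->
  rmatch (us :: rs) (fresh ns :: ns) (set_rv e (fresh ns) P) (scons Q r).
Proof.
move=> hsz H hP [|k] /= hk ts hts; first by rewrite eqxx hP.
by rewrite (negPf (fresh_nth _)) ?hsz //; apply: H.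
Qed.

End Contexts.

Arguments tk {T}.
Arguments sh {T}.
Arguments nz {A}.

Definition exV (A : structure) (s : sort) (P : value A -> bool) : bool :=
  match s with SE => [exists a : car A, P (inl a)]
             | SN => [exists i : 'I_#|car A|.+1, P (inr i)] end.
Definition allV A s (P : value A -> bool) := ~~ exV s (fun x => ~~ P x).
Arguments exV {A} : simpl never.
Arguments allV {A} : simpl never.
Lemma exVP A s (P : value A -> bool) :
  reflect (exists2 v, matches s v & P v) (exV s P).
Proof.
rewrite /exV; case: s; apply: (iffP existsP) => [[a h]|[[a|a] // _ h]];
  by [exists (inl a) | exists (inr a) | exists a].
Qed.
Lemma allVP A s (P : value A -> bool) :
  reflect (forall v, matches s v -> P v) (allV s P).
Proof.
apply: (iffP negP) => [h v hv|h /exVP [v hv]]; last by rewrite h.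
by apply/negPn/negP => hn; apply: h; apply/exVP; exists v.
Qed.

(** The head of the block is quantified innermost, because it is the newest variable of the context
    [us ++ ss]. *)
Fixpoint exS (A : structure) (us : seq sort) (Q : seq (value A) -> bool) : bool :=
  if us is u :: us' then exS us' (fun ts => exV u (fun a => Q (a :: ts))) else Q [::].
Definition allS A us (Q : seq (value A) -> bool) := ~~ exS us (fun x => ~~ Q x).
Lemma exSP A us (Q : seq (value A) -> bool) :
  reflect (exists2 ts, wsort us ts & Q ts) (exS us Q).
Proof.
elim: us Q => [|u us IH] Q /=.
  apply: (iffP idP) => [h|[[|a t]]]; first by exists [::].
    by [].
  by [].
apply: (iffP (IH _)) => [[ts h1 /exVP [a ha h2]]|[[|a ts] //]].
  by exists (a :: ts); rewrite ?wsort_cons ?ha.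
by rewrite wsort_cons => /andP [ha hts] h; exists ts => //; apply/exVP; exists a.
Qed.
Lemma allSP A us (Q : seq (value A) -> bool) :
  reflect (forall ts, wsort us ts -> Q ts) (allS us Q).
Proof.
apply: (iffP negP) => [h v hv|h /exSP [v hv]]; last by rewrite h.
by apply/negPn/negP => hn; apply: h; apply/exSP; exists v.
Qed.

Definition relV (A : structure) k (vs : seq (value A)) := srel A k (pmap (@ev A) vs).
Definition cntE (A : structure) (P : value A -> bool) := #|[pred a : car A | P (inl a)]|.
Arguments cntE {A} : simpl never.
Arguments relV {A} : simpl never.
Arguments nv {A} : simpl never.
Arguments exS {A} : simpl never.
Arguments allS {A} : simpl never.

(** * Definable predicates and their first-order closure properties *)

Section Definability.
Variable tau : seq nat.

(* Contexts are de Bruijn: index 0 is the newest variable, whose name is the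
   length of the context.  The number variable 0 is reserved and always denotes
   the number 0.  Relation variables have an extra leading column, read at 0 only;
   def_let uses the other rows as scratch space. *)
Inductive Def rs ss (Phi : forall A, rvs A -> ctx A -> bool) : Prop := DefI of
  forall ns, size ns = size rs ->
  exists2 f, {subset fv f <= (SN, 0) :: stdb ss 0} &
  forall A e r c, 0 < #|car A| -> ematch ss e c -> rmatch rs ns e r ->
    eval tau A f e = Phi A r c.

Lemma def_eq rs ss (P Q : forall A, rvs A -> ctx A -> bool) :
  (forall A r c, 0 < #|car A| -> (forall i, i < size ss -> matches (nth SE ss i) (c i)) ->
     P A r c = Q A r c) ->
  Def rs ss P -> Def rs ss Q.
Proof.
move=> h [hf]; split=> ns hns; have [f f1 f2] := hf ns hns; exists f => // A e r c hA he hr; rewrite (f2 A e r c) // h //.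
by move=> i hi; case: (ematch_lookup he hi).
Qed.

Lemma def_and rs ss (P Q : forall A, rvs A -> ctx A -> bool) :
  Def rs ss P -> Def rs ss Q -> Def rs ss (fun A r c => P A r c && Q A r c).
Proof.
move=> [hf] [hg]; split=> ns hns; have [f f1 f2] := hf ns hns; have [g g1 g2] := hg ns hns; exists (FAnd f g) => [v|A e r c hA he hr].
  by rewrite /= mem_cat => /orP [/f1|/g1].
by rewrite evalE (f2 A e r c) // (g2 A e r c).
Qed.
Lemma def_or rs ss (P Q : forall A, rvs A -> ctx A -> bool) :
  Def rs ss P -> Def rs ss Q -> Def rs ss (fun A r c => P A r c || Q A r c).
Proof.
move=> [hf] [hg]; split=> ns hns; have [f f1 f2] := hf ns hns; have [g g1 g2] := hg ns hns; exists (FOr f g) => [v|A e r c hA he hr].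
  by rewrite /= mem_cat => /orP [/f1|/g1].
by rewrite evalE (f2 A e r c) // (g2 A e r c).
Qed.
Lemma def_not rs ss (P : forall A, rvs A -> ctx A -> bool) :
  Def rs ss P -> Def rs ss (fun A r c => ~~ P A r c).
Proof.
move=> [hf]; split=> ns hns; have [f f1 f2] := hf ns hns; exists (FNot f) => // A e r c hA he hr.
by rewrite evalE (f2 A e r c).
Qed.
Lemma def_imp rs ss (P Q : forall A, rvs A -> ctx A -> bool) :
  Def rs ss P -> Def rs ss Q -> Def rs ss (fun A r c => P A r c ==> Q A r c).
Proof.
move=> hP hQ; apply: (@def_eq _ _ (fun A r c => ~~ P A r c || Q A r c)) => [A r c _ _|].
  by rewrite implybE.
by apply: def_or => //; apply: def_not.
Qed.
Lemma def_eqb rs ss (P Q : forall A, rvs A -> ctx A -> bool) :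
  Def rs ss P -> Def rs ss Q -> Def rs ss (fun A r c => P A r c == Q A r c).
Proof.
move=> hP hQ.
apply: (@def_eq _ _ (fun A r c => (P A r c ==> Q A r c) && (Q A r c ==> P A r c))).
  by move=> A r c _ _; case: (P A r c); case: (Q A r c).
by apply: def_and; apply: def_imp.
Qed.
Lemma def_if rs ss (B P Q : forall A, rvs A -> ctx A -> bool) :
  Def rs ss B -> Def rs ss P -> Def rs ss Q ->
  Def rs ss (fun A r c => if B A r c then P A r c else Q A r c).
Proof.
move=> hB hP hQ.
apply: (@def_eq _ _ (fun A r c => (B A r c && P A r c) || (~~ B A r c && Q A r c))).
  by move=> A r c _ _; case: (B A r c) => //=; rewrite orbF.
by apply: def_or; apply: def_and => //; apply: def_not.
Qed.
Lemma def_true rs ss : Def rs ss (fun _ _ _ => true).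
Proof.
split=> ns hns; exists (FEqN (TVar 0) (TVar 0)) => [v|A e r c hA he hr].
  by rewrite /= !inE orbb => ->.
by rewrite !evalE (ematch_num0 he) /= eqxx.
Qed.
Lemma def_false rs ss : Def rs ss (fun _ _ _ => false).
Proof. exact: (def_not (def_true rs ss)). Qed.
Lemma def_cst rs ss (b : bool) : Def rs ss (fun _ _ _ => b).
Proof. by case: b; [exact: def_true | exact: def_false]. Qed.

Lemma sub_filter_fresh (s : sort) x (vs l : seq var) :
  {subset vs <= (SN, 0) :: (s, x) :: l} -> 
  {subset filter (predC1 (s, x)) vs <= (SN, 0) :: l}.
Proof.
move=> h v; rewrite mem_filter /= => /andP [h1 /h]; rewrite !inE.
by case/or3P => [->|E|->] //; rewrite ?orbT //; rewrite E in h1.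
Qed.

Lemma def_exV rs ss s (P : forall A, rvs A -> ctx A -> value A -> bool) :
  Def rs (s :: ss) (fun A r c => P A r (fun i => c i.+1) (c 0)) ->
  Def rs ss (fun A r c => exV s (P A r c)).
Proof.
move=> [hf]; split=> ns hns; have [f f1 f2] := hf ns hns.
case: s {hf} f1 f2 => f1 f2.
  exists (FExE (size ss).+1 f) => [|A e r c hA he hr].
    by apply: sub_filter_fresh; rewrite -[X in (SE, X.+1)]addn0.
  rewrite evalE; apply: eq_existsb => a.
  by rewrite (f2 A _ r (scons (inl a) c)) //=; split=> //=; [rewrite eqxx |
    apply: (@ematch_assign1 _ _ _ _ (SE, _) (inl a))].
exists (FExN (size ss).+1 f) => [|A e r c hA he hr].
  by apply: sub_filter_fresh; rewrite -[X in (SN, X.+1)]addn0.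
rewrite evalE; apply: eq_existsb => a.
by rewrite (f2 A _ r (scons (inr a) c)) //=; split=> //=; [rewrite eqxx |
    apply: (@ematch_assign1 _ _ _ _ (SN, _) (inr a))].
Qed.
Lemma def_allV rs ss s (P : forall A, rvs A -> ctx A -> value A -> bool) :
  Def rs (s :: ss) (fun A r c => P A r (fun i => c i.+1) (c 0)) ->
  Def rs ss (fun A r c => allV s (P A r c)).
Proof. by move=> h; apply: def_not; apply: def_exV; apply: def_not. Qed.

Lemma def_exS rs ss us (P : forall A, rvs A -> ctx A -> seq (value A) -> bool) :
  Def rs (us ++ ss) (fun A r c => P A r (sh (size us) c) (tk (size us) c)) ->
  Def rs ss (fun A r c => exS us (P A r c)).
Proof.
elim: us ss P => [|u us IH] ss P //= h.
apply: (IH _ (fun A r c ts => exV u (fun a => P A r c (a :: ts)))).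
by apply: (@def_exV _ _ _ (fun A r c a => P A r (sh (size us) c) (a :: tk (size us) c))).
Qed.
Lemma def_allS rs ss us (P : forall A, rvs A -> ctx A -> seq (value A) -> bool) :
  Def rs (us ++ ss) (fun A r c => P A r (sh (size us) c) (tk (size us) c)) ->
  Def rs ss (fun A r c => allS us (P A r c)).
Proof.
by move=> h; apply/def_not/(@def_exS _ _ _ (fun A r c ts => ~~ P A r c ts))/def_not.
Qed.

Lemma mem_std ss i : i < size ss -> (nth SE ss i, size ss - i) \in stdb ss 0.
Proof. by move=> h; rewrite -[size ss]addn0 -(nth_stdb 0 (SE, 0) h) mem_nth // size_stdb. Qed.

Definition isv ss s i := (i < size ss) && (nth SE ss i == s).

Lemma isvP A ss s i (e : env A) c : isv ss s i -> ematch ss e c ->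
  matches s (c i) /\ lookup e (s, size ss - i) = Some (c i).
Proof. by case/andP => h1 /eqP <- h; apply: ematch_lookup. Qed.
Lemma isv_mem ss s i : isv ss s i -> (s, size ss - i) \in (SN, 0) :: stdb ss 0.
Proof. by case/andP => h1 /eqP <-; rewrite inE mem_std ?orbT. Qed.

Lemma isvN A ss i (e : env A) c : isv ss SN i -> ematch ss e c ->
  exists2 a, num e (size ss - i) = Some a & nv (c i) = a.
Proof.
move=> h /(isvP h) [] /=; case: (c i) => //= a _; case: (num e _) => //= b [<-].
by exists b.
Qed.

Lemma def_le rs ss i j : isv ss SN i && isv ss SN j ->
  Def rs ss (fun A r c => nv (c i) <= nv (c j)).
Proof.
move=> /andP [hi hj]; split=> ns hns; exists (FLeN (TVar (size ss - i)) (TVar (size ss - j))) => [v|A e r c hA he hr].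
  by rewrite /= !mem_seq2 => /orP [] /eqP ->; apply: isv_mem.
by rewrite !evalE; have [a -> ->] := isvN hi he; have [b -> ->] := isvN hj he.
Qed.
Lemma def_lt rs ss i j : isv ss SN i && isv ss SN j ->
  Def rs ss (fun A r c => nv (c i) < nv (c j)).
Proof.
move=> h; apply: (@def_eq _ _ (fun A r c => ~~ (nv (c j) <= nv (c i)))).
  by move=> *; rewrite ltnNge.
by apply: def_not; apply: def_le; rewrite andbC.
Qed.
Lemma def_eqn rs ss i j : isv ss SN i && isv ss SN j ->
  Def rs ss (fun A r c => nv (c i) == nv (c j)).
Proof.
move=> h; apply: (@def_eq _ _ (fun A r c => (nv (c i) <= nv (c j)) && (nv (c j) <= nv (c i)))).
  by move=> *; rewrite eqn_leq.
by apply: def_and; apply: def_le => //; rewrite andbC.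
Qed.
Lemma def_eq0 rs ss i : isv ss SN i -> Def rs ss (fun A r c => nv (c i) == 0).
Proof.
move=> hi; split=> ns hns; exists (FEqN (TVar (size ss - i)) (TVar 0)) => [v|A e r c hA he hr].
  by rewrite /= !mem_seq2 => /orP [] /eqP ->; [apply: isv_mem | rewrite inE eqxx].
by rewrite !evalE; have [a -> ->] := isvN hi he; rewrite (ematch_num0 he).
Qed.
Lemma def_eqv rs ss i j : isv ss SE i && isv ss SE j -> Def rs ss (fun A r c => c i == c j).
Proof.
move=> /andP [hi hj]; split=> ns hns; exists (FEqE (size ss - i) (size ss - j)) => [v|A e r c hA he hr].
  by rewrite /= !mem_seq2 => /orP [] /eqP ->; apply: isv_mem.
rewrite evalE; have [_] := isvP hi he; have [_] := isvP hj he => /=.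
case: (elt e (size ss - j)) => //= y [<-]; case: (elt e (size ss - i)) => //= x [<-].
by apply/eqP/eqP => [->|[]].
Qed.
Lemma def_relV rs ss k (is_ : seq nat) :
  [&& k < size tau, size is_ == arity tau k & all (isv ss SE) is_] ->
  Def rs ss (fun A r c => relV k [seq c i | i <- is_]).
Proof.
move=> /and3P [h1 h2 h3]; split=> ns hns; exists (FRel k [seq size ss - i | i <- is_]) => [v /=|A e r c hA he hr].
  rewrite -map_comp => /mapP [i /(allP h3) hi ->]; exact: isv_mem.
rewrite evalE /= h1 size_map h2 -map_comp /=.
rewrite (_ : map _ is_ = [seq ev (c i) | i <- is_]); last first.
  apply/eq_in_map => i /(allP h3) hi /=; have := isvP hi he => /=.
  by case: (elt e _) => [a|] [] //= _ [<-].
have -> : all isSome [seq ev (c i) | i <- is_].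
  rewrite all_map; apply/allP => i /(allP h3) hi /=; have := isvP hi he => /=.
  by case: (elt e _) => [a|] [] //= _ [<-].
by rewrite /relV; congr srel; elim: is_ {h1 h2 h3} => //= a s <-; case: (ev (c a)).
Qed.

Lemma def_rv rs ss k (is_ : seq nat) :
  [&& k < size rs, nth [::] rs k == map (nth SE ss) is_ & all (fun i => i < size ss) is_] ->
  Def rs ss (fun A r c => r k [seq c i | i <- is_]).
Proof.
move=> /and3P [h1 /eqP h2 h3]; split=> ns hns.
exists (FRVar (nth 0 ns k) ((SN, 0) :: [seq (nth SE ss i, size ss - i) | i <- is_])).
  move=> v /=; rewrite inE => /orP [/eqP ->|/mapP [i /(allP h3) hi ->]]; first by rewrite inE eqxx.
  by rewrite inE mem_std ?orbT.
move=> A e r c hA he hr; rewrite evalE /= (ematch_num0 he) /=.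
have -> : [seq lookup e i | i <- [seq (nth SE ss i, size ss - i) | i <- is_]] = [seq Some (c i) | i <- is_].
  rewrite -map_comp; apply/eq_in_map => i /(allP h3) hi /=.
  by have [_ ->] := ematch_lookup he hi.
rewrite all_map (_ : all _ _ = true) /=; last by apply/allP.
rewrite (_ : pmap id _ = [seq c i | i <- is_]); last by elim: is_ {h2 h3} => //= a s ->.
apply: hr => //; rewrite h2 /wsort !size_map eqxx /=.
elim: is_ h3 {h2} => //= i s IH /andP [hi hs]; rewrite IH // andbT.
by case: (ematch_lookup he hi).
Qed.

Lemma def_cnt rs ss (P : forall A, rvs A -> ctx A -> value A -> bool) i :
  isv ss SN i ->
  Def rs (SE :: ss) (fun A r c => P A r (fun i => c i.+1) (c 0)) ->
  Def rs ss (fun A r c => cntE (P A r c) == nv (c i)).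
Proof.
move=> hi [hf]; split=> ns hns; have [f f1 f2] := hf ns hns; exists (FEqN (TCount (size ss).+1 f) (TVar (size ss - i))).
  move=> v; rewrite /= mem_cat => /orP [|].
    by move: v; apply: sub_filter_fresh; rewrite -[X in (SE, X.+1)]addn0.
  by rewrite inE => /eqP ->; apply: isv_mem.
move=> A e r c hA he hr; rewrite !evalE; have [a -> ->] := isvN hi he.
have -> : #|[pred x | eval tau A f (set_elt e (size ss).+1 x)]| = cntE (P A r c).
  apply: eq_card => x; rewrite !inE.
  by rewrite (f2 A _ r (scons (inl x) c)) //=; split=> //=; [rewrite eqxx |
    apply: (@ematch_assign1 _ _ _ _ (SE, _) (inl x))].
by rewrite /oeq -val_eqE /= inordK // ltnS /cntE; exact: max_card.
Qed.

(** [Def] provides a formula for every list of names, so instead of renaming inside a formula the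
    definition is instantiated at the names selected by [g]. *)
Lemma def_rename (g : nat -> nat) rs rs' ss (P : forall A, rvs A -> ctx A -> bool) :
  (forall k, k < size rs -> g k < size rs' /\ nth [::] rs' (g k) = nth [::] rs k) ->
  Def rs ss P -> Def rs' ss (fun A r c => P A (fun k => r (g k)) c).
Proof.
move=> h [hf]; split=> ns hns.
have [|f f1 f2] := hf [seq nth 0 ns (g k) | k <- iota 0 (size rs)]; first by rewrite size_map size_iota.
exists f => // A e r c hA he hr; apply: f2 => // k hk ts hts; have [h1 h2] := h k hk.
by rewrite (nth_map 0) ?size_iota // nth_iota // add0n hr // h2.
Qed.
Lemma def_weaken us rs ss (P : forall A, rvs A -> ctx A -> bool) :
  Def rs ss P -> Def (us :: rs) ss (fun A r c => P A (fun k => r k.+1) c).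
Proof.
move=> [hf]; split=> [[|n ns]] //= [hns]; have [f f1 f2] := hf ns hns; exists f => // A e r c hA he hr.
by apply: f2 => // k; apply: (hr k.+1).
Qed.

End Definability.

(** * Stages of inflationary fixed points *)

Section Inflation.
Variables (A : structure) (us : seq sort).
Implicit Types (P : seq (value A) -> bool) (t : seq (value A)).

Definition stepV (B : (seq (value A) -> bool) -> seq (value A) -> bool) P t :=
  P t || (wsort us t && B P t).
Definition stage B j := iter j (stepV B) (fun _ => false).
Arguments stage : simpl never.
(** The exponent exceeds the arity by one because the formulas below carry an additional leading
    column; this is the number of stages that they run. *)
Definition ifpV B := stage B (#|car A|.+1 ^ (size us).+1).

Definition sort_values (s : sort) : seq (value A) :=
  if s is SE then [seq inl x | x : car A] else [seq inr i | i : 'I_#|car A|.+1].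
Fixpoint sorted_tuples (vs : seq sort) : seq (seq (value A)) :=
  if vs is s :: vs' then allpairs cons (sort_values s) (sorted_tuples vs') else [:: [::]].

Lemma mem_sorted_tuples vs t : wsort vs t -> t \in sorted_tuples vs.
Proof.
elim: vs t => [|s vs IH] [|a t] //; rewrite wsort_cons => /andP [ha ht] /=.
apply/allpairsP; exists (a, t); split; rewrite ?IH //=.
by case: s a ha => [] [] a //= _; apply/imageP; exists a.
Qed.
Lemma size_sorted_tuples vs : size (sorted_tuples vs) <= #|car A|.+1 ^ size vs.
Proof.
elim: vs => //= s vs IH; rewrite size_allpairs expnS; apply: leq_mul => //.
by case: s; rewrite /= size_map -cardT ?card_ord.
Qed.

Variable B : (seq (value A) -> bool) -> seq (value A) -> bool.

Lemma stage_iter j : stage B j.+1 = stepV B (stage B j). Proof. by []. Qed.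
Lemma stageS j t : stage B j.+1 t = stage B j t || (wsort us t && B (stage B j) t).
Proof. by []. Qed.
Lemma stage_wsort j t : stage B j t -> wsort us t.
Proof. by elim: j => // j IH; rewrite stageS => /orP [/IH|/andP []]. Qed.
Lemma stage_leS i j t : i <= j -> stage B i t -> stage B j t.
Proof.
move=> /subnK <-; elim: (j - i) => // k IH h; rewrite addSn stageS IH //.
Qed.

(** As long as no stage has repeated, each one contributes a new tuple, so stage j + 1 has more than
    j of them; the number of well-sorted tuples bounds this. Once two consecutive stages agree, all
    later ones do. *)
Lemma stage_stable : stage B (#|car A|.+1 ^ size us).+1 = stage B (#|car A|.+1 ^ size us).
Proof.
have H j : stage B j.+1 = stage B j \/ j < count (stage B j.+1) (sorted_tuples us).
  elim: j => [|j [E|IH]]; last 1 first.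
  - case: (boolP (all (fun t => stage B j.+2 t == stage B j.+1 t) (sorted_tuples us))) => h.
      left; apply: functional_extensionality => t.
      case: (boolP (wsort us t)) => ht.
        by have /eqP := allP h _ (mem_sorted_tuples ht).
      by apply/idP/idP => /stage_wsort; rewrite (negPf ht).
    right; move: h => /allPn [t ht hne].
    have {hne} hs : stage B j.+2 t && ~~ stage B j.+1 t.
      by move: hne; case h1: (stage B j.+1 t); rewrite ?(stage_leS _ h1) //; case: (stage _ _ _).
    apply: (leq_ltn_trans IH); move: ht hs; elim: (sorted_tuples us) => //= t' L IL.
    rewrite inE => /orP [/eqP <- /andP [-> /negPf ->]|h1 h2].
      rewrite add0n add1n ltnS; apply: sub_count => x; exact: stage_leS (leqnSn _).
    have hle : (stage B j.+1 t' : nat) <= stage B j.+2 t'.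
      by case h: (stage B j.+1 t') => //; rewrite (stage_leS _ h).
    by have := IL h1 h2; lia.
  - by case: (boolP (has (stage B 1) (sorted_tuples us))) => h;
      [right; rewrite -has_count | left; apply: functional_extensionality => t;
       apply: contraNF h => ht; apply/hasP; exists t => //;
       apply: mem_sorted_tuples; apply: stage_wsort ht].
  - by left; rewrite stage_iter E.
have [h|h] := H (size (sorted_tuples us)); last first.
  by have := count_size (stage B (size (sorted_tuples us)).+1) (sorted_tuples us); lia.
have := size_sorted_tuples us => /subnK <-.
elim: (_ - _) => [|k IH]; first by rewrite add0n.
by rewrite !addSn stage_iter IH.
Qed.

Lemma stage_ge K : #|car A|.+1 ^ size us <= K -> stage B K = stage B (#|car A|.+1 ^ size us).
Proof.
move=> /subnK <-; elim: (_ - _) => [|k IH]; first by rewrite add0n.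
by rewrite addSn stage_iter IH; exact: stage_stable.
Qed.
Lemma ifpVE : ifpV B = stage B (#|car A|.+1 ^ size us).
Proof. by apply: stage_ge; rewrite leq_pexp2l. Qed.
Lemma ifpV_fix t : wsort us t -> B (ifpV B) t -> ifpV B t.
Proof.
by rewrite ifpVE => h1 h2; rewrite -stage_stable stageS h1 h2 orbT.
Qed.
End Inflation.
Arguments ifpV {A} : simpl never.
Arguments stage {A} : simpl never.


(** * Definability of fixed points and of local definitions *)

Section Fixpoints.
Variable tau : seq nat.
Local Notation Def := (Def tau).


Lemma map_lookup_block A us ss (e : env A) c : ematch (us ++ ss) e c ->
  [seq lookup e v | v <- stdb us (size ss)] = [seq Some v | v <- tk (size us) c].
Proof.
elim: us c => //= u us IH c [h1 h2 h3]; rewrite size_cat in h2.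
by rewrite (IH _ h3) h2.
Qed.
Lemma all_isSome_map T (s : seq T) : all isSome [seq Some v | v <- s].
Proof. by elim: s. Qed.
Lemma pmap_Some_map T (s : seq T) : pmap id [seq Some v | v <- s] = s.
Proof. by elim: s => //= a s ->. Qed.
Lemma wsort_tk A us ss (e : env A) c : ematch (us ++ ss) e c -> wsort us (tk (size us) c).
Proof.
elim: us c => //= u us IH c [h1 h2 h3]; by rewrite wsort_cons h1; apply: (IH (fun i => c i.+1)).
Qed.
Lemma ematch_sh A us ss (e : env A) c : ematch (us ++ ss) e c -> ematch ss e (sh (size us) c).
Proof. by elim: us c => //= u us IH c [_ _]; apply: IH. Qed.
Lemma stdb_sub us ss : {subset stdb us (size ss) <= (SN, 0) :: stdb (us ++ ss) 0}.
Proof. by move=> v h; rewrite inE stdb_cat mem_cat addn0 h orbT. Qed.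
Lemma stdb_sub_r us ss : {subset stdb ss 0 <= stdb (us ++ ss) 0}.
Proof. by move=> v h; rewrite stdb_cat mem_cat h orbT. Qed.
Lemma fv_weaken us ss f : {subset fv f <= (SN,0) :: stdb ss 0} ->
  {subset fv f <= (SN,0) :: stdb (us ++ ss) 0}.
Proof.
by move=> h v /h; rewrite !inE => /orP [->|/(@stdb_sub_r us) ->]; rewrite ?orbT.
Qed.

Lemma fv_ifp_sub X us g ws (L : seq var) :
  {subset fv g <= us ++ L} -> {subset ws <= L} -> {subset fv (FIfp X us g ws) <= L}.
Proof.
move=> h1 h2 v; rewrite mem_cat mem_filter => /orP [/andP [h /h1]|/h2 //].
by rewrite mem_cat (negPf h).
Qed.
Lemma fv_and_sub f g (L : seq var) : {subset fv f <= L} -> {subset fv g <= L} ->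
  {subset fv (FAnd f g) <= L}.
Proof. by move=> h1 h2 v; rewrite mem_cat => /orP [/h1|/h2]. Qed.
Lemma fv_or_sub f g (L : seq var) : {subset fv f <= L} -> {subset fv g <= L} ->
  {subset fv (FOr f g) <= L}.
Proof. exact: fv_and_sub. Qed.
Lemma fv_eqN_sub i j (L : seq var) : (SN, i) \in L -> (SN, j) \in L ->
  {subset fv (FEqN (TVar i) (TVar j)) <= L}.
Proof. by move=> h1 h2 v; rewrite !inE => /orP [] /eqP ->. Qed.

(** The leading column gets a variable [K] beyond the context, and the body forces it to be 0. Thus
    the relation is written only in row 0, the row in which [rmatch] reads it. The names of the
    block [us] serve both as bound variables and as arguments. *)
Lemma def_ifp rs ss us
  (B : forall A, rvs A -> ctx A -> (seq (value A) -> bool) -> seq (value A) -> bool) :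
  Def (us :: rs) (us ++ ss) (fun A r c =>
     B A (fun k => r k.+1) (sh (size us) c) (r 0) (tk (size us) c)) ->
  Def rs (us ++ ss) (fun A r c => ifpV us (B A r (sh (size us) c)) (tk (size us) c)).
Proof.
move=> [hB]; split=> ns hns; have [|f f1 f2] := hB (fresh ns :: ns); first by rewrite /= hns.
set bl := stdb us (size ss); set K := (size us + size ss).+1.
exists (FIfp (fresh ns) ((SN, K) :: bl) (FAnd (FEqN (TVar K) (TVar 0)) f) ((SN, 0) :: bl)).
  apply: fv_ifp_sub => [|v]; last first.
    by rewrite inE => /orP [/eqP ->|/stdb_sub //]; rewrite inE eqxx.
  apply: fv_and_sub => [|v /f1].
    by apply: fv_eqN_sub; rewrite !inE ?mem_cat ?inE ?eqxx ?orbT.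
  by rewrite mem_cat => ->; rewrite orbT.
move=> A e r c hA he hr.
have hsz : size bl = size us by apply: size_stdb.
rewrite eval_ifp /= (ematch_num0 he) (map_lookup_block he) /= all_isSome_map pmap_Some_map /= hsz.
rewrite /ifpV.
have hus := wsort_tk he.
have H j x ts : iter j (@ifp_step tau A (fresh ns) ((SN, K) :: bl)
    (FAnd (FEqN (TVar K) (TVar 0)) f) e) (fun _ => false) (x :: ts) =
   (x == nz) && stage us (B A r (sh (size us) c)) j ts.
  elim: j x ts => [|j IH] x ts; first by rewrite andbF.
  rewrite iterS {1}/ifp_step IH stageS andb_orr; congr orb.
  rewrite (_ : map fst _ = SN :: us) /=; last by rewrite map_fst_stdb.
  rewrite wsort_cons; case: x => [x|x] //=.
  case: (boolP (wsort us ts)) => hts; rewrite /= ?andbF //.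
  set P := iter j _ _.
  rewrite !evalE assign_cons /=.
  have he1 : ematch (us ++ ss) (assign (set_num (set_rv e (fresh ns) P) K x) bl ts)
              (catc ts (sh (size us) c)).
    apply: ematch_assign => //; apply: (@ematch_assign1 _ _ _ _ (SN, K) (inr x)) => /=.
      by rewrite /K; lia.
    by apply: ematch_rv; apply: ematch_sh he.
  rewrite (ematch_num0 he1).
  have -> : num (assign (set_num (set_rv e (fresh ns) P) K x) bl ts) K = Some x.
    have : lookup (assign (set_num (set_rv e (fresh ns) P) K x) bl ts) (SN, K) = Some (inr x).
      by rewrite lookup_assign /= ?eqxx //; apply/negP => /stdb_bound /=; rewrite /K; lia.
    by rewrite /=; case: (num _ K) => //= y [->].
  rewrite [oeq _ _]/=; congr andb.
  rewrite (f2 A _ (scons (stage us (B A r (sh (size us) c)) j) r) (catc ts (sh (size us) c))) //=.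
    by rewrite -(wsort_size hts) sh_catc tk_catc.
  apply: (rmatch_eq (e := set_rv e (fresh ns) P)); first by rewrite rv_assign.
  by apply: rmatch_push => // t ht; rewrite /P IH eqxx.
by rewrite H eqxx.
Qed.

(* There is no substitution of formulas: a single fixed point with a flag column
   first collects Q in the rows flagged 0, and evaluates P in the other rows once
   the rows flagged 0 contain Q. *)
Lemma def_let rs ss us
  (P : forall A, rvs A -> ctx A -> (seq (value A) -> bool) -> bool)
  (Q : forall A, rvs A -> ctx A -> seq (value A) -> bool) :
  Def (us :: rs) ss (fun A r c => P A (fun k => r k.+1) c (r 0)) ->
  Def rs (us ++ ss) (fun A r c => Q A r (sh (size us) c) (tk (size us) c)) ->
  Def rs ss (fun A r c => P A r c (Q A r c)).
Proof.
move=> hP hQ.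
have hg : Def (us :: rs) ss (fun A r c =>
    allS us (fun ts => Q A (fun k => r k.+1) c ts ==> r 0 ts) && P A (fun k => r k.+1) c (r 0)).
  apply: def_and => //; apply: (def_allS (P := fun A r c ts => Q A (fun k => r k.+1) c ts ==> r 0 ts)).
  apply: def_imp; first by apply: (@def_weaken _ _ _ _ (fun A r c => Q A r (sh (size us) c) (tk (size us) c))).
  apply: def_eq (@def_rv tau (us :: rs) (us ++ ss) 0 (iota 0 (size us)) _).
    by move=> A r c _ _; rewrite tkE.
  rewrite /=; apply/andP; split.
    apply/eqP; apply: (@eq_from_nth _ SE); first by rewrite size_map size_iota.
    move=> i hi; rewrite (nth_map 0) ?size_iota // nth_iota // add0n nth_cat.
    by rewrite hi.
  apply/allP => i; rewrite mem_iota size_cat; lia.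
(* The fixed point needs arguments for its flag and its block, although [P] depends on neither. They
   are taken from additional variables, which are quantified away here; a nonzero flag exists since
   the structure is nonempty. *)
suff hF : Def rs ((SN :: us) ++ ss) (fun A r c => (nv (c 0) != 0) && P A r (sh (size us).+1 c) (Q A r (sh (size us).+1 c))).
  apply: def_eq (def_exS (P := fun A r c ts => (nv (head nz ts) != 0) && P A r c (Q A r c)) hF).
  move=> A r c hA _; apply/exSP/idP => [[ts _ /andP []] //|h].
  have hN : 1 < #|car A|.+1 by [].
  have [x0 _] := card_gt0P hA.
  exists (inr (Ordinal hN) :: map (fun s => if s is SE then inl x0 else nz) us) => //.
  by rewrite wsort_cons /wsort size_map eqxx /=; elim: (us) => // [[]].
case: hQ hg => [hQ] [hg]; split=> ns hns; have [q q1 q2] := hQ ns hns.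
have [|g g1 g2] := hg (fresh ns :: ns); first by rewrite /= hns.
set bl := stdb us (size ss); set K := (size us + size ss).+1.
pose f := FIfp (fresh ns) ((SN, K) :: bl)
  (FOr (FAnd (FEqN (TVar K) (TVar 0)) q) (FAnd (FNot (FEqN (TVar K) (TVar 0))) g)) ((SN, K) :: bl).
exists (FAnd (FNot (FEqN (TVar K) (TVar 0))) f).
  have hK : (SN, K) \in stdb ((SN :: us) ++ ss) 0 by rewrite /= size_cat addn0 inE eqxx.
  have h0 : (SN, 0) \in (SN, 0) :: stdb ((SN :: us) ++ ss) 0 by rewrite inE eqxx.
  apply: fv_and_sub; first by apply: fv_eqN_sub; rewrite // inE hK orbT.
  have hbl : {subset (SN, K) :: bl <= (SN, 0) :: stdb ((SN :: us) ++ ss) 0}.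
    by move=> v; rewrite inE => /orP [/eqP ->|/stdb_sub h]; [rewrite inE hK orbT |
      apply: (@fv_weaken [:: SN] (us ++ ss) (FRVar 0 [:: v])); rewrite ?mem_seq1 // => w /[!inE] /eqP ->].
  apply: fv_ifp_sub => //.
  have hL v : v \in (SN, 0) :: stdb ((SN :: us) ++ ss) 0 ->
    v \in ((SN, K) :: bl) ++ (SN, 0) :: stdb ((SN :: us) ++ ss) 0.
    by move=> h; rewrite mem_cat h orbT.
  have hz : {subset fv (FEqN (TVar K) (TVar 0)) <= ((SN, K) :: bl) ++ (SN, 0) :: stdb ((SN :: us) ++ ss) 0}.
    by apply: fv_eqN_sub; [rewrite inE eqxx | apply: hL].
  apply: fv_or_sub; apply: fv_and_sub => // v hv; apply: hL.
    exact: (@fv_weaken [:: SN] (us ++ ss) q).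
  exact: (@fv_weaken (SN :: us) ss g).
move=> A e r c hA he hr.
have hx : exists2 x, num e K = Some x & nv (c 0) = x.
  by have := @isvN _ _ 0 e c _ he; rewrite /= size_cat subn0; apply.
case: hx => x hx1 hx2; rewrite !evalE hx1 (ematch_num0 he) hx2 /=.
case: (x =P ord0) => [->|/eqP hx0] //=; have -> : (x : nat) != 0 by [].
have hsz : size bl = size us by apply: size_stdb.
have hes : ematch (us ++ ss) e (sh 1 c) by case: he.
have hus := wsort_tk hes.
rewrite /f eval_ifp.
set c' := sh (size us) (fun i => c i.+1).
set ts0 := tk (size us) (sh 1 c) in hus *.
have hc' : ematch ss e c' by apply: (ematch_sh hes).
have -> : [seq lookup e v | v <- (SN, K) :: bl] = [seq Some v | v <- inr x :: ts0].
  by rewrite /= hx1 (map_lookup_block hes).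
rewrite /= all_isSome_map pmap_Some_map hsz andTb.
set Q0 := Q A r c'; set PQ := P A r c' Q0.
set bd := FOr _ _.
pose I j := iter j (@ifp_step tau A (fresh ns) ((SN, K) :: bl) bd e) (fun _ => false).
have he1 j y ts : wsort us ts -> ematch ((SN :: us) ++ ss)
    (assign (set_rv e (fresh ns) (I j)) ((SN, K) :: bl) (inr y :: ts)) (catc (inr y :: ts) c').
  move=> hts; apply: (@ematch_assign _ ss _ c' (SN :: us)); last by rewrite wsort_cons.
  exact: ematch_rv hc'.
have hr1 j y ts R : (forall t, wsort us t -> I j (nz :: t) = R t) -> rmatch (us :: rs) (fresh ns :: ns)
    (assign (set_rv e (fresh ns) (I j)) ((SN, K) :: bl) (inr y :: ts)) (scons R r).
  move=> h; apply: (rmatch_eq (e := set_rv e (fresh ns) (I j))); first by rewrite rv_assign.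
  exact: rmatch_push.
have eg j y ts : wsort us ts -> (forall t, wsort us t -> I j (nz :: t) -> Q0 t) ->
    eval tau A g (assign (set_rv e (fresh ns) (I j)) ((SN, K) :: bl) (inr y :: ts)) =
    allS us (fun t => Q0 t ==> I j (nz :: t)) && PQ.
  move=> hts hI; have := ematch_sh (us := SN :: us) (he1 j y ts hts).
  have -> : sh (size (SN :: us)) (catc (inr y :: ts) c') = c'.
    by rewrite [size _]/= -(wsort_size hts); exact: (sh_catc (inr y :: ts)).
  move=> hc1.
  case: allSP => h /=.
    rewrite (g2 A _ (scons Q0 r) c') //=; last first.
      by apply: hr1 => t ht; apply/idP/idP => [/hI|]; [apply | apply: implyP (h t ht)].
    by rewrite (_ : allS us _) //; apply/allSP => t _; apply: implybb.
  rewrite (g2 A _ (scons (fun t => I j (nz :: t)) r) c') //=; last by apply: hr1.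
  by case: allSP.
have IS j y ts : wsort us ts -> (forall t, wsort us t -> I j (nz :: t) -> Q0 t) ->
    I j.+1 (inr y :: ts) = I j (inr y :: ts) || 
     (if y == ord0 then Q0 ts else allS us (fun t => Q0 t ==> I j (nz :: t)) && PQ).
  move=> hts hI; rewrite /I iterS {1}/ifp_step -/(I j); congr orb.
  rewrite (_ : map fst _ = SN :: us) /=; last by rewrite map_fst_stdb.
  rewrite wsort_cons hts andTb !evalE eg //.
  have h1 := he1 j y ts hts.
  rewrite (ematch_num0 h1); case: (h1) => _ /=; rewrite size_cat -/K.
  case: (num _ K) => //= z [->] h2; rewrite /oeq.
  rewrite (q2 A _ r (catc ts c')) //; last first.
    by move=> k hk; have := @hr1 j y ts (fun t => I j (nz :: t)) (fun _ _ => erefl) k.+1 hk.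
  rewrite -(wsort_size hts) sh_catc tk_catc -/Q0.
  by case: (y == ord0); rewrite /= ?orbF.
(* From the first stage on, the rows flagged 0 are exactly [Q]; from the second on at the latest,
   the other rows have the value of [P]. Hence two stages must be available. *)
have H0 j t : wsort us t -> I j (nz :: t) = (0 < j) && Q0 t.
  elim: j t => // j IH t ht; rewrite IS ?IH //=; last by move=> ? ?; rewrite IH // => /andP [].
  by case: (Q0 t); rewrite ?andbF ?orbT.
have HI j : forall t, wsort us t -> I j (nz :: t) -> Q0 t by move=> t ht; rewrite H0 // => /andP [].
have hT : 2 <= #|car A|.+1 ^ (size us).+1.
  have : 0 < #|car A|.+1 ^ size us by rewrite expn_gt0.
  by rewrite expnS; nia.
move: hT => /subnK <-; rewrite -/(I _) addn2 (IS _ _ _ hus (HI _)).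
case: ifP => [h|_]; first by case/negP: hx0; exact: h.
have -> : allS us (fun t => Q0 t ==> I (#|car A|.+1 ^ (size us).+1 - 2).+1 (nz :: t)).
  by apply/allSP => t ht; rewrite H0 //= implybb.
rewrite andTb; apply/orP/idP; last by right.
case=> //; elim: (#|car A|.+1 ^ (size us).+1 - 2).+1 => // j IH.
rewrite (IS _ _ _ hus (HI _)); case: ifP => [h|_]; first by case/negP: hx0; exact: h.
by move=> /orP [//|/andP []].
Qed.
End Fixpoints.

(** * Substitution of variables *)

Section Calls.
Variable tau : seq nat.
Local Notation Def := (Def tau).

Definition isvs ss us (js : seq nat) :=
  ([seq nth SE ss j | j <- js] == us) && all (fun j => j < size ss) js.

Lemma isvs_wsort A ss us js (c : ctx A) :
  (forall i, i < size ss -> matches (nth SE ss i) (c i)) -> isvs ss us js ->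
  wsort us [seq c j | j <- js].
Proof.
move=> h /andP [/eqP <- h2]; elim: js h2 => //= j js IH /andP [h3 h4].
by rewrite wsort_cons h // IH.
Qed.

(** Substitution without touching the formula: a fixed point whose body does not mention its own
    relation variable has [P] as its first stage, and the arguments [js] select the instance. The
    tail [tl] is arbitrary because [P] is defined in the context [ss0]. *)
Lemma def_call ss0 rs ss js (tl : forall A, ctx A -> ctx A) (P : forall A, rvs A -> ctx A -> bool) :
  isvs ss ss0 js -> Def rs ss0 P ->
  Def rs ss (fun A r c => P A r (catc [seq c j | j <- js] (tl A c))).
Proof.
move=> hjs [hP]; split=> ns hns; have [f f1 f2] := hP ns hns.
have [/eqP hj1 hj2] := andP hjs.
exists (FIfp (fresh ns) (stdb ss0 0) f [seq (nth SE ss i, size ss - i) | i <- js]).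
  apply: fv_ifp_sub => v; first by move=> /f1; rewrite mem_cat !inE => /orP [->|->]; rewrite ?orbT.
  by move=> /mapP [i /(allP hj2) hi ->]; rewrite inE mem_std ?orbT.
move=> A e r c hA he hr; rewrite eval_ifp /=.
have -> : [seq lookup e v | v <- [seq (nth SE ss i, size ss - i) | i <- js]] = [seq Some v | v <- map c js].
  rewrite -!map_comp; apply/eq_in_map => i /(allP hj2) hi /=.
  by have [_ ->] := ematch_lookup he hi.
rewrite all_isSome_map pmap_Some_map andTb size_stdb.
set ts := map c js.
have hts : wsort ss0 ts.
  by apply: isvs_wsort hjs => i hi; case: (ematch_lookup he hi).
have H j : iter j (@ifp_step tau A (fresh ns) (stdb ss0 0) f e) (fun _ => false) ts =
   (0 < j) && P A r (catc ts (tl A c)).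
  elim: j => // j IH; rewrite iterS {1}/ifp_step IH map_fst_stdb hts andTb.
  rewrite (f2 A _ r (catc ts (tl A c))) //; first by case: (P A r _); rewrite ?andbF ?orbT.
    have := @ematch_assign A [::] (set_rv e (fresh ns) (iter j (@ifp_step tau A (fresh ns) (stdb ss0 0) f e) (fun _ => false))) (tl A c) ss0 ts.
    by rewrite cats0; apply => //=; apply: ematch_num0 he.
  move=> k hk t ht; rewrite rv_assign /= (negPf (fresh_nth _)) ?hns //.
  exact: hr.
by rewrite H expn_gt0.
Qed.

Lemma catc_tk_sh T k (c : nat -> T) : catc (tk k c) (sh k c) = c.
Proof.
elim: k c => //= k IH c; rewrite IH.
by apply: functional_extensionality => [[]].
Qed.

Lemma isvs_iota ss : isvs ss ss (iota 0 (size ss)).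
Proof.
apply/andP; split; last by apply/allP => i; rewrite mem_iota.
by rewrite -/(mkseq _ _) mkseq_nth.
Qed.
Lemma isvs_cat ss us us' js js' : isvs ss us js -> isvs ss us' js' -> isvs ss (us ++ us') (js ++ js').
Proof.
by rewrite /isvs map_cat all_cat => /andP [/eqP -> ->] /andP [/eqP -> ->]; rewrite eqxx.
Qed.
Lemma isvs1 ss s i : isv ss s i -> isvs ss [:: s] [:: i].
Proof. by case/andP => h /eqP <-; rewrite /isvs /= eqxx h. Qed.
Lemma isvs_size ss us js : isvs ss us js -> size js = size us.
Proof. by case/andP => /eqP <-; rewrite size_map. Qed.

Lemma isvs_iota_cat pre ss : isvs (pre ++ ss) ss (iota (size pre) (size ss)).
Proof.
apply/andP; split; last by apply/allP => i; rewrite mem_iota size_cat => /andP [].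
apply/eqP/(@eq_from_nth _ SE); rewrite size_map size_iota // => i hi.
by rewrite (nth_map 0) ?size_iota // nth_iota // nth_cat ltnNge leq_addr addKn.
Qed.
Lemma isvs_mid pre us post : isvs (pre ++ us ++ post) us (iota (size pre) (size us)).
Proof.
case/andP: (isvs_iota_cat pre (us ++ post)) => /eqP h1 /allP h2; apply/andP; split.
  apply/eqP/(@eq_from_nth _ SE); rewrite size_map size_iota // => k hk.
  rewrite (nth_map 0) ?size_iota // nth_iota // !nth_cat.
  by rewrite ltnNge leq_addr /= addKn hk.
by apply/allP => k hk; apply: h2; move: hk; rewrite !mem_iota size_cat /=; lia.
Qed.
Definition sorted_ctx A ss (c : ctx A) := forall i, i < size ss -> matches (nth SE ss i) (c i).
Lemma sorted_catc A us ss (t : seq (value A)) c : wsort us t -> sorted_ctx ss c ->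
  sorted_ctx (us ++ ss) (catc t c).
Proof.
move=> ht hc; elim: us t ht => [|u us IH] [|a t] //; rewrite wsort_cons => /andP [ha ht].
by case=> [|i] //= hi; apply: IH.
Qed.
Lemma catc_cat A (s1 s2 : seq (value A)) (c0 : ctx A) : catc (s1 ++ s2) c0 = catc s1 (catc s2 c0).
Proof. by elim: s1 => //= a s1 ->. Qed.
Lemma map_iota_tk T (c : nat -> T) k n : [seq c j | j <- iota k n] = tk n (sh k c).
Proof.
rewrite tkE -[k in iota k]addn0 iotaDl -map_comp; apply: eq_map => i /=.
by rewrite shE.
Qed.

(** The form in which a definition is reused below further quantifiers: its block [us] is read at
    arbitrary positions, and the variables [pre] are skipped. *)
Lemma def_move pre us rs ss js (P : forall A, rvs A -> seq (value A) -> ctx A -> bool) :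
  isvs (pre ++ ss) us js -> Def rs (us ++ ss) (fun A r c => P A r (tk (size us) c) (sh (size us) c)) ->
  Def rs (pre ++ ss) (fun A r c => P A r [seq c j | j <- js] (sh (size pre) c)).
Proof.
move=> h1 h2.
have := def_call (fun A c => sh (size pre + size ss) c) (isvs_cat h1 (isvs_iota_cat pre ss)) h2.
apply: def_eq => A r c _ _; rewrite map_cat map_iota_tk catc_cat.
have hs : size [seq c j | j <- js] = size us by rewrite size_map (isvs_size h1).
by rewrite shD catc_tk_sh -hs tk_catc sh_catc.
Qed.
Lemma def_call_ext us rs ss js (P : forall A, rvs A -> seq (value A) -> ctx A -> bool) :
  isvs ss us js -> Def rs (us ++ ss) (fun A r c => P A r (tk (size us) c) (sh (size us) c)) ->
  Def rs ss (fun A r c => P A r [seq c j | j <- js] c).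
Proof. exact: (@def_move [::]). Qed.

Lemma def_ifpA rs ss us js
  (B : forall A, rvs A -> ctx A -> (seq (value A) -> bool) -> seq (value A) -> bool) :
  isvs ss us js ->
  Def (us :: rs) (us ++ ss) (fun A r c =>
     B A (fun k => r k.+1) (sh (size us) c) (r 0) (tk (size us) c)) ->
  Def rs ss (fun A r c => ifpV us (B A r c) [seq c j | j <- js]).
Proof.
move=> h hB; apply: (def_call_ext (P := fun A r ts c => ifpV us (B A r c) ts) h).
exact: def_ifp hB.
Qed.

Lemma def_rv1 rs ss k i :
  [&& k < size rs, nth [::] rs k == [:: nth SE ss i] & i < size ss] ->
  Def rs ss (fun A r c => r k [:: c i]).
Proof. by case/and3P=> h1 h2 h3; apply: (@def_rv tau rs ss k [:: i]); rewrite h1 h2 /= h3. Qed.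
Lemma def_rv2 rs ss k i j :
  [&& k < size rs, nth [::] rs k == [:: nth SE ss i; nth SE ss j] & (i < size ss) && (j < size ss)] ->
  Def rs ss (fun A r c => r k [:: c i; c j]).
Proof.
by case/and3P=> h1 h2 /andP [h3 h4]; apply: (@def_rv tau rs ss k [:: i; j]); rewrite h1 h2 /= h3 h4.
Qed.
Lemma def_rv3 rs ss k i j l :
  [&& k < size rs, nth [::] rs k == [:: nth SE ss i; nth SE ss j; nth SE ss l],
      i < size ss, j < size ss & l < size ss] ->
  Def rs ss (fun A r c => r k [:: c i; c j; c l]).
Proof.
by case/and5P=> h1 h2 h3 h4 h5; apply: (@def_rv tau rs ss k [:: i; j; l]); rewrite h1 h2 /= h3 h4 h5.
Qed.
Lemma def_rv4 rs ss k i j l m :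
  [&& k < size rs, nth [::] rs k == [:: nth SE ss i; nth SE ss j; nth SE ss l; nth SE ss m],
      i < size ss, j < size ss & (l < size ss) && (m < size ss)] ->
  Def rs ss (fun A r c => r k [:: c i; c j; c l; c m]).
Proof.
by case/and5P=> h1 h2 h3 h4 /andP [h5 h6]; apply: (@def_rv tau rs ss k [:: i; j; l; m]);
  rewrite h1 h2 /= h3 h4 h5 h6.
Qed.
End Calls.

Section Arith.
Variable tau : seq nat.
Local Notation Def := (Def tau).

Definition succV A (x y : value A) := (nv x < nv y) && allV SN (fun z : value A => (nv z <= nv x) || (nv y <= nv z)).
Lemma succVE A (x y : value A) : matches SN x -> succV x y = (nv y == (nv x).+1).
Proof.
case: x => // i _; rewrite /succV /=.
apply/andP/eqP => [[h /allVP h2]|h].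
  have hy : (nv y) < #|car A|.+1 by case: y {h h2} => // j; apply: ltn_ord.
  have hi : i.+1 < #|car A|.+1 by apply: leq_trans hy.
  have := h2 (inr (Ordinal hi)) isT; rewrite /nv /= -/(nv _) in h *; move: h; lia.
split; first by rewrite h.
by apply/allVP => z _; rewrite h; lia.
Qed.
Lemma def_succ rs ss i j : isv ss SN i && isv ss SN j ->
  Def rs ss (fun A r c => nv (c j) == (nv (c i)).+1).
Proof.
move=> /andP [hi hj].
have : Def rs ss (fun A r c => succV (c i) (c j)).
  rewrite /succV; apply: def_and; first by apply: def_lt; rewrite hi.
  apply: def_allV; apply: def_or; apply: def_le; rewrite /isv /=.
    exact: hi.
  by rewrite andbT; exact: hj.
apply: def_eq => A r c _ h; apply: succVE.
by case/andP: hi => hi1 /eqP <-; apply: h.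
Qed.
End Arith.

(** The atomic equalities precede the general case, which treats [==] as equality of truth values.
    The final pattern matches only bodies that depend neither on the structure nor on the
    context. *)
Ltac dstep := lazymatch goal with
 | |- Def _ _ _ (fun A r c => andb _ _) => apply: def_and
 | |- Def _ _ _ (fun A r c => orb _ _) => apply: def_or
 | |- Def _ _ _ (fun A r c => implb _ _) => apply: def_imp
 | |- Def _ _ _ (fun A r c => negb _) => apply: def_not
 | |- Def _ _ _ (fun A r c => if _ then _ else _) => apply: def_if
 | |- Def _ _ _ (fun A r c => exV _ _) => apply: def_exV
 | |- Def _ _ _ (fun A r c => allV _ _) => apply: def_allV
 | |- Def _ _ _ (fun A r c => exS _ _) => apply: def_exS; rewrite /=
 | |- Def _ _ _ (fun A r c => allS _ _) => apply: def_allS; rewrite /=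
 | |- Def _ _ _ (fun A r c => eq_op (cntE _) (nv (c _))) => apply: def_cnt; first by []
 | |- Def _ _ _ (fun A r c => eq_op (nv (c _)) (nv (c _))) => apply: def_eqn; by []
 | |- Def _ _ _ (fun A r c => eq_op (nv (c _)) (S (nv (c _)))) => apply: def_succ; by []
 | |- Def _ _ _ (fun A r c => eq_op (nv (c _)) 0) => apply: def_eq0; by []
 | |- Def _ _ _ (fun A r c => eq_op (c _) (c _)) => apply: def_eqv; by []
 | |- Def _ _ _ (fun A r c => eq_op _ _) => apply: def_eqb
 | |- Def _ _ _ (fun A r c => leq (S (nv (c _))) (nv (c _))) => apply: def_lt; by []
 | |- Def _ _ _ (fun A r c => leq (nv (c _)) (nv (c _))) => apply: def_le; by []
 | |- Def _ _ _ (fun A r c => r _ [:: c _]) => apply: def_rv1; by []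
 | |- Def _ _ _ (fun A r c => r _ [:: c _; c _]) => apply: def_rv2; by []
 | |- Def _ _ _ (fun A r c => r _ [:: c _; c _; c _]) => apply: def_rv3; by []
 | |- Def _ _ _ (fun A r c => r _ [:: c _; c _; c _; c _]) => apply: def_rv4; by []
 | |- Def _ _ _ (fun A r c => ?b) => apply: (def_cst _ _ _ b)
 end.
Ltac dfn := repeat (dstep; cbv beta).


(** * Recursion along the numbers *)

Section Iteration.
Variable tau : seq nat.
Local Notation Def := (Def tau).

Lemma sorted_env A ss (c : ctx A) : (forall i, i < size ss -> matches (nth SE ss i) (c i)) ->
  forall rvf, exists2 e : env A, ematch ss e c & rv e = rvf.
Proof.
move=> h rvf; have hw : wsort ss (tk (size ss) c).
  have := isvs_wsort h (isvs_iota ss); by rewrite -tkE.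
pose e0 : env A := Env A (fun _ => None) (fun _ => Some ord0) rvf.
exists (assign e0 (stdb ss 0) (tk (size ss) c)); last by rewrite rv_assign.
have := @ematch_assign A [::] e0 (sh (size ss) c) ss _ erefl hw.
by rewrite cats0 catc_tk_sh.
Qed.

(** One formula computes both sides, and a single environment represents [r] as well as [r'],
    because [rmatch] looks at well-sorted tuples only. *)
Lemma def_ext rs ss (P : forall A, rvs A -> ctx A -> bool) A (r r' : rvs A) c :
  Def rs ss P -> 0 < #|car A| ->
  (forall i, i < size ss -> matches (nth SE ss i) (c i)) ->
  (forall k, k < size rs -> forall ts, wsort (nth [::] rs k) ts -> r k ts = r' k ts) ->
  P A r c = P A r' c.
Proof.
move=> [h] hA hc hr; have [|f _ f2] := h (iota 0 (size rs)); first by rewrite size_iota.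
have [e he hre] := sorted_env hc (fun k ts => r k (behead ts)).
have H k ts : k < size rs -> rv e (nth 0 (iota 0 (size rs)) k) (nz :: ts) = r k ts.
  by move=> hk; rewrite nth_iota // add0n hre.
rewrite -(f2 A e r c) // ?(f2 A e r' c) // => k hk ts hts; rewrite H //; exact: hr.
Qed.

Fixpoint iterV A (F : value A -> (seq (value A) -> bool) -> seq (value A) -> bool)
   (R0 : seq (value A) -> bool) d : seq (value A) -> bool :=
  if d is d'.+1 then F (nval A d') (iterV F R0 d') else R0.

(** Since [F] need not be monotone, it may be applied to an iterate only when that iterate is final.
    The fixed point has two extra columns f and d: the rows with f = 0 hold iterate d, and those
    with f nonzero are a clock. Clock row d enters at stage d + 1 for every tuple, which is exactly
    when iterate d is complete, and iterate d + 1 waits for it. *)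
Lemma def_iter rs ss us
  (F : forall A, rvs A -> ctx A -> value A -> (seq (value A) -> bool) -> seq (value A) -> bool)
  (R0 : forall A, rvs A -> ctx A -> seq (value A) -> bool) i js :
  isv ss SN i -> isvs ss us js ->
  Def rs (us ++ ss) (fun A r c => R0 A r (sh (size us) c) (tk (size us) c)) ->
  Def (us :: rs) (us ++ SN :: ss) (fun A r c =>
    F A (fun k => r k.+1) (sh (size us).+1 c) (c (size us)) (r 0) (tk (size us) c)) ->
  Def rs ss (fun A r c => iterV (F A r c) (R0 A r c) (nv (c i)) [seq c j | j <- js]).
Proof.
move=> hi hjs hR hF.
pose B A (r : rvs A) (c : ctx A) (Z : seq (value A) -> bool) (ts : seq (value A)) : bool :=
  if ts is f :: d :: t then
    if nv f == 0 then
      if nv d == 0 then R0 A r c t else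
      exV SN (fun d' : value A => [&& nv d == (nv d').+1, exV SN (fun f1 : value A => (nv f1 != 0) && Z [:: f1, d' & t]) &
         F A r c d' (fun t' => Z [:: f, d' & t']) t])
    else (nv d == 0) || exV SN (fun d' : value A => (nv d == (nv d').+1) && Z [:: f, d' & t])
  else false.
have hB : Def rs (SN :: ss) (fun A r c => ifpV (SN :: SN :: us) (B A r (fun i => c i.+1))
    [seq c j | j <- [:: 0, i.+1 & map S js]]).
  apply: (@def_ifpA tau rs (SN :: ss) (SN :: SN :: us) _ (fun A r c => B A r (fun i => c i.+1))).
    case/andP: hi => h1 /eqP h2; case/andP: hjs => /eqP h3 h4.
    rewrite /isvs /= h2 (_ : [seq _ | j <- map S js] = us); last by rewrite -map_comp -[RHS]h3.
    by rewrite eqxx /= ltnS h1 /= all_map.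
  have hE : us ++ SN :: ss = (us ++ [:: SN]) ++ ss by rewrite -catA.
  have hit pre : isvs (pre ++ us ++ SN :: ss) us (iota (size pre) (size us)) by apply: isvs_mid.
  have hbase A (c : ctx A) k : sh (k + size (us ++ [:: SN])) c = (fun i => sh (size us) (sh k c) i.+1).
    by apply: functional_extensionality => x; rewrite !shE size_cat; congr c => /=; lia.
  have hRm : Def ([:: SN, SN & us] :: rs) ([:: SN, SN & us] ++ SN :: ss) (fun A r c =>
      R0 A (fun k => r k.+1) (fun i => sh (size us) (sh 2 c) i.+1) (tk (size us) (sh 2 c))).
    have := hit [:: SN; SN]; rewrite /= hE => h.
    have := def_weaken [:: SN, SN & us] (@def_move tau [:: SN, SN & us ++ [:: SN]] us rs ss _ (fun A r ts c => R0 A r c ts) h hR).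
    by apply: def_eq => A r c _ _; rewrite map_iota_tk -(hbase A c 2).
  have hFm : Def [:: us, [:: SN, SN & us] & rs] [:: SN, SN, SN & us ++ SN :: ss] (fun A r c =>
      F A (fun k => r k.+2) (fun i => sh (size us) (sh 3 c) i.+1) (c 0) (r 0) (tk (size us) (sh 3 c))).
    have h : isvs [:: SN, SN, SN & us ++ SN :: ss] (us ++ [:: SN]) (iota 3 (size us) ++ [:: 0]).
      by apply: isvs_cat; [exact: (hit [:: SN; SN; SN]) | apply: isvs1].
    pose P A (r : rvs A) ts c := F A (fun k => r k.+1) c (nth nz ts (size us)) (r 0) (take (size us) ts).
    move: h; rewrite hE => h.
    have hF' : Def (us :: rs) ((us ++ [:: SN]) ++ ss) (fun A r c =>
        P A r (tk (size (us ++ [:: SN])) c) (sh (size (us ++ [:: SN])) c)).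
      rewrite -hE; apply: def_eq hF => A r c _ _; rewrite /P size_cat addn1.
      have E : tk (size us).+1 c = rcons (tk (size us) c) (c (size us)).
        by rewrite !tkE -addn1 iotaD map_cat cats1.
      by rewrite E nth_rcons size_tk ltnn eqxx -cats1 take_size_cat ?size_tk.
    have := def_rename (g := fun k => if k is k'.+1 then k'.+2 else 0) (rs' := [:: us, [:: SN, SN & us] & rs]) _
      (@def_move tau [:: SN, SN, SN & us ++ [:: SN]] _ _ _ _ P h hF').
    case=> [[|k]|] //; rewrite -/(Def _ _ _) => hh.
    apply: def_eq (DefI hh) => A r c _ _; rewrite /P map_cat map_iota_tk.
    by rewrite nth_cat size_tk ltnn subnn take_size_cat ?size_tk //= -(hbase A c 3).
  rewrite /B /=.
  apply: def_if; first by apply: def_eq0.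
    apply: def_if; first by apply: def_eq0.
    exact: hRm.
    apply: def_exV; apply: def_and; first by apply: def_succ.
    apply: def_and.
      apply: def_exV; apply: def_and; first by apply/def_not/def_eq0.
      have := hit [:: SN; SN; SN; SN] => /andP [/eqP h1 h2].
      have := @def_rv tau ([:: SN, SN & us] :: rs) [:: SN, SN, SN, SN & us ++ SN :: ss] 0 [:: 0, 1 & iota 4 (size us)].
      rewrite /= h1 eqxx h2 => /(_ isT).
      by apply: def_eq => A r c _ _; rewrite map_iota_tk.
    apply: (def_let (us := us) (P := fun A r c R => F A (fun k => r k.+1) (fun i => sh (size us) (sh 3 c) i.+1) (c 0) R (tk (size us) (sh 3 c)))
      (Q := fun A r c t' => r 0 [:: c 1, c 0 & t'])); first exact: hFm.
    have /andP [/eqP h1 /allP h2] := isvs_mid [::] us [:: SN, SN, SN & us ++ SN :: ss].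
    have := @def_rv tau ([:: SN, SN & us] :: rs) (us ++ [:: SN, SN, SN & us ++ SN :: ss]) 0 [:: size us + 1, size us & iota 0 (size us)].
    rewrite /= h1 !nth_cat ltnn ltnNge leq_addr /= addKn subnn /= eqxx.
    have -> : size us + 1 < size (us ++ [:: SN, SN, SN & us ++ SN :: ss]) by rewrite size_cat /=; lia.
    have -> : size us < size (us ++ [:: SN, SN, SN & us ++ SN :: ss]) by rewrite size_cat /=; lia.
    rewrite /=.
    case: allP => // _ /(_ isT).
    by apply: def_eq => A r c _ _; rewrite -tkE !shE addn0 addn1.
  apply: def_or; first by apply: def_eq0.
  apply: def_exV; apply: def_and; first by apply: def_succ.
  have := hit [:: SN; SN; SN] => /andP [/eqP h1 h2].
  have := @def_rv tau ([:: SN, SN & us] :: rs) [:: SN, SN, SN & us ++ SN :: ss] 0 [:: 1, 0 & iota 3 (size us)].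
  rewrite /= h1 eqxx h2 => /(_ isT).
  by apply: def_eq => A r c _ _; rewrite map_iota_tk.
have : Def rs ss (fun A r c => exV SN (fun f => (nv f == 0) && ifpV (SN :: SN :: us) (B A r c) [:: f, c i & map c js])).
  apply: (def_exV (P := fun A r c f => (nv f == 0) && ifpV (SN :: SN :: us) (B A r c) [:: f, c i & map c js])).
  apply: def_and; first by apply: def_eq0.
  by apply: def_eq hB => A r c _ _; rewrite /= -map_comp.
apply: def_eq => A r c hA hc.
have hts := isvs_wsort hc hjs.
have [d hd] : exists d, c i = inr d.
  by case/andP: hi => h1 /eqP h2; have := hc _ h1; rewrite h2; case: (c i) => // d; exists d.
rewrite hd /=; set ts := map c js in hts *.
(* The fixed point agrees with the iterate on well-sorted tuples only; by [def_ext] a definable [F]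
   does not see the difference. *)
have Fext x t (Z Z' : seq (value A) -> bool) : matches SN x -> wsort us t -> (forall t', wsort us t' -> Z t' = Z' t') ->
   F A r c x Z t = F A r c x Z' t.
  move=> hx ht hZ.
  have := @def_ext _ _ _ A (scons Z r) (scons Z' r) (catc t (scons x c)) hF hA.
  rewrite /= -(wsort_size ht) tk_catc.
  have -> : catc t (scons x c) (size t) = x by elim: (t) => //=.
  have -> : sh (size t) (fun k => catc t (scons x c) k.+1) = c.
    by elim: (t) => //=.
  apply.
    by apply: sorted_catc => // [[|k]] //=; apply: hc.
  by case.
have exi (P : value A -> bool) (e : 'I_#|car A|.+1) :
  exV SN (fun e' : value A => ((e : nat) == (nv e').+1) && P e') = (0 < e) && P (nval A e.-1).
  have he : e.-1 < #|car A|.+1 by apply: leq_ltn_trans (leq_pred e) _.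
  apply/exVP/andP => [[[//|e'] _ /andP [/eqP h1 h2]]|[h1 h2]].
    by rewrite h1 /nval /nv /= inord_val.
  by exists (nval A e.-1); rewrite // h2 /nval /nv inordK // prednK // eqxx.
have hA2 : exists2 f1 : 'I_#|car A|.+1, f1 != 0 :> nat & true by exists (Ordinal (n := #|car A|.+1) (m := 1) hA).
have Hn (e : 'I_#|car A|.+1) : nv (inr e) = e by [].
have H j (f e : 'I_#|car A|.+1) t : wsort us t -> stage (SN :: SN :: us) (B A r c) j [:: inr f, inr e & t] =
    (e < j) && ((f != 0 :> nat) || iterV (F A r c) (R0 A r c) e t).
  elim: j f e t => [|j IH] f e t ht; first by rewrite ltn0.
  rewrite stageS IH // !wsort_cons ht /= !Hn.
  have hin : e.-1 < #|car A|.+1 by apply: leq_ltn_trans (leq_pred e) _.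
  case: (f =P 0 :> nat) => /= [hf|/eqP hf]; last first.
    rewrite andbT exi /nval IH // inordK // ltnS.
    by rewrite hf; case: (nat_of_ord e) => [|e'] //=; lia.
  case: (eqVneq (e : nat) 0) => [->|he] /=.
    by case: (R0 _ _ _ _); rewrite ?andbF ?orbT //.
  rewrite (exi (fun e' => exV SN _ && _)) lt0n he /=.
  have -> : exV SN (fun f1 : value A => (nv f1 != 0) && stage (SN :: SN :: us) (B A r c) j [:: f1, nval A e.-1 & t]) = (e.-1 < j).
    case: hA2 => f1 hf1 _; apply/exVP/idP => [[[//|f2] _ /andP [_]]|h].
      by rewrite IH // inordK // => /andP [].
    by exists (inr f1) => //; rewrite Hn hf1 IH // inordK // h hf1.
  have -> : (e < j.+1) = (e.-1 < j) by lia.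
  case: (ltnP e.-1 j) => hj /=; last by rewrite (_ : e < j = false) //; lia.
  rewrite (Fext _ _ _ (iterV (F A r c) (R0 A r c) e.-1)) //; last first.
    by move=> t' ht'; rewrite IH // inordK // hj hf.
  have -> : iterV (F A r c) (R0 A r c) e t = F A r c (nval A e.-1) (iterV (F A r c) (R0 A r c) e.-1) t.
    by case: (nat_of_ord e) he.
  by case: (F _ _ _ _ _ _); rewrite ?andbF ?orbT.
apply/exVP/idP => [[[//|f] _ /andP [/eqP hf]]|h].
  by rewrite /ifpV H // => /andP [_]; rewrite -Hn hf.
exists nz => //; rewrite /ifpV H //; rewrite Hn in h; rewrite h orbT andbT /=.
apply: (leq_trans (ltn_ord d)); rewrite -{1}[_.+1]expn1; apply: leq_pexp2l => //.
Qed.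

End Iteration.

(** * Arithmetic, closure and counting *)

Section NumberOperations.
Variable tau : seq nat.
Local Notation Def := (Def tau).

Lemma nvN A (i : 'I_#|car A|.+1) : nv (inr i : value A) = i. Proof. by []. Qed.
Lemma nv_lt A (v : value A) : nv v < #|car A|.+1.
Proof. by case: v => // i; exact: ltn_ord. Qed.
Lemma nv_nval A k : k <= #|car A| -> nv (nval A k) = k.
Proof. by move=> h; rewrite /nval nvN inordK. Qed.
Lemma nval_nv A (v : value A) : matches SN v -> nval A (nv v) = v.
Proof. by case: v => // i _; rewrite /nval nvN inord_val. Qed.

Lemma exNP A (P : value A -> bool) :
  reflect (exists2 k, k <= #|car A| & P (nval A k)) (exV SN P).
Proof.
apply: (iffP (exVP _ _)) => [[v hv h]|[k hk h]]; last by exists (nval A k).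
by exists (nv v); [rewrite -ltnS nv_lt | rewrite nval_nv].
Qed.

Lemma def_add rs ss i j k : [&& isv ss SN i, isv ss SN j & isv ss SN k] ->
  Def rs ss (fun A r c => nv (c i) + nv (c j) == nv (c k)).
Proof.
move=> /and3P [hi hj hk].
have : Def rs ss (fun A r c => iterV (fun _ (Z : seq (value A) -> bool) ts =>
    exV SN (fun y : value A => Z [:: nth nz ts 0; y] && (nv (nth nz ts 1) == (nv y).+1)))
    (fun ts => nv (nth nz ts 0) == nv (nth nz ts 1)) (nv (c i)) [seq c l | l <- [:: j; k]]).
  apply: (def_iter (us := [:: SN; SN])
    (F := fun A r c _ (Z : seq (value A) -> bool) ts =>
      exV SN (fun y : value A => Z [:: nth nz ts 0; y] && (nv (nth nz ts 1) == (nv y).+1)))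
    (R0 := fun A r c (ts : seq (value A)) => nv (nth nz ts 0) == nv (nth nz ts 1))) => //=.
  - by apply: isvs_cat (isvs1 hj) (isvs1 hk).
  - by dfn.
  - by dfn.
apply: def_eq => A r c _ hc.
rewrite addnC; have : nv (c i) <= #|car A| by rewrite -ltnS nv_lt.
move: (nv (c i)) => d; rewrite [map _ _]/=; move: (c j) (c k) => x.
elim: d => [|d IH] z hd /=; first by rewrite addn0.
apply/exNP/eqP => [[y hy /andP []]|h].
  by rewrite (IH _ (ltnW hd)) => /eqP <- /eqP ->; rewrite addnS.
have hz := nv_lt z; have hb : nv x + d <= #|car A| by rewrite -ltnS -addnS h; apply: leq_trans hz.
by exists (nv x + d); rewrite // (IH _ (ltnW hd)) nv_nval // eqxx -h addnS /=.
Qed.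

(** The number m of iterations is itself a number, at most n, while there are n + 1 summands; so the
    partial sum below m = n is iterated and the last summand is added separately. A partial sum
    above n has no number representing it, but then the total is not a number either. *)
Lemma def_sum rs ss (f : forall A, rvs A -> ctx A -> nat -> nat) k : isv ss SN k ->
  Def rs (SN :: SN :: ss) (fun A r c => f A r (fun i => c i.+2) (nv (c 0)) == nv (c 1)) ->
  Def rs ss (fun A r c => \sum_(d < #|car A|.+1) f A r c d == nv (c k)).
Proof.
move=> hk hf.
pose F A (r : rvs A) (c : ctx A) (d : value A) (Z : seq (value A) -> bool) (ts : seq (value A)) :=
  exV SN (fun y : value A => exV SN (fun z : value A => [&& Z [:: y], f A r c (nv d) == nv z &
     nv y + nv z == nv (nth nz ts 0)])).
pose R0 A (r : rvs A) (c : ctx A) (ts : seq (value A)) := nv (nth nz ts 0) == 0.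
have hI : Def rs (SN :: SN :: ss) (fun A r c =>
    iterV (F A r (fun i => c i.+2)) (R0 A r (fun i => c i.+2)) (nv (c 0)) [seq c l | l <- [:: 1]]).
  apply: (def_iter (us := [:: SN]) (F := fun A r c => F A r (fun i => c i.+2))
    (R0 := fun A r c => R0 A r (fun i => c i.+2))) => //=; first by rewrite /R0 /=; dfn.
  rewrite /F /=; apply: def_exV; apply: def_exV; apply: def_and; first by dfn.
  apply: def_and; last by apply: def_add.
  exact: (def_weaken [:: SN] (@def_move tau [:: SN; SN; SN; SN; SN; SN] [:: SN; SN] rs ss [:: 3; 0]
     (fun A r ts c => f A r c (nv (nth nz ts 0)) == nv (nth nz ts 1)) isT hf)).
have : Def rs ss (fun A r c => exV SN (fun m : value A => exV SN (fun y : value A => exV SN (fun z : value A =>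
   [&& allV SN (fun m' : value A => nv m' <= nv m), iterV (F A r c) (R0 A r c) (nv m) [:: y],
      f A r c (nv m) == nv z & nv y + nv z == nv (c k)])))).
  apply: def_exV; apply: def_exV; apply: def_exV; apply: def_and; first by dfn.
  apply: def_and.
    exact: (@def_move tau [:: SN; SN; SN] [:: SN; SN] rs ss [:: 2; 1]
     (fun A r ts c => iterV (F A r c) (R0 A r c) (nv (nth nz ts 0)) [:: nth nz ts 1]) isT hI).
  apply: def_and; last by apply: def_add; rewrite /= [isv _ _ _]hk.
  exact: (@def_move tau [:: SN; SN; SN] [:: SN; SN] rs ss [:: 2; 0]
     (fun A r ts c => f A r c (nv (nth nz ts 0)) == nv (nth nz ts 1)) isT hf).
apply: def_eq => A r c _ hc.
have hI' d x : d <= #|car A| -> iterV (F A r c) (R0 A r c) d [:: x] = (\sum_(e < d) f A r c e == nv x).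
  elim: d x => [|d IH] x hd /=; first by rewrite big_ord0 eq_sym.
  rewrite big_ord_recr /= {1}/F /=.
  apply/exNP/eqP => [[y hy /exNP [z hz /and3P []]]|h].
    by rewrite (IH _ (ltnW hd)) (nv_nval (ltnW hd)) => /eqP -> /eqP -> /eqP.
  have hle : \sum_(e < d) f A r c e + f A r c d <= #|car A| by rewrite h -ltnS nv_lt.
  have h1 := leq_trans (leq_addr _ _) hle; have h2 := leq_trans (leq_addl _ _) hle.
  exists (\sum_(e < d) f A r c e) => //; apply/exNP; exists (f A r c d) => //.
  by rewrite (IH _ (ltnW hd)) (nv_nval (ltnW hd)) !nv_nval // h !eqxx.
rewrite big_ord_recr /=; apply/exNP/eqP.
  case=> m hm /exNP [y hy /exNP [z hz /and4P [/allVP h1]]].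
  have Em : m = #|car A|.
    have := h1 (nval A #|car A|) isT; rewrite !nv_nval //; lia.
  rewrite nv_nval // hI' // Em => /eqP -> /eqP -> /eqP //.
move=> h.
have hle : \sum_(e < #|car A|) f A r c e + f A r c #|car A| <= #|car A| by rewrite h -ltnS nv_lt.
have h1 := leq_trans (leq_addr _ _) hle; have h2 := leq_trans (leq_addl _ _) hle.
exists #|car A| => //; apply/exNP; exists (\sum_(e < #|car A|) f A r c e) => //.
apply/exNP; exists (f A r c #|car A|) => //.
apply/and4P; split.
- by apply/allVP => v _; rewrite nv_nval // -ltnS nv_lt.
- by rewrite nv_nval // hI' // nv_nval.
- by rewrite !nv_nval.
- by rewrite !nv_nval ?h.
Qed.

Lemma def_mul rs ss i j k : [&& isv ss SN i, isv ss SN j & isv ss SN k] ->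
  Def rs ss (fun A r c => nv (c i) * nv (c j) == nv (c k)).
Proof.
move=> /and3P [hi hj hk].
have := @def_sum rs ss (fun A r c d => if d < nv (c i) then nv (c j) else 0) k hk.
case.
  apply: (@def_eq _ _ _ (fun A r c => if nv (c 0) < nv (c i.+2) then nv (c j.+2) == nv (c 1) else nv (c 1) == 0)).
    by move=> A r c _ _; case: ifP => // _; rewrite eq_sym.
  apply: def_if; first by apply: def_lt; rewrite /= [isv _ _ _]hi.
    by apply: def_eqn; rewrite andbC /= [isv _ _ _]hj.
  exact: def_eq0.
move=> hh; apply: def_eq (DefI hh) => A r c _ _.
rewrite -big_mkcond /= -(big_ord_widen _ (fun _ => nv (c j)) (ltnW (nv_lt (c i)))).
by rewrite sum_nat_const card_ord.
Qed.

(** [TCount] binds element variables only; numbers are counted by adding up truth values. *)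
Lemma def_cntN rs ss (P : forall A, rvs A -> ctx A -> value A -> bool) k : isv ss SN k ->
  Def rs (SN :: ss) (fun A r c => P A r (fun i => c i.+1) (c 0)) ->
  Def rs ss (fun A r c => \sum_(d < #|car A|.+1) P A r c (nval A d) == nv (c k)).
Proof.
move=> hk hP.
apply: (@def_sum rs ss (fun A r c d => (P A r c (nval A d) : nat)) k hk).
have hP' : Def rs (SN :: SN :: ss) (fun A r c => P A r (fun i => c i.+2) (nth nz [:: c 0] 0)).
  by apply: (@def_move tau [:: SN; SN] [:: SN] rs ss [:: 0] (fun A r ts c => P A r c (nth nz ts 0)) isT hP).
apply: (@def_eq _ _ _ (fun A r c => if P A r (fun i => c i.+2) (c 0) then nv (c 1) == 1 else nv (c 1) == 0)).
  move=> A r c _ hc; rewrite nval_nv; last exact: (hc 0).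
  by case: (P _ _ _ _) => /=; rewrite eq_sym.
apply: def_if => //; last exact: def_eq0.
apply: (@def_eq _ _ _ (fun A r c => exV SN (fun z : value A => (nv z == 0) && (nv (c 1) == (nv z).+1)))).
  move=> A r c hA _; apply/exNP/eqP => [[z hz /andP [/eqP ->] /eqP //]|->].
  by exists 0; rewrite ?nv_nval.
by apply: def_exV; apply: def_and; [apply: def_eq0 | apply: def_succ].
Qed.
End NumberOperations.

Ltac dstep2 := first [dstep | lazymatch goal with
 | |- Def _ _ _ (fun A r c => eq_op (addn (nv (c _)) (nv (c _))) (nv (c _))) => apply: def_add; by []
 | |- Def _ _ _ (fun A r c => eq_op (muln (nv (c _)) (nv (c _))) (nv (c _))) => apply: def_mul; by []
 | |- Def _ _ _ (fun A r c => eq_op (bigop _ _ (fun i => BigBody i _ _ (nat_of_bool _))) (nv (c _))) => apply: def_cntN; first by []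
 | |- Def _ _ _ (fun A r c => eq_op (bigop _ _ _) (nv (c _))) => apply: def_sum; first by []
 end].
Ltac dfn2 := repeat (dstep2; cbv beta).

(** * Reflexive and transitive closure on tuples *)

Section Closure.
Variable tau : seq nat.
Local Notation Def := (Def tau).

Lemma def_eqval rs ss s i j : isv ss s i && isv ss s j -> Def rs ss (fun A r c => c i == c j).
Proof.
case: s => h; first exact: def_eqv.
apply: def_eq (def_eqn _ _ h) => A r c _ hc; case/andP: h => /andP [h1 /eqP h2] /andP [h3 /eqP h4].
by have := hc _ h1; have := hc _ h3; rewrite h2 h4; case: (c i) => // x; case: (c j).
Qed.
Lemma def_eqs rs ss us is_ js : isvs ss us is_ -> isvs ss us js ->
  Def rs ss (fun A r c => [seq c i | i <- is_] == [seq c j | j <- js]).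
Proof.
elim: us is_ js => [|u us IH] [|i is_] [|j js] /=; rewrite /isvs /= ?eqseq_cons //.
  by move=> _ _; apply: def_true.
case/andP=> /andP [h1 h2] /andP [h3 h4] /andP [/andP [h1' h2'] /andP [h3' h4']].
rewrite (_ : (fun A r c => _) = (fun A r (c : ctx A) => (c i == c j) && ([seq c i | i <- is_] == [seq c j | j <- js]))).
  apply: def_and; last by apply: IH; rewrite /isvs ?h2 ?h2'.
  by apply: (@def_eqval _ _ u); rewrite /isv h3 h1 h3' h1'.
by do 3 (apply: functional_extensionality_dep => ?); rewrite eqseq_cons.
Qed.

Definition conn_step A us (S : seq (value A) -> seq (value A) -> bool)
   (Z : seq (value A) -> bool) ts :=
  (take (size us) ts == drop (size us) ts) ||
     exS us (fun m => Z (take (size us) ts ++ m) && S m (drop (size us) ts)).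
Definition connT A us (S : seq (value A) -> seq (value A) -> bool) a b :=
  ifpV (us ++ us) (conn_step us S) (a ++ b).

(** Each stage extends paths by one step; conversely the fixed point is closed under steps by
    [ifpV_fix], whatever the length of the path. *)
Lemma connTP A us (S : seq (value A) -> seq (value A) -> bool) a b :
  wsort us a -> wsort us b ->
  reflect (exists p, [/\ all (wsort us) p, path S a p & last a p = b]) (connT us S a b).
Proof.
move=> ha; pose B := conn_step us S.
have hsz := wsort_size ha.
have tka t : take (size us) (a ++ t) = a by rewrite take_size_cat.
have dra t : drop (size us) (a ++ t) = t by rewrite drop_size_cat.
have HB t : wsort us t -> B (ifpV (us ++ us) B) (a ++ t) -> ifpV (us ++ us) B (a ++ t).
  by move=> ht; apply: ifpV_fix; rewrite wsort_cat ?ha.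
move=> hb; apply: (iffP idP) => [|[p [h1 h2 <-]]].
  rewrite /connT -/B /ifpV; move: (_ ^ _) => j; elim: j b hb => // j IH b hb.
  rewrite stageS => /orP [/IH|/andP [_]]; first exact.
  rewrite {1}/B /conn_step tka dra => /orP [/eqP <-|/exSP [m hm /andP [/(IH _ hm) [p [p1 p2 p3]] hS]]].
    by exists [::].
  exists (rcons p b); rewrite all_rcons p1 hb rcons_path p2 last_rcons p3; split=> //.
rewrite /connT -/B; elim/last_ind: p h1 h2 => [|p x IH].
  by move=> _ _; apply: HB => //; rewrite /B /conn_step tka dra eqxx.
rewrite all_rcons rcons_path last_rcons => /andP [hx hp] /andP [hp1 hp2].
apply: HB => //; rewrite /B /conn_step tka dra; apply/orP; right; apply/exSP.
exists (last a p); last by rewrite IH.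
by case: (p) hp => //= y q /andP [hy /allP hq]; have := mem_last y q; rewrite inE => /orP [/eqP ->|/hq].
Qed.

Lemma def_connT rs ss us (S : forall A, rvs A -> ctx A -> seq (value A) -> seq (value A) -> bool) is_ js :
  isvs ss us is_ -> isvs ss us js ->
  Def rs (us ++ us ++ ss) (fun A r c => S A r (sh (size us) (sh (size us) c)) (tk (size us) c)
      (tk (size us) (sh (size us) c))) ->
  Def rs ss (fun A r c => connT us (S A r c) [seq c i | i <- is_] [seq c j | j <- js]).
Proof.
move=> h1 h2 hS.
pose B A (r : rvs A) c := conn_step us (S A r c).
suff : Def rs ss (fun A r c => ifpV (us ++ us) (B A r c) [seq c j | j <- is_ ++ js]).
  by apply: def_eq => A r c _ _; rewrite map_cat.
apply: (@def_ifpA tau rs ss (us ++ us) _ B); first exact: isvs_cat.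
set n := size us.
have tk1 T (c : nat -> T) : tk (n + n) c = tk n c ++ tk n (sh n c).
  by rewrite -map_iota_tk !tkE iotaD map_cat add0n.
have hin0 : isvs ((us ++ us) ++ ss) us (iota 0 n) by rewrite -catA; apply: (isvs_mid [::]).
have hin1 : isvs ((us ++ us) ++ ss) us (iota n n) by rewrite -catA; apply: isvs_mid.
apply: (@def_eq _ _ _ (fun A r c => (tk n c == tk n (sh n c)) ||
     exS us (fun m => r 0 (tk n c ++ m) && S A (fun k => r k.+1) (sh (n + n) c) m (tk n (sh n c))))).
  move=> A r c _ _; rewrite /B /conn_step size_cat tk1 take_size_cat ?size_tk // drop_size_cat ?size_tk //.
apply: def_or.
  have := def_eqs ((us ++ us) :: rs) hin0 hin1.
  by apply: def_eq => A r c _ _; rewrite !map_iota_tk.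
apply: (def_exS (P := fun A r c m => r 0 (tk n c ++ m) && S A (fun k => r k.+1) (sh (n + n) c) m (tk n (sh n c)))).
rewrite -/n; apply: def_and.
  have /andP [/eqP e1 e2] : isvs (us ++ (us ++ us) ++ ss) (us ++ us) (iota n n ++ iota 0 n).
    by apply: isvs_cat; rewrite -?catA; [apply: isvs_mid | apply: (isvs_mid [::])].
  have := @def_rv tau ((us ++ us) :: rs) (us ++ (us ++ us) ++ ss) 0 (iota n n ++ iota 0 n).
  rewrite /= e1 eqxx e2 => /(_ isT).
  by apply: def_eq => A r c _ _; rewrite map_cat !map_iota_tk.
have hh : isvs ((us ++ us ++ us) ++ ss) (us ++ us) (iota 0 n ++ iota (n + n) n).
  apply: isvs_cat; rewrite -?catA; first exact: (isvs_mid [::]).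
  by rewrite {2}/n -size_cat catA; apply: isvs_mid.
have := @def_move tau (us ++ us ++ us) (us ++ us) rs ss _
  (fun A r ts c => S A r c (take n ts) (drop n ts)) hh.
rewrite -!catA => hS'.
have /(def_weaken (us ++ us)) : Def rs (us ++ us ++ us ++ ss) (fun A r c =>
   S A r (sh (size (us ++ us ++ us)) c) (take n [seq c j | j <- iota 0 n ++ iota (n + n) n])
       (drop n [seq c j | j <- iota 0 n ++ iota (n + n) n])).
  apply: hS'; apply: def_eq hS => A r c _ _.
  by rewrite size_cat tk1 take_size_cat ?size_tk // drop_size_cat ?size_tk // shD.
apply: def_eq => A r c _ _.
rewrite map_cat !map_iota_tk take_size_cat ?size_tk // drop_size_cat ?size_tk //.
by rewrite !size_cat !shD.
Qed.
End Closure.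

(** * Counting equivalence classes *)

Section ClassCount.

(* The number of classes of E inside P, summed over the class sizes s. *)
Definition ccnt A (E : value A -> value A -> bool) (P : value A -> bool) : nat :=
  \sum_(s < #|car A|.+1) (cntE (fun u => P u && (cntE (E u) == s)) %/ s).

Lemma def_ccnt tau rs ss (E : forall A, rvs A -> ctx A -> value A -> value A -> bool)
   (P : forall A, rvs A -> ctx A -> value A -> bool) k : isv ss SN k ->
  Def tau rs (SE :: SE :: ss) (fun A r c => E A r (fun i => c i.+2) (c 1) (c 0)) ->
  Def tau rs (SE :: ss) (fun A r c => P A r (fun i => c i.+1) (c 0)) ->
  Def tau rs ss (fun A r c => ccnt (E A r c) (P A r c) == nv (c k)).
Proof.
move=> hk hE hP.
apply: (def_sum (f := fun A r c s => cntE (fun u => P A r c u && (cntE (E A r c u) == s)) %/ s)) => //.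
(* The quotient is characterised by a product and a remainder below s, all of them at most n; for s
   = 0 the value of [%/] is 0. *)
apply: (@def_eq _ _ _ (fun A r c => exV SN (fun m : value A =>
  (cntE (fun u => P A r (fun i => c i.+2) u && (cntE (E A r (fun i => c i.+2) u) == nv (c 0))) == nv m) &&
  (if nv (c 0) == 0 then nv (c 1) == 0 else exV SN (fun p : value A => exV SN (fun q : value A =>
     [&& nv (c 1) * nv (c 0) == nv p, nv q < nv (c 0) & nv p + nv q == nv m])))))).
  move=> A r c _ _; set x := cntE _.
  have hx : x <= #|car A| by apply: max_card.
  apply/exNP/idP.
    move=> [m hm /andP [/eqP ->]]; case: eqP => [-> /eqP ->|/eqP hs]; first by rewrite divn0.
    move=> /exNP [p hp /exNP [q hq /and3P [/eqP h1 h2 /eqP h3]]].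
    by rewrite -h3 -h1 divnMDl ?lt0n // divn_small // addn0.
  move=> /eqP h; exists x => //; rewrite nv_nval // eqxx /=.
  case: (eqVneq (nv (c 0)) 0) => [E0|h0]; first by rewrite -h E0 divn0.
  have hd := divn_eq x (nv (c 0)).
  have h1 : x %/ nv (c 0) * nv (c 0) <= #|car A| by apply: leq_trans (leq_trunc_div _ _) hx.
  have h2 : x %% nv (c 0) <= #|car A| by apply: leq_trans (leq_mod _ _) hx.
  apply/exNP; exists (x %/ nv (c 0) * nv (c 0)) => //.
  apply/exNP; exists (x %% nv (c 0)) => //.
  by rewrite -h !nv_nval // eqxx ltn_mod lt0n h0 -hd eqxx.
apply: def_exV; apply: def_and.
  apply: def_cnt => //; apply: def_and.
    exact: (@def_move tau [:: SE; SN; SN; SN] [:: SE] rs ss [:: 0] (fun A r ts c => P A r c (nth nz ts 0)) isT hP).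
  apply: def_cnt => //.
  exact: (@def_move tau [:: SE; SE; SN; SN; SN] [:: SE; SE] rs ss [:: 0; 1]
    (fun A r ts c => E A r c (nth nz ts 1) (nth nz ts 0)) isT hE).
by dfn2.
Qed.

(** The classes have no definable representatives, so they are counted through their members: the
    elements lying in classes of size s number s times the classes of that size. *)
Lemma ccntE A (e : rel (car A)) (p : pred (car A)) (E : value A -> value A -> bool) P :
  (forall u w, E (inl u) (inl w) = e u w) -> (forall u, P (inl u) = p u) ->
  (forall u, p u -> e u u) -> (forall u w, p u -> e u w -> p w) ->
  (forall u w, p u -> e u w -> e w =1 e u) ->
  ccnt E P = #|[set [set w | e u w] | u in p]|.
Proof.
move=> hE hP er ep ee; pose cl u := [set w | e u w].
have clP u : p u -> u \in cl u by move=> h; rewrite inE er.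
have cl_eq u w : p u -> w \in cl u -> cl w = cl u.
  by move=> hu; rewrite inE => hw; apply/setP => x; rewrite !inE (ee u w).
rewrite /ccnt.
have hs (b : {set car A}) : #|b| < #|car A|.+1 by rewrite ltnS max_card.
rewrite -sum1_card (partition_big (fun b : {set car A} => Ordinal (hs b)) xpredT) //=.
apply: eq_bigr => s _.
have -> : cntE (fun u => P u && (cntE (E u) == s)) = #|[pred u | p u & #|cl u| == s]|.
  rewrite /cntE; apply: eq_card => u; rewrite !inE hP; congr andb.
  by congr (_ == _); apply: eq_card => w; rewrite !inE hE.
have -> : #|[pred u | p u & #|cl u| == s]| =
    #|[pred b : {set car A} | (b \in [set cl u | u in p]) && (Ordinal (hs b) == s)]| * s.
  rewrite -[LHS]sum1_card (partition_big cl (fun b => (b \in [set cl u | u in p]) && (Ordinal (hs b) == s))) /=; last first.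
    by move=> u; rewrite inE => /andP [h1 /eqP h2]; rewrite imset_f // -val_eqE /= h2 eqxx.
  rewrite -sum_nat_const; apply: eq_big => // b /andP [/imsetP [u hu ->] /eqP <- /=].
  rewrite -[RHS]sum1_card; apply: eq_bigl => w; rewrite !inE.
  apply/andP/idP => [[/andP [h1 _] /eqP h]|h].
    by have := clP w h1; rewrite h inE.
  have hw : w \in cl u by rewrite inE.
  by rewrite (ep u w hu h) (cl_eq _ _ hu hw) !eqxx.
rewrite sum1_card; case: (posnP s) => [s0|s0]; first last.
  by rewrite mulnK //; apply: eq_card.
rewrite s0 divn0; apply/esym/eq_card0 => b; rewrite !inE; apply/negP => /andP [/imsetP [u hu ->] /eqP /(congr1 val) /=].
by rewrite s0 => /cards0_eq h; have := clP u hu; rewrite /cl h inE.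
Qed.
End ClassCount.

(** * The first-difference order on numerical relations *)

Section FirstDifference.
Variable A : structure.
Implicit Types (R : seq (value A) -> bool).
Local Notation n := #|car A|.

Fixpoint ltx (s t : seq (value A)) : bool :=
  match s, t with
  | x :: s', y :: t' => (nv x < nv y) || ((nv x == nv y) && ltx s' t')
  | _, _ => false end.
(** The tuple read as a numeral in base n + 1. This turns the lexicographic order into the order of
    the natural numbers, where least tuples exist. *)
Fixpoint weight (s : seq (value A)) : nat :=
  if s is x :: s' then nv x * n.+1 ^ size s' + weight s' else 0.
Lemma weight_lt s : weight s < n.+1 ^ size s.
Proof.
elim: s => // x s IH; rewrite /= expnS; have := nv_lt x.
move: (n.+1 ^ size s) IH => k IH h.
apply: (@leq_trans (nv x * k + k)); first by rewrite ltn_add2l.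
by rewrite addnC -mulSn leq_mul2r h orbT.
Qed.
Lemma ltxE s t : size s = size t -> ltx s t = (weight s < weight t).
Proof.
elim: s t => [|x s IH] [|y t] //= [h]; rewrite IH // h.
have := weight_lt s; have := weight_lt t; rewrite h.
move: (n.+1 ^ size t) => k h1 h2.
case: (ltngtP (nv x) (nv y)) => hxy /=; last by rewrite hxy ltn_add2l.
  symmetry; apply: (@leq_trans (nv x * k + k)); first by rewrite ltn_add2l.
  by apply: leq_trans (leq_addr _ _); rewrite addnC -mulSn leq_mul2r hxy orbT.
apply/esym/negbTE; rewrite -leqNgt; apply: ltnW.
apply: (@leq_trans (nv y * k + k)); first by rewrite ltn_add2l.
by apply: leq_trans (leq_addr _ _); rewrite addnC -mulSn leq_mul2r hxy orbT.
Qed.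
Lemma weight_inj k s t : wsort (nseq k SN) s -> wsort (nseq k SN) t -> weight s = weight t -> s = t.
Proof.
elim: k s t => [|k IH] [|x s] [|y t] //=; rewrite !wsort_cons => /andP [hx hs] /andP [hy ht] h.
have E : size s = size t by rewrite (wsort_size hs) (wsort_size ht).
have hxy : nv x = nv y.
  have := weight_lt s; have := weight_lt t; move: h; rewrite E.
  move: (n.+1 ^ size t) (weight s) (weight t) => m a b h h1 h2.
  have m0 : 0 < m by apply: leq_ltn_trans h2.
  by have := congr1 (divn^~ m) h; rewrite !divnMDl // !divn_small // !addn0.
congr cons; last by apply: IH => //; move: h; rewrite hxy E => /addnI.
by rewrite -[x]nval_nv // -[y]nval_nv // hxy.
Qed.

(** Comparison at the least tuple on which the relations differ: a definable strict order, total up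
    to agreement on well-sorted tuples. *)
Definition precedes us R R' := exS us (fun s => [&& R s, ~~ R' s & allS us (fun t => ltx t s ==> (R t == R' t))]).

Variable k : nat.
Local Notation us := (nseq k SN).

Lemma precedesP R R' :
  reflect (exists s, [/\ wsort us s, R s, ~~ R' s & forall t, wsort us t -> weight t < weight s -> R t = R' t])
    (precedes us R R').
Proof.
apply: (iffP (exSP _ _)) => [[s hs /and3P [h1 h2 /allSP h3]]|[s [hs h1 h2 h3]]]; exists s => //.
  split=> // t ht; rewrite -ltxE; last by rewrite (wsort_size hs) (wsort_size ht).
  by move=> hlt; apply/eqP; apply: implyP (h3 t ht) hlt.
rewrite h1 h2; apply/allSP => t ht; apply/implyP.
by rewrite ltxE; [move=> h; rewrite h3 | rewrite (wsort_size hs) (wsort_size ht)].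
Qed.
Lemma precedes_irr R : ~~ precedes us R R.
Proof. by apply/precedesP => [[s [_ h]]]; rewrite h. Qed.
Lemma precedes_trans R1 R2 R3 : precedes us R1 R2 -> precedes us R2 R3 -> precedes us R1 R3.
Proof.
move=> /precedesP [s [hs a1 a2 a3]] /precedesP [t [ht b1 b2 b3]]; apply/precedesP.
case: (ltngtP (weight s) (weight t)) => h.
- exists s; split=> //; first by rewrite -b3.
  by move=> x hx hlt; rewrite a3 // b3 //; apply: ltn_trans h.
- exists t; split=> //; first by rewrite a3.
  by move=> x hx hlt; rewrite a3 ?b3 //; apply: ltn_trans h.
- by have E := weight_inj hs ht h; rewrite -E (negPf a2) in b1.
Qed.
Lemma precedes_total R R' :
  [\/ precedes us R R', precedes us R' R | forall s, wsort us s -> R s = R' s].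
Proof.
case: (boolP (exS us (fun s => R s != R' s))) => [|/exSP h]; last first.
  by apply: Or33 => s hs; apply/eqP/negPn/negP => hn; apply: h; exists s.
move=> /exSP [s hs hne].
have hex : exists m, exS us (fun t => (weight t == m) && (R t != R' t)).
  by exists (weight s); apply/exSP; exists s => //; rewrite eqxx.
case: (ex_minnP hex) => m /exSP [t ht /andP [/eqP <- htne]] hmin {s hs hne}.
have hagree x : wsort us x -> weight x < weight t -> R x = R' x.
  move=> hx; apply: contraTeq => hn; rewrite -leqNgt; apply: hmin.
  by apply/exSP; exists x => //; rewrite eqxx.
case h1: (R t) htne; case h2: (R' t) => // _.
  by apply: Or31; apply/precedesP; exists t; rewrite h1 h2.
apply: Or32; apply/precedesP; exists t; rewrite h1 h2; split=> // x hx hlt.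
by rewrite hagree.
Qed.
End FirstDifference.

Lemma finite_minimal (T : finType) (P : pred T) (lt : rel T) x0 :
  (forall x, ~~ lt x x) -> (forall x y z, lt x y -> lt y z -> lt x z) -> P x0 ->
  exists2 x, P x & forall y, P y -> ~~ lt y x.
Proof.
move=> hi ht h0; case: (@arg_minnP T x0 P (fun x => #|[pred y | lt y x]|) h0) => x hx hmin.
exists x => // y hy; apply/negP => hlt; have := hmin y hy; rewrite leqNgt => /negP; apply.
apply: proper_card; apply/properP; split.
  by apply/subsetP => z; rewrite !inE => hz; apply: ht hlt.
by exists y; rewrite !inE ?hlt //; apply: hi.
Qed.

(** * Ranks in linear orders *)

Section Rank.
Variables (T : finType) (D : pred T) (le : rel T).
Hypothesis le_total : forall x y, D x -> D y -> le x y || le y x.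
Hypothesis le_anti : forall x y, D x -> D y -> le x y -> le y x -> x = y.
Hypothesis le_trans' : forall x y z, D x -> D y -> D z -> le x y -> le y z -> le x z.

Definition rank x := #|[pred y | D y && ~~ le x y]|.

Lemma rank_le x y : D x -> D y -> (rank x <= rank y) = le x y.
Proof.
move=> hx hy; apply/idP/idP => h; last first.
  apply: subset_leq_card; apply/subsetP => z; rewrite !inE => /andP [hz hn].
  by rewrite hz; apply: contra hn => h'; apply: le_trans' h h'.
apply: contraLR h => hn; rewrite -ltnNge; apply: proper_card; apply/properP.
have hyx : le y x by have := le_total hx hy; rewrite (negPf hn).
split; last by exists y; rewrite !inE hy ?hn // negbK; have := le_total hy hy; rewrite orbb.
apply/subsetP => z; rewrite !inE => /andP [hz hz']; rewrite hz.
by apply: contra hz' => h'; apply: le_trans' hyx h'.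
Qed.
Lemma rank_inj x y : D x -> D y -> rank x = rank y -> x = y.
Proof. by move=> hx hy h; apply: le_anti => //; rewrite -rank_le // h. Qed.
Lemma rank_lt x : D x -> rank x < #|D|.
Proof.
move=> hx; apply: proper_card; apply/properP; split.
  by apply/subsetP => y; rewrite inE => /andP [].
by exists x => //; rewrite inE negb_and negbK; have := le_total hx hx; rewrite orbb => ->; rewrite orbT.
Qed.
Lemma rank_onto d : d < #|D| -> exists2 x, D x & rank x = d.
Proof.
move=> hd; have x0 : 'I_#|D| by exact: Ordinal hd.
pose f x := if insub (rank x) is Some i then i else x0.
have fE x : D x -> f x = rank x :> nat by move=> hx; rewrite /f insubT ?rank_lt // => h; rewrite SubK.
have : f @: D = [set: 'I_#|D|].
  apply/eqP; rewrite eqEcard subsetT cardsT card_ord /= card_in_imset // => x y hx hy /(congr1 val) /=.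
  by rewrite !fE //; apply: rank_inj.
move=> /setP /(_ (Ordinal hd)); rewrite inE => /imsetP [x hx /(congr1 val) /= E].
by exists x; rewrite // E fE.
Qed.
End Rank.

Section DefinableRank.
Variable tau : seq nat.

Definition rank_start A us (D : seq (value A) -> bool) (Le : seq (value A) -> seq (value A) -> bool) t :=
  D t && allS us (fun t' => D t' ==> Le t t').
Definition rank_step A us (D : seq (value A) -> bool) (Le : seq (value A) -> seq (value A) -> bool)
    (Z : seq (value A) -> bool) t :=
  D t && exS us (fun t' => [&& Z t', ~~ Le t t' &
       allS us (fun t'' => [&& D t'' & ~~ Le t'' t'] ==> Le t t'')]).
(** Elements of an output structure are classes of tuples, so the elements below a given one cannot
    be counted directly. Their ranks are found by starting at the least element and passing to the
    immediate successor [d] times. *)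
Definition rankT A us (D : seq (value A) -> bool) Le d t :=
  iterV (fun _ : value A => rank_step us D Le) (rank_start us D Le) d t : bool.
Arguments rankT {A}.

Lemma rankTE A us (D : seq (value A) -> bool) Le (T : finType) (D' : pred T) (le : rel T) (cl : seq (value A) -> T) :
  (forall x y, D' x -> D' y -> le x y || le y x) ->
  (forall x y, D' x -> D' y -> le x y -> le y x -> x = y) ->
  (forall x y z, D' x -> D' y -> D' z -> le x y -> le y z -> le x z) ->
  (forall t, wsort us t -> D t -> D' (cl t)) ->
  (forall x, D' x -> exists t, [/\ wsort us t, D t & cl t = x]) ->
  (forall t t', wsort us t -> wsort us t' -> D t -> D t' -> Le t t' = le (cl t) (cl t')) ->
  forall d t, wsort us t -> rankT us D Le d t = D t && (rank D' le (cl t) == d).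
Proof.
move=> htot hanti htrans hD hsur hle.
have hAll (Q : T -> bool) (Q' : seq (value A) -> bool) :
   (forall t', wsort us t' -> D t' -> Q' t' = Q (cl t')) ->
   allS us (fun t' => D t' ==> Q' t') = [forall x, D' x ==> Q x].
  move=> h; apply/allSP/forallP => [h1 x|h1 t' ht'].
    apply/implyP => /hsur [t' [a b <-]]; rewrite -h //; exact: implyP (h1 _ a) b.
  by apply/implyP => b; rewrite h //; apply: implyP (h1 _) (hD _ ht' b).
elim=> [|d IH] t ht.
  rewrite /rankT /= /rank_start; case hDt: (D t) => //=.
  rewrite (hAll (fun x => le (cl t) x)) //; last by move=> t' ht' hDt'; rewrite hle.
  rewrite eqn0Ngt; apply/forallP/negP => [h|h x].
    by case/card_gt0P => x; rewrite !inE => /andP [/(implyP (h x)) ->].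
  apply/implyP => hx; apply/negPn/negP => hn; apply: h; apply/card_gt0P.
  by exists x; rewrite !inE hx.
rewrite [LHS](_ : _ = rank_step us D Le (rankT us D Le d) t) // /rank_step; case hDt: (D t) => //=.
have hx := hD t ht hDt; set x := cl t in hx *.
have hrl := rank_le htot htrans.
apply/exSP/eqP => [[t' ht']|hr].
  rewrite IH // => /and3P [/andP [hDt' /eqP hr] hn].
  have hy := hD t' ht' hDt'; rewrite hle // -/x in hn.
  rewrite (_ : allS us _ = allS us (fun t'' => D t'' ==> (~~ Le t'' t' ==> Le t t''))); last first.
    rewrite /allS; congr negb; congr exS; apply: functional_extensionality => t''.
    by case: (D t'') => //=.
  rewrite (hAll (fun z => ~~ le z (cl t') ==> le x z)); last by move=> s hs hDs; rewrite !hle.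
  move=> /forallP hall.
  rewrite -hr /rank.
  (* [x] is the immediate successor of [cl t'], so the elements below [x] are [cl t'] and those
     below it. *)
  have -> : #|[pred y | D' y & ~~ le x y]| = #|[predU1 (cl t') & [pred y | D' y & ~~ le (cl t') y]]|.
    apply: eq_card => z; rewrite !inE; case: eqP => [->|hz] /=; first by rewrite hy hn.
    case hDz: (D' z) => //=; apply/idP/idP => hh; last first.
      apply: contra hn => h1; apply: htrans h1 _ => //.
      by have := htot _ _ hDz hy; rewrite (negPf hh) orbF.
    apply/negP => h1; case/negP: hh; have := implyP (implyP (hall z) hDz); apply.
    by apply/negP => h2; apply: hz; apply: hanti.
  by rewrite cardU1 !inE hy /= negbK; have := htot _ _ hy hy; rewrite orbb => ->.
have hr0 : d < #|D'| by apply: leq_trans (rank_lt htot hx); rewrite hr.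
have [y hy hry] := rank_onto htot hanti htrans hr0.
have [t' [ht' hDt' hcl]] := hsur _ hy.
exists t' => //; rewrite IH // hDt' hcl hry eqxx /= hle // -/x hcl -hrl // hr hry ltnn /=.
apply/allSP => s hs; apply/implyP => /andP [hDs]; have hz := hD s hs hDs.
by rewrite !hle // -/x hcl -!hrl // -ltnNge hr hry.
Qed.

Lemma def_rankT rs ss us (D : forall A, rvs A -> ctx A -> seq (value A) -> bool)
   (Le : forall A, rvs A -> ctx A -> seq (value A) -> seq (value A) -> bool) i js :
  isv ss SN i -> isvs ss us js ->
  Def tau rs (us ++ ss) (fun A r c => D A r (sh (size us) c) (tk (size us) c)) ->
  Def tau rs (us ++ us ++ ss) (fun A r c => Le A r (sh (size us) (sh (size us) c)) (tk (size us) c)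
      (tk (size us) (sh (size us) c))) ->
  Def tau rs ss (fun A r c => rankT us (D A r c) (Le A r c) (nv (c i)) [seq c j | j <- js]).
Proof.
move=> hi hjs hD hL; rewrite /rankT; set n := size us.
have tk1 T (c : nat -> T) : tk (n + n) c = tk n c ++ tk n (sh n c).
  by rewrite -map_iota_tk !tkE iotaD map_cat add0n.
have eS T (x : nat -> T) : sh n.+1 x = sh 1 (sh n x) by rewrite -shD addn1.
have hD' pre is_ : isvs (pre ++ ss) us is_ ->
   Def tau rs (pre ++ ss) (fun A r c => D A r (sh (size pre) c) [seq c j | j <- is_]).
  move=> h; exact: (@def_move tau pre us rs ss is_ (fun A r ts c => D A r c ts) h hD).
have hL' pre is1 is2 : isvs (pre ++ ss) us is1 -> isvs (pre ++ ss) us is2 ->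
   Def tau rs (pre ++ ss) (fun A r c => Le A r (sh (size pre) c) [seq c j | j <- is1] [seq c j | j <- is2]).
  move=> h1 h2; have := @def_move tau pre (us ++ us) rs ss (is1 ++ is2)
    (fun A r ts c => Le A r c (take n ts) (drop n ts)) (isvs_cat h1 h2) _.
  case; last first.
    move=> h; apply: def_eq (DefI h) => A r c _ _.
    by rewrite map_cat take_size_cat ?drop_size_cat // size_map (isvs_size h1).
  rewrite -catA; apply: def_eq hL => A r c _ _.
  by rewrite size_cat tk1 take_size_cat ?size_tk // drop_size_cat ?size_tk // shD.
apply: (def_iter (us := us) (F := fun A r c _ => rank_step us (D A r c) (Le A r c))
  (R0 := fun A r c => rank_start us (D A r c) (Le A r c))) => //.
  rewrite /rank_start; apply: def_and => //.
  apply: (def_allS (P := fun A r c t' => D A r (sh n c) t' ==> Le A r (sh n c) (tk n c) t')).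
  have h0 : isvs ((us ++ us) ++ ss) us (iota 0 n) by rewrite -catA; apply: (isvs_mid [::]).
  have h1 : isvs ((us ++ us) ++ ss) us (iota n n) by rewrite -catA; apply: isvs_mid.
  rewrite catA -/n; apply: def_imp.
    by apply: def_eq (hD' _ _ h0) => A r c _ _; rewrite size_cat shD map_iota_tk.
  by apply: def_eq (hL' _ _ _ h1 h0) => A r c _ _; rewrite size_cat shD !map_iota_tk.
rewrite /rank_step -/n; apply: def_and.
  have h0 : isvs ((us ++ [:: SN]) ++ ss) us (iota 0 n) by rewrite -catA; apply: (isvs_mid [::]).
  have := def_weaken us (hD' _ _ h0); rewrite -catA; apply: def_eq => A r c _ _.
  by rewrite size_cat map_iota_tk addn1.
apply: (def_exS (P := fun A r c t' => [&& r 0 t', ~~ Le A (fun k => r k.+1) (sh n.+1 c) (tk n c) t' &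
   allS us (fun t'' => [&& D A (fun k => r k.+1) (sh n.+1 c) t'' & ~~ Le A (fun k => r k.+1) (sh n.+1 c) t'' t'] ==>
      Le A (fun k => r k.+1) (sh n.+1 c) (tk n c) t'')])).
rewrite -/n; apply: def_and.
  have /andP [/eqP e1 e2] := isvs_mid [::] us (us ++ SN :: ss).
  have := @def_rv tau (us :: rs) (us ++ us ++ SN :: ss) 0 (iota 0 n).
  rewrite /= e1 eqxx e2 => /(_ isT).
  by apply: def_eq => A r c _ _; rewrite map_iota_tk.
apply: def_and; first apply: def_not.
  have h0 : isvs ((us ++ us ++ [:: SN]) ++ ss) us (iota 0 n) by rewrite -!catA; apply: (isvs_mid [::]).
  have h1 : isvs ((us ++ us ++ [:: SN]) ++ ss) us (iota n n) by rewrite -!catA; apply: isvs_mid.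
  have := def_weaken us (hL' _ _ _ h1 h0); rewrite -!catA; apply: def_eq => A r c _ _.
  by rewrite !size_cat !map_iota_tk !shD !eS.
apply: (def_allS (P := fun A r c t'' => [&& D A (fun k => r k.+1) (sh n.+1 (sh n c)) t'' &
    ~~ Le A (fun k => r k.+1) (sh n.+1 (sh n c)) t'' (tk n c)] ==>
      Le A (fun k => r k.+1) (sh n.+1 (sh n c)) (tk n (sh n c)) t'')).
have E : us ++ us ++ us ++ SN :: ss = (us ++ us ++ us ++ [:: SN]) ++ ss by rewrite -!catA.
have h0 : isvs ((us ++ us ++ us ++ [:: SN]) ++ ss) us (iota 0 n) by rewrite -!catA; apply: (isvs_mid [::]).
have h1 : isvs ((us ++ us ++ us ++ [:: SN]) ++ ss) us (iota n n) by rewrite -!catA; apply: isvs_mid.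
have h2 : isvs ((us ++ us ++ us ++ [:: SN]) ++ ss) us (iota (n + n) n).
  by rewrite -!catA {2}/n -size_cat (catA us); apply: isvs_mid.
rewrite -/n E.
have hsh A (c : ctx A) : sh (size (us ++ us ++ us ++ [:: SN])) c = sh n.+1 (sh n (sh n c)).
  by rewrite !size_cat !shD !eS.
apply: def_imp; first apply: def_and; last 1 first.
- have := def_weaken us (hL' _ _ _ h2 h0); apply: def_eq => A r c _ _.
  by rewrite hsh !map_iota_tk !shD.
- have := def_weaken us (hD' _ _ h0); apply: def_eq => A r c _ _.
  by rewrite hsh !map_iota_tk.
apply: def_not.
have := def_weaken us (hL' _ _ _ h0 h1); apply: def_eq => A r c _ _.
by rewrite hsh !map_iota_tk.
Qed.
End DefinableRank.

Scheme nterm_formula_ind := Induction for nterm Sort Prop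
  with formula_nterm_ind := Induction for formula Sort Prop.

(** * Interpretations *)

Section Weakening.
Variable tau : seq nat.

Lemma def_weakens us rs ss (P : forall A, rvs A -> ctx A -> bool) :
  Def tau rs ss P -> Def tau (us ++ rs) ss (fun A r c => P A (sh (size us) r) c).
Proof. by elim: us P => //= u us IH P h; apply: (def_weaken u (IH _ h)). Qed.
Lemma def_weakctx pre rs ss (P : forall A, rvs A -> ctx A -> bool) :
  Def tau rs ss P -> Def tau rs (pre ++ ss) (fun A r c => P A r (sh (size pre) c)).
Proof. exact: (@def_move tau pre [::] rs ss [::] (fun A r _ c => P A r c) isT). Qed.
Lemma def_insert us mid rs ss (P : forall A, rvs A -> ctx A -> bool) :
  Def tau rs (us ++ ss) P ->
  Def tau rs (us ++ mid ++ ss) (fun A r c =>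
    P A r (catc (tk (size us) c) (sh (size mid) (sh (size us) c)))).
Proof.
move=> h; have h0 : isvs ((us ++ mid) ++ ss) us (iota 0 (size us)).
  by rewrite -catA; apply: (isvs_mid [::]).
have := @def_move tau (us ++ mid) us rs ss _ (fun A r ts c => P A r (catc ts c)) h0.
rewrite -catA; case; last first.
  by move=> hh; apply: def_eq (DefI hh) => A r c _ _; rewrite map_iota_tk size_cat shD.
by apply: def_eq h => A r c _ _; rewrite catc_tk_sh.
Qed.
End Weakening.

(* Each element or number of an interpreted structure is coded by an element and
   two numbers. *)
Definition cd : seq sort := [:: SE; SN; SN].
Fixpoint cds n : seq sort := if n is n'.+1 then cd ++ cds n' else [::].
Fixpoint sh3 {T} n (c : nat -> T) := if n is n'.+1 then sh3 n' (sh 3 c) else c.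
Lemma size_cds n : size (cds n) = 3 * n.
Proof. by elim: n => //= n ->; rewrite mulnS. Qed.
Lemma sh3E T n (c : nat -> T) : sh3 n c = sh (size (cds n)) c.
Proof. by elim: n c => //= n IH c; rewrite IH. Qed.
Lemma isvs_cds n k ss : k < n -> isvs (cds n ++ ss) cd (iota (3 * k) 3).
Proof.
move=> h; have -> : cds n = cds k ++ cd ++ cds (n - k.+1).
  elim: n k h => // n IH [|k] h /=; first by rewrite subn1.
  by rewrite (IH k) // subSS.
by rewrite -!catA -size_cds; apply: isvs_mid.
Qed.
Lemma cds_cat m n : cds (m + n) = cds m ++ cds n.
Proof. by elim: m => //= m ->. Qed.

Section Decoding.
Variables (G A : structure) (d : sort -> value G -> value G -> value G -> value A).

Definition dec3 s (cs : seq (value G)) := d s (nth nz cs 0) (nth nz cs 1) (nth nz cs 2).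
Fixpoint decs (us : seq sort) (cs : seq (value G)) : seq (value A) :=
  match us, cs with
  | s :: us', [:: x, y, z & cs'] => d s x y z :: decs us' cs'
  | _, _ => [::] end.
Fixpoint envE (xs : seq var) (c : ctx G) : env A :=
  if xs is v :: xs' then assign1 (envE xs' (sh 3 c)) v (d v.1 (c 0) (c 1) (c 2)) else env0.
(** The tuple is reversed because the bound variables of a fixed point are assigned from left to
    right: the last one is the newest and comes first in the context. *)
Fixpoint rvE (Xs : seq (nat * seq sort)) (r : rvs G) : nat -> seq (value A) -> bool :=
  if Xs is (X, us) :: Xs' then
    fun Y => if Y == X then fun ts => exS (cds (size us)) (fun cs => r 0 cs && (decs us cs == rev ts))
             else rvE Xs' (fun k => r k.+1) Y
  else fun _ _ => false.
Definition envX xs Xs r c := Env A (elt (envE xs c)) (num (envE xs c)) (rvE Xs r).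

Definition cod (xs : seq var) v := iota (3 * index v xs) 3.

Hypothesis d_match : forall s x y z, wsort cd [:: x; y; z] -> matches s (d s x y z).

Lemma wsort_cd (t : seq (value G)) : wsort cd t -> exists x y z, t = [:: x; y; z].
Proof.
by move=> h; have := wsort_size h; case: t h => [|x [|y [|z []]]] // _ _; exists x, y, z.
Qed.

Lemma lookup_envE xs c v ss : sorted_ctx (cds (size xs) ++ ss) c ->
  lookup (envE xs c) v = if v \in xs then Some (dec3 v.1 [seq c i | i <- cod xs v]) else None.
Proof.
elim: xs c => [|w xs IH] c hc; first by case: v => [[] k].
rewrite /= inE; case: (eqVneq v w) => [<-|hne] /=.
  rewrite lookup_assign1_eq; first by rewrite /cod /= ?eqxx /dec3.
  by apply: d_match; rewrite !wsort_cons (hc 0 isT) (hc 1 isT) (hc 2 isT).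
rewrite lookup_assign1 1?eq_sym // IH; last by move=> i hi; apply: (hc i.+3).
case: (v \in xs) => //; rewrite /cod /= ?[w == v]eq_sym ?(negPf hne) mulnS.
by rewrite /dec3 /= !addSn !add0n.
Qed.

Lemma decs_cods (vs xs : seq var) c : decs (map fst vs) [seq c i | i <- flatten (map (cod xs) vs)] =
  [seq dec3 v.1 [seq c i | i <- cod xs v] | v <- vs].
Proof. by elim: vs => //= v vs ->. Qed.

Lemma rvE_index Xs r X ts : rvE Xs r X ts = (X \in map fst Xs) &&
   let k := index X (map fst Xs) in let us := nth [::] (map snd Xs) k in
   exS (cds (size us)) (fun cs => r k cs && (decs us cs == rev ts)).
Proof.
elim: Xs r => //= [[Y us] Xs] IH r; rewrite inE [Y == X]eq_sym.
by case: (X == Y) => //=; rewrite IH.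
Qed.

Lemma decs_wsort us cs : wsort (cds (size us)) cs -> wsort us (decs us cs).
Proof.
elim: us cs => [|s us IH] cs; first by case: cs.
case: cs => [|x [|y [|z cs]]] //=; rewrite !wsort_cons ?andbF //.
  by case/and4P => h1 h2 h3 h4; rewrite d_match ?IH // !wsort_cons h1 h2 h3.
Qed.

Lemma assign_rcons (e : env A) vs v ts a : size vs = size ts ->
  assign e (rcons vs v) (rcons ts a) = assign1 (assign e vs ts) v a.
Proof. by move=> h; rewrite /assign zip_rcons // foldl_rcons. Qed.
Lemma size_decs us cs : size cs = 3 * size us -> size (decs us cs) = size us.
Proof.
elim: us cs => [|s us IH] cs /=; first by case: cs.
by rewrite mulnS; case: cs => [|x [|y [|z cs]]] //= [h]; rewrite IH.
Qed.
Lemma envE_cat ys xs c : envE (ys ++ xs) c =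
  assign (envE xs (sh3 (size ys) c)) (rev ys) (rev (decs (map fst ys) (tk (3 * size ys) c))).
Proof.
elim: ys c => [|y ys IH] c //.
rewrite [size (_ :: _)]/= mulnS !addSn add0n /= !rev_cons assign_rcons ?IH //.
by rewrite !size_rev size_decs ?size_map // size_tk.
Qed.

Lemma envX_cat ys xs X us Xs r c : envX (ys ++ xs) ((X, us) :: Xs) r c =
  assign (set_rv (envX xs Xs (fun k => r k.+1) (sh3 (size ys) c)) X
    (fun t => exS (cds (size us)) (fun cs => r 0 cs && (decs us cs == rev t))))
    (rev ys) (rev (decs (map fst ys) (tk (3 * size ys) c))).
Proof.
rewrite {1}/envX envE_cat.
set e1 := set_rv _ _ _; set e2 := envE _ _.
have : elt e1 = elt e2 /\ num e1 = num e2 by [].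
have : rv e1 = rvE ((X, us) :: Xs) r by [].
move: (rev ys) (rev (decs _ _)) e1 e2; elim=> [|y zs IH] [|t ts] e1 e2 h1 [h2 h3].
- by case: e1 h1 h2 h3 => /= ? ? ? -> -> ->.
- by case: e1 h1 h2 h3 => /= ? ? ? -> -> ->.
- by case: e1 h1 h2 h3 => /= ? ? ? -> -> ->.
rewrite !assign_cons; apply: IH; first by rewrite rv_assign1.
by case: y t => [[] y] [a|a]; rewrite //= h2 h3.
Qed.

Hypothesis d_surj : forall s v, matches s v -> exists2 cs, wsort cd cs & dec3 s cs = v.
Lemma decs_surj us ts : wsort us ts -> exists2 cs, wsort (cds (size us)) cs & decs us cs = ts.
Proof.
elim: us ts => [|s us IH] [|v ts] //; first by exists [::].
rewrite wsort_cons => /andP [hv hts].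
have [cs h1 h2] := IH _ hts; have [cs' h3 h4] := d_surj hv.
exists (cs' ++ cs); first by rewrite /= -[SE :: _]/(cd ++ cds (size us)) wsort_cat ?h3 // (wsort_size h3).
by have [x [y [z E]]] := wsort_cd h3; rewrite -h4 E /= h2.
Qed.
End Decoding.

Section Interpretation.
Variables (tau tau' : seq nat) (rs0 : seq (seq sort)) (ss0 : seq sort).
Variable S : forall G, rvs G -> ctx G -> structure.
Variable dec : forall G (r : rvs G) (c : ctx G), sort -> value G -> value G -> value G -> value (S r c).
Notation Dc r c := (@dec _ r c).

Hypothesis dec_match : forall G (r : rvs G) c s x y z, wsort cd [:: x; y; z] -> matches s (Dc r c s x y z).
Hypothesis dec_surj : forall G (r : rvs G) c, 0 < #|car G| -> sorted_ctx ss0 c ->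
  forall s v, matches s v -> exists2 cs, wsort cd cs & dec3 (Dc r c) s cs = v.
(* Bounds the number of stages of the fixed points of the interpreted structure. *)
Hypothesis S_size : forall G (r : rvs G) c, 0 < #|car G| -> sorted_ctx ss0 c ->
  #|car (S r c)|.+1 <= #|car G|.+1 ^ 3.
Hypothesis dec_eq : forall s, Def tau rs0 (cd ++ cd ++ ss0) (fun G r c =>
  Dc r (sh 6 c) s (c 0) (c 1) (c 2) == Dc r (sh 6 c) s (c 3) (c 4) (c 5)).
Hypothesis dec_le : Def tau rs0 (cd ++ cd ++ ss0) (fun G r c =>
  nv (Dc r (sh 6 c) SN (c 0) (c 1) (c 2)) <= nv (Dc r (sh 6 c) SN (c 3) (c 4) (c 5))).
Hypothesis dec_rel : forall i, i < size tau' -> let n := arity tau' i in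
  Def tau rs0 (cds n ++ ss0) (fun G r c =>
    relV i (decs (Dc r (sh3 n c)) (nseq n SE) (tk (3 * n) c))).
(** Several codes may denote the same element, so the size of a set of elements is not a number of
    codes. It has to be definable for an arbitrary set of codes, which is passed as relation
    variable 0. *)
Hypothesis dec_cnt : Def tau (cd :: rs0) (cd ++ ss0) (fun G r c =>
  #|[pred a | exS cd (fun cs => r 0 cs && (dec3 (Dc (fun k => r k.+1) (sh 3 c)) SE cs == inl a))]|
   == nv (Dc (fun k => r k.+1) (sh 3 c) SN (c 0) (c 1) (c 2))).

Implicit Types (Xs : seq (nat * seq sort)) (xs vs : seq var).
Definition rsX (Xs : seq (nat * seq sort)) := [seq cds (size p.2) | p <- Xs].
Notation St n m r c := (S (sh m r) (sh3 n c)).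
Notation Dt n m r c := (Dc (sh m r) (sh3 n c)).
Notation EX xs Xs r c := (envX (Dt (size xs) (size Xs) r c) xs Xs r c).

(** [xs] lists the variables that have a value, newest first, and [Xs] the relation variables in
    scope with their sorts. All other variables are undefined or empty, as in [env0], so every
    formula is covered, whatever its free variables. *)
Definition pulls (f : formula) := forall xs Xs,
  Def tau (rsX Xs ++ rs0) (cds (size xs) ++ ss0) (fun G r c =>
    eval tau' (St (size xs) (size Xs) r c) f (EX xs Xs r c)).
(** A term is translated through its graph on codes, since its value is a number of the interpreted
    structure and may exceed every number of [G]. *)
Definition pulls_t (t : nterm) := forall xs Xs,
  Def tau (rsX Xs ++ rs0) (cd ++ cds (size xs) ++ ss0) (fun G r c =>
    omap inr (teval tau' _ t (EX xs Xs r (sh 3 c))) ==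
    Some (Dt (size xs) (size Xs) r (sh 3 c) SN (c 0) (c 1) (c 2))).

Lemma size_rsX Xs : size (rsX Xs) = size Xs. Proof. by rewrite size_map. Qed.

Lemma sorted_base pre G (c : ctx G) : sorted_ctx (pre ++ ss0) c -> sorted_ctx ss0 (sh (size pre) c).
Proof.
move=> h i hi; have := h (size pre + i); rewrite size_cat ltn_add2l nth_cat shE.
by rewrite [size pre + i < _]ltnNge leq_addr /= addKn; apply.
Qed.
Lemma sorted_base3 n G (c : ctx G) : sorted_ctx (cds n ++ ss0) c -> sorted_ctx ss0 (sh3 n c).
Proof. by rewrite sh3E; apply: sorted_base. Qed.

Lemma def_codes (P : forall G (r : rvs G), ctx G -> seq (value G) -> bool) Xs pre us js :
  isvs (pre ++ ss0) us js ->
  Def tau rs0 (us ++ ss0) (fun G r c => P G r (sh (size us) c) (tk (size us) c)) ->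
  Def tau (rsX Xs ++ rs0) (pre ++ ss0) (fun G r c =>
    P G (sh (size Xs) r) (sh (size pre) c) [seq c j | j <- js]).
Proof.
move=> h1 h2; rewrite -(size_rsX Xs).
exact: (def_weakens (rsX Xs) (@def_move tau pre us rs0 ss0 js (fun A r ts c => P A r c ts) h1 h2)).
Qed.

Lemma def_eq3 Xs pre s is_ js : isvs (pre ++ ss0) cd is_ -> isvs (pre ++ ss0) cd js ->
  Def tau (rsX Xs ++ rs0) (pre ++ ss0) (fun G r c =>
    dec3 (Dc (sh (size Xs) r) (sh (size pre) c)) s [seq c i | i <- is_] ==
    dec3 (Dc (sh (size Xs) r) (sh (size pre) c)) s [seq c j | j <- js]).
Proof.
move=> h1 h2; have hs1 := isvs_size h1.
have := @def_codes (fun G r c ts => dec3 (Dc r c) s (take 3 ts) == dec3 (Dc r c) s (drop 3 ts)) Xs pre (cd ++ cd) _ (isvs_cat h1 h2) (dec_eq s).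
apply: def_eq => G r c _ _.
by rewrite map_cat take_size_cat ?drop_size_cat ?size_map.
Qed.

Lemma def_eqdecs Xs pre us is_ js : isvs (pre ++ ss0) (cds (size us)) is_ -> isvs (pre ++ ss0) (cds (size us)) js ->
  Def tau (rsX Xs ++ rs0) (pre ++ ss0) (fun G r c =>
    decs (Dc (sh (size Xs) r) (sh (size pre) c)) us [seq c i | i <- is_] ==
    decs (Dc (sh (size Xs) r) (sh (size pre) c)) us [seq c j | j <- js]).
Proof.
elim: us is_ js => [|s us IH] is_ js.
  by move=> _ _; apply: def_eq (def_true _ _ _) => G r c _ _; rewrite eqxx.
move=> h1 h2; have s1 := isvs_size h1; have s2 := isvs_size h2.
case: is_ s1 h1 => [|i1 [|i2 [|i3 is_]]] // s1; case: js s2 h2 => [|j1 [|j2 [|j3 js]]] // s2.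
rewrite /isvs /= !eqseq_cons => /andP [/and4P [a1' a2' a3' a4'] /and4P [b1' b2' b3' b4']].
move=> /andP [/and4P [a1 a2 a3 a4] /and4P [b1 b2 b3 b4]].
have hi : isvs (pre ++ ss0) cd [:: i1; i2; i3] by rewrite /isvs /= !eqseq_cons a1 a2 a3 b1 b2 b3.
have hj : isvs (pre ++ ss0) cd [:: j1; j2; j3] by rewrite /isvs /= !eqseq_cons a1' a2' a3' b1' b2' b3'.
have hI : isvs (pre ++ ss0) (cds (size us)) is_ by rewrite /isvs a4 b4.
have hJ : isvs (pre ++ ss0) (cds (size us)) js by rewrite /isvs a4' b4'.
apply: def_eq (def_and (def_eq3 Xs s hi hj) (IH _ _ hI hJ)) => G r c _ _.
by rewrite eqseq_cons.
Qed.

Lemma oeq_elt A (e : env A) x y :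
  oeq (elt e x) (elt e y) = isSome (lookup e (SE, x)) && (lookup e (SE, x) == lookup e (SE, y)).
Proof. by rewrite /=; case: (elt e x) => [a|]; case: (elt e y) => [b|]. Qed.

Lemma lookup_envX G A (d : sort -> value G -> value G -> value G -> value A) xs Xs r c v :
  lookup (envX d xs Xs r c) v = lookup (envE d xs c) v.
Proof. by case: v => [[] k]. Qed.

Lemma lookup_EX xs Xs G (r : rvs G) c ss v : sorted_ctx (cds (size xs) ++ ss) c ->
  lookup (EX xs Xs r c) v =
  if v \in xs then Some (dec3 (Dt (size xs) (size Xs) r c) v.1 [seq c i | i <- cod xs v]) else None.
Proof. by move=> hc; rewrite lookup_envX (lookup_envE _ _ hc) //; apply: dec_match. Qed.

Lemma isvs_cod xs v ss : v \in xs -> isvs (cds (size xs) ++ ss) cd (cod xs v).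
Proof. by move=> h; apply: isvs_cds; rewrite index_mem. Qed.

Lemma dec3_match G (r : rvs G) c s cs : wsort cd cs -> matches s (dec3 (Dc r c) s cs).
Proof. by move=> h; have [x [y [z E]]] := wsort_cd h; rewrite E in h *; apply: dec_match. Qed.

Lemma pull_eqE x y : pulls (FEqE x y).
Proof.
move=> xs Xs.
case: (boolP (((SE, x) \in xs) && ((SE, y) \in xs))) => [/andP [hx hy]|h].
  apply: def_eq (def_eq3 Xs SE (isvs_cod ss0 hx) (isvs_cod ss0 hy)) => G r c _ hc.
  by rewrite evalE oeq_elt !(lookup_EX _ _ _ hc) hx hy /= -sh3E.
apply: def_eq (def_false _ _ _) => G r c _ hc.
rewrite evalE oeq_elt !(lookup_EX _ _ _ hc); move: h.
by case: ((SE, x) \in xs); case: ((SE, y) \in xs).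
Qed.

Lemma pull_var p : pulls_t (TVar p).
Proof.
move=> xs Xs.
have L G (r : rvs G) c : sorted_ctx (cd ++ cds (size xs) ++ ss0) c ->
  omap inr (teval tau' _ (TVar p) (EX xs Xs r (sh 3 c))) =
  if (SN, p) \in xs then Some (dec3 (Dt (size xs) (size Xs) r (sh 3 c)) SN [seq sh 3 c i | i <- cod xs (SN, p)]) else None.
  by move=> hc; rewrite -(@lookup_EX _ _ _ _ _ ss0) // => i hi; apply: (hc i.+3).
case: (boolP ((SN, p) \in xs)) => hp; last first.
  by apply: def_eq (def_false _ _ _) => G r c _ hc; rewrite L // (negPf hp).
have h1 : isvs (cds (size xs).+1 ++ ss0) cd (iota (3 * (index (SN, p) xs).+1) 3).
  by apply: isvs_cds; rewrite ltnS index_mem.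
have h2 : isvs (cds (size xs).+1 ++ ss0) cd (iota 0 3) by apply: (@isvs_cds _ 0).
have := def_eq3 Xs SN h1 h2.
apply: def_eq => G r c _ hc; rewrite L // hp -sh3E.
by rewrite /cod mulnS addSn add2n.
Qed.


Lemma pull_eqN s t : pulls_t s -> pulls_t t -> pulls (FEqN s t).
Proof.
move=> hs ht xs Xs.
have := def_exS (P := fun G r c cs =>
   (omap inr (teval tau' _ s (EX xs Xs r c)) == Some (dec3 (Dt (size xs) (size Xs) r c) SN cs)) &&
   (omap inr (teval tau' _ t (EX xs Xs r c)) == Some (dec3 (Dt (size xs) (size Xs) r c) SN cs))) (def_and (hs xs Xs) (ht xs Xs)).
apply: def_eq => G r c hG hc; rewrite evalE.
have hb := sorted_base3 hc.
case: (teval _ _ s _) => [a|]; case: (teval _ _ t _) => [b|] /=; try by apply/negbTE/exSP => -[cs _]; rewrite ?andbF.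
apply/exSP/eqP => [[cs hcs /andP [/eqP [e1] /eqP [e2]]]|->].
  by have := etrans e1 (esym e2); case.
by have [cs h1 h2] := @dec_surj _ (sh (size Xs) r) _ hG hb SN (inr b) isT; exists cs; rewrite ?h2 ?eqxx.
Qed.

Lemma pull_leN s t : pulls_t s -> pulls_t t -> pulls (FLeN s t).
Proof.
move=> hs ht xs Xs.
have hs' := def_weakctx cd (hs xs Xs).
have ht' := def_insert cd (ht xs Xs).
have hle : Def tau (rsX Xs ++ rs0) (cd ++ cd ++ cds (size xs) ++ ss0) (fun G r c =>
   nv (dec3 (Dt (size xs) (size Xs) r (sh 6 c)) SN (tk 3 (sh 3 c))) <= nv (dec3 (Dt (size xs) (size Xs) r (sh 6 c)) SN (tk 3 c))).
  have h : isvs (cds (size xs).+2 ++ ss0) (cd ++ cd) (iota 3 3 ++ iota 0 3).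
    by apply: isvs_cat; [apply: (@isvs_cds _ 1) | apply: (@isvs_cds _ 0)].
  have := @def_codes (fun G r c ts => nv (dec3 (Dc r c) SN (take 3 ts)) <= nv (dec3 (Dc r c) SN (drop 3 ts))) Xs _ _ _ h dec_le.
  by apply: def_eq => G r c _ _; rewrite -sh3E.
have := def_exS (P := fun G r c cs => exS cd (fun cs' =>
   [&& omap inr (teval tau' _ s (EX xs Xs r c)) == Some (dec3 (Dt (size xs) (size Xs) r c) SN cs),
       omap inr (teval tau' _ t (EX xs Xs r c)) == Some (dec3 (Dt (size xs) (size Xs) r c) SN cs') &
       nv (dec3 (Dt (size xs) (size Xs) r c) SN cs) <= nv (dec3 (Dt (size xs) (size Xs) r c) SN cs')]))
   (def_exS (P := fun G r c cs' =>
   [&& omap inr (teval tau' _ s (EX xs Xs r (sh 3 c))) == Some (dec3 (Dt (size xs) (size Xs) r (sh 3 c)) SN (tk 3 c)),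
       omap inr (teval tau' _ t (EX xs Xs r (sh 3 c))) == Some (dec3 (Dt (size xs) (size Xs) r (sh 3 c)) SN cs') &
       nv (dec3 (Dt (size xs) (size Xs) r (sh 3 c)) SN (tk 3 c)) <= nv (dec3 (Dt (size xs) (size Xs) r (sh 3 c)) SN cs')])
   (def_and hs' (def_and ht' hle))).
apply: def_eq => G r c hG hc; rewrite evalE.
have hb := sorted_base3 hc.
case: (teval _ _ s _) => [a|] /=; last by apply/negbTE/exSP => -[cs _] /exSP [cs' _]; rewrite ?andbF.
case: (teval _ _ t _) => [b|] /=; last by apply/negbTE/exSP => -[cs _] /exSP [cs' _]; rewrite ?andbF.
apply/exSP/idP => [[cs hcs /exSP [cs' hcs' /and3P [/eqP [<-] /eqP [<-]]]] //|h].
have [cs h1 h2] := @dec_surj _ (sh (size Xs) r) _ hG hb SN (inr a) isT.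
have [cs' h3 h4] := @dec_surj _ (sh (size Xs) r) _ hG hb SN (inr b) isT.
by exists cs => //; apply/exSP; exists cs' => //; rewrite h2 h4 !eqxx.
Qed.

Lemma pull_not g : pulls g -> pulls (FNot g).
Proof. by move=> h xs Xs; apply: def_eq (def_not (h xs Xs)) => G r c _ _; rewrite evalE. Qed.
Lemma pull_and f g : pulls f -> pulls g -> pulls (FAnd f g).
Proof. by move=> h h' xs Xs; apply: def_eq (def_and (h xs Xs) (h' xs Xs)) => G r c _ _; rewrite evalE. Qed.
Lemma pull_or f g : pulls f -> pulls g -> pulls (FOr f g).
Proof. by move=> h h' xs Xs; apply: def_eq (def_or (h xs Xs) (h' xs Xs)) => G r c _ _; rewrite evalE. Qed.

Lemma EX_cons v xs Xs G (r : rvs G) c : wsort cd (tk 3 c) ->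
  EX (v :: xs) Xs r c =
  assign1 (EX xs Xs r (sh 3 c)) v (dec3 (Dt (size xs) (size Xs) r (sh 3 c)) v.1 (tk 3 c)).
Proof.
move=> h; have := @dec_match _ (sh (size Xs) r) (sh3 (size xs) (sh 3 c)) v.1 _ _ _ h.
by rewrite /envX /=; case: v => [[] k] /=; rewrite /dec3 /=; case: (Dc _ _ _ _ _ _).
Qed.

Lemma pull_ex s x g (F : forall A, env A -> bool) : pulls g ->
  (forall A (e : env A), F A e = exV s (fun a => eval tau' A g (assign1 e (s, x) a))) ->
  forall xs Xs, Def tau (rsX Xs ++ rs0) (cds (size xs) ++ ss0) (fun G r c => F _ (EX xs Xs r c)).
Proof.
move=> h hF xs Xs.
pose Q G (r : rvs G) c cs := eval tau' _ g (assign1 (EX xs Xs r c) (s, x) (dec3 (Dt (size xs) (size Xs) r c) s cs)).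
apply: (@def_eq _ _ _ (fun G r c => exS cd (Q G r c))) => [G r c hG hc|].
  rewrite hF; have hb := sorted_base3 hc.
  apply/exSP/exVP => [[cs h1 h2]|[v h1 h2]].
    by exists (dec3 (Dt (size xs) (size Xs) r c) s cs) => //; apply: dec3_match.
  by have [cs h3 h4] := @dec_surj _ (sh (size Xs) r) _ hG hb _ _ h1; exists cs; rewrite /Q ?h4.
apply: def_exS.
apply: def_eq (h ((s, x) :: xs) Xs) => G r c hG hc.
have hw : wsort cd (tk 3 c).
  by rewrite /= !wsort_cons (hc 0 isT) (hc 1 isT) (hc 2 isT).
by rewrite (EX_cons _ _ _ _ hw).
Qed.

Lemma pull_exE x g : pulls g -> pulls (FExE x g).
Proof. by move=> h; apply: (@pull_ex SE x g (fun A e => eval tau' A (FExE x g) e) h). Qed.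
Lemma pull_exN x g : pulls g -> pulls (FExN x g).
Proof. by move=> h; apply: (@pull_ex SN x g (fun A e => eval tau' A (FExN x g) e) h). Qed.

Lemma isvs_cods vs xs ss : all (mem xs) vs ->
  isvs (cds (size xs) ++ ss) (cds (size vs)) (flatten [seq cod xs v | v <- vs]).
Proof.
elim: vs => [|v vs IH] //= /andP [h1 h2].
by apply: (@isvs_cat _ cd _ (cod xs v)); [apply: isvs_cod | apply: IH].
Qed.

Lemma pull_rel i zs : pulls (FRel i zs).
Proof.
move=> xs Xs; set vs' := map (pair SE) zs.
have hlook G (r : rvs G) c x : sorted_ctx (cds (size xs) ++ ss0) c -> elt (EX xs Xs r c) x =
  if (SE, x) \in xs then ev (dec3 (Dt (size xs) (size Xs) r c) SE [seq c i | i <- cod xs (SE, x)]) else None.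
  move=> hc; have := lookup_EX Xs r (SE, x) hc; case: ifP => hx /=; last by case: (elt _ _).
  by case: (elt _ _) => //= a [<-].
case: (boolP [&& i < size tau', size zs == arity tau' i & all (mem xs) vs']) => [/and3P [h1 /eqP h2 h3]|h].
  have hjs := isvs_cods ss0 h3; rewrite size_map h2 in hjs.
  have := @def_codes (fun G r c ts => relV i (decs (Dc r c) (nseq (arity tau' i) SE) ts)) Xs _ _ _ hjs.
  case=> [|hh].
    by apply: def_eq (dec_rel h1) => G r c _ _; rewrite sh3E size_cds.
  apply: def_eq (DefI hh) => G r c hG hc.
  rewrite evalE /= h1 h2 eqxx -sh3E.
  have -> : nseq (arity tau' i) SE = map fst vs' by rewrite -h2 /vs' -map_comp; elim: (zs) => //= a s ->.
  have hall : all isSome [seq elt (EX xs Xs r c) i0 | i0 <- zs].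
    rewrite all_map; apply/allP => x hx /=; rewrite hlook //.
    have hx' : (SE, x) \in xs by apply: (allP h3); apply: map_f.
    rewrite hx'; have := @dec3_match _ (sh (size Xs) r) (sh3 (size xs) c) SE [seq c i | i <- cod xs (SE, x)].
    case: (dec3 _ _ _) => //= b; apply; apply: isvs_wsort (isvs_cod ss0 hx') => //.
  rewrite hall decs_cods /relV; congr srel.
  rewrite /vs' -map_comp; elim: (zs) (h3 : all (mem xs) (map (pair SE) zs)) => //= x s IH /andP [hx hs].
  by rewrite hlook // hx IH.
apply: def_eq (def_false _ _ _) => G r c hG hc; rewrite evalE /=.
apply/esym/negbTE; apply: contra h => /and4P [-> -> /allP h3 _] /=.
apply/allP => _ /mapP [x hx ->] /=; have := h3 _ (map_f _ hx); rewrite hlook //.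
by case: ifP.
Qed.

Lemma wsort_uniq G us us' (t : seq (value G)) : wsort us t -> wsort us' t -> us = us'.
Proof.
elim: t us us' => [|a t IH] [|u us] [|u' us'] //; rewrite !wsort_cons => /andP [h1 h2] /andP [h3 h4].
by rewrite (IH _ _ h2 h4); case: u u' h1 h3 => [] [] //; case: a.
Qed.

Lemma wsort_rev G us (t : seq (value G)) : wsort us t -> wsort (rev us) (rev t).
Proof.
elim: us t => [|u us IH] [|a t] //; rewrite wsort_cons => /andP [h1 h2].
by rewrite !rev_cons -!cats1 wsort_cat ?(wsort_size (IH _ h2)) // IH // wsort_cons h1.
Qed.

Notation vals xs Xs vs r c := [seq dec3 (Dt (size xs) (size Xs) r c) v.1 [seq c i | i <- cod xs v] | v <- vs].

Lemma vals_wsort xs Xs vs G (r : rvs G) c : sorted_ctx (cds (size xs) ++ ss0) c -> all (mem xs) vs ->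
  wsort (map fst vs) (vals xs Xs vs r c).
Proof.
move=> hc; elim: vs => //= v vs IH /andP [h1 h2]; rewrite wsort_cons IH // andbT.
by apply: dec3_match; apply: isvs_wsort (isvs_cod ss0 h1).
Qed.

Lemma lookups xs Xs vs G (r : rvs G) c : sorted_ctx (cds (size xs) ++ ss0) c -> all (mem xs) vs ->
  [seq lookup (EX xs Xs r c) v | v <- vs] = [seq Some v | v <- vals xs Xs vs r c].
Proof.
move=> hc h; rewrite -map_comp; apply/eq_in_map => v /(allP h) hv.
by rewrite (lookup_EX _ _ _ hc) (hv : v \in xs).
Qed.
Lemma lookups_fail xs Xs vs G (r : rvs G) c : sorted_ctx (cds (size xs) ++ ss0) c -> ~~ all (mem xs) vs ->
  all isSome [seq lookup (EX xs Xs r c) v | v <- vs] = false.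
Proof.
move=> hc h; apply/negbTE; apply: contra h; rewrite all_map => /allP h; apply/allP => v /h /=.
by rewrite (lookup_EX _ _ _ hc); case: ifP.
Qed.

Lemma def_codes_eq xs Xs vs : all (mem xs) vs ->
  Def tau (rsX Xs ++ rs0) (cds (size vs) ++ cds (size xs) ++ ss0) (fun G r c =>
    decs (Dt (size xs) (size Xs) r (sh (size (cds (size vs))) c)) (rev (map fst vs)) (tk (size (cds (size vs))) c)
    == rev (vals xs Xs vs r (sh (size (cds (size vs))) c))).
Proof.
move=> h; set m := size vs; set us := rev (map fst vs).
have hm : size us = m by rewrite size_rev size_map.
have h1 : isvs ((cds m ++ cds (size xs)) ++ ss0) (cds (size us)) (iota 0 (size (cds m))).
  by rewrite hm -catA; apply: (isvs_mid [::]).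
have h2 : isvs ((cds m ++ cds (size xs)) ++ ss0) (cds (size us)) [seq size (cds m) + j | j <- flatten [seq cod xs v | v <- rev vs]].
  have hr : all (mem xs) (rev vs) by rewrite all_rev.
  have /andP [/eqP e1 /allP e2] := isvs_cods ss0 hr; rewrite -catA; apply/andP; split.
    rewrite -map_comp hm /m -(size_rev vs) -e1; apply/eqP/eq_map => j /=.
    by rewrite nth_cat ltnNge leq_addr addKn.
  by apply/allP => _ /mapP [j /e2 hj ->]; rewrite size_cat ltn_add2l.
have := def_eqdecs Xs h1 h2; rewrite -catA; apply: def_eq => G r c _ _.
rewrite map_iota_tk size_cat shD -sh3E; congr (_ == _).
rewrite -map_rev -(decs_cods _ (rev vs) xs); congr decs; first by rewrite /us map_rev.
by rewrite -map_comp; apply: eq_map => j /=; rewrite shE.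
Qed.

Lemma def_codes_eq' xs Xs vs us : all (mem xs) vs ->
  Def tau (rsX Xs ++ rs0) (cds (size us) ++ cds (size xs) ++ ss0) (fun G r c =>
    decs (Dt (size xs) (size Xs) r (sh (size (cds (size us))) c)) us (tk (size (cds (size us))) c)
    == rev (vals xs Xs vs r (sh (size (cds (size us))) c))).
Proof.
move=> h; case: (eqVneq us (rev (map fst vs))) => [->|hne].
  by rewrite size_rev size_map; apply: def_codes_eq.
apply: def_eq (def_false _ _ _) => G r c hG hc; apply/esym/negbTE; apply: contra hne => /eqP E; apply/eqP.
apply: (@wsort_uniq _ _ _ (decs (Dt (size xs) (size Xs) r (sh (size (cds (size us))) c)) us (tk (size (cds (size us))) c))).
  apply: decs_wsort => [*|]; first exact: dec_match.
  have := isvs_wsort hc (isvs_mid [::] (cds (size us)) (cds (size xs) ++ ss0)).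
  by rewrite map_iota_tk.
rewrite E; apply/wsort_rev/vals_wsort => // i hi.
have := hc (size (cds (size us)) + i); rewrite size_cat ltn_add2l nth_cat shE.
by rewrite [_ + i < _]ltnNge leq_addr /= addKn; apply.
Qed.

Lemma pull_rvar X vs : pulls (FRVar X vs).
Proof.
move=> xs Xs; set k := index X (map fst Xs); set us := nth [::] (map snd Xs) k.
case: (boolP (all (mem xs) vs)) => hvs; last first.
  by apply: def_eq (def_false _ _ _) => G r c hG hc; rewrite evalE /= lookups_fail.
(* For [X] out of scope, or for arguments of other sorts than declared, the atom is false in the
   interpreted structure. *)
case: (boolP ((X \in map fst Xs) && (us == rev (map fst vs)))) => [/andP [hX /eqP hus]|h]; last first.
  apply: def_eq (def_false _ _ _) => G r c hG hc.
  rewrite evalE /= lookups // all_isSome_map pmap_Some_map andTb rvE_index -/k -/us.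
  apply/esym/negbTE/negP => /andP [hX /exSP [cs hcs /andP [_ /eqP hd]]].
  case/negP: h; rewrite hX /=; apply/eqP/(@wsort_uniq _ _ _ (decs (Dt (size xs) (size Xs) r c) us cs)).
    by apply: decs_wsort => // *; apply: dec_match.
  by rewrite hd; apply/wsort_rev/vals_wsort.
have hk : k < size Xs by rewrite -(size_map fst) index_mem.
have hsz : size us = size vs by rewrite hus size_rev size_map.
apply: (@def_eq _ _ _ (fun G r c => exS (cds (size vs)) (fun cs => r k cs &&
    (decs (Dt (size xs) (size Xs) r c) (rev (map fst vs)) cs == rev (vals xs Xs vs r c))))) => [G r c hG hc|].
  by rewrite evalE /= lookups // all_isSome_map pmap_Some_map andTb rvE_index hX /= -/k -/us hsz hus.
apply: (def_exS (P := fun G r c cs => r k cs &&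
    (decs (Dt (size xs) (size Xs) r c) (rev (map fst vs)) cs == rev (vals xs Xs vs r c)))).
apply: def_and; last exact: def_codes_eq.
have /andP [/eqP e1 e2] := isvs_mid [::] (cds (size vs)) (cds (size xs) ++ ss0).
have := @def_rv tau (rsX Xs ++ rs0) (cds (size vs) ++ cds (size xs) ++ ss0) k (iota 0 (size (cds (size vs)))).
rewrite [size (rsX Xs ++ rs0)]size_cat size_rsX (leq_trans hk) ?leq_addr // e2 e1 nth_cat size_rsX hk.
rewrite (nth_map (0, [::])) // -hsz /us (nth_map (0, [::])) // eqxx => /(_ isT).
by apply: def_eq => G r c _ _; rewrite map_iota_tk.
Qed.

(** The fixed point is run on codes, and its stages are the sets of codes of the stages in the
    interpreted structure. It runs for at least as many stages by [S_size], and [stage_ge] shows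
    that the surplus adds nothing. *)
Lemma pull_ifp X us g ws : pulls g -> pulls (FIfp X us g ws).
Proof.
move=> hg xs Xs.
case: (boolP (all (mem xs) ws)) => hws; last first.
  by apply: def_eq (def_false _ _ _) => G r c hG hc; rewrite eval_ifp /= lookups_fail.
set k := size us; set uss := rev (map fst us).
have huss : size uss = k by rewrite size_rev size_map.
pose lift G (r : rvs G) c (Z : seq (value G) -> bool) t :=
  exS (cds k) (fun cs => Z cs && (decs (Dt (size xs) (size Xs) r c) uss cs == rev t)).
pose B G (r : rvs G) c (Z : seq (value G) -> bool) cs := eval tau' _ g
  (assign (set_rv (EX xs Xs r c) X (lift G r c Z)) us (rev (decs (Dt (size xs) (size Xs) r c) uss cs))).
have hB : Def tau (rsX Xs ++ rs0) (cds k ++ cds (size xs) ++ ss0) (fun G r c =>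
    ifpV (cds k) (B G r (sh (size (cds k)) c)) (tk (size (cds k)) c)).
  apply: def_ifp.
  have := hg (rev us ++ xs) ((X, uss) :: Xs).
  rewrite size_cat size_rev -/k cds_cat -catA [rsX _]/= huss.
  apply: def_eq => G r c hG hc.
  have E : sh3 (k + size xs) c = sh3 (size xs) (sh (size (cds k)) c).
    by rewrite !sh3E cds_cat size_cat shD.
  rewrite [size (_ :: _)]/= E /B /lift; congr (eval tau' _ g).
  rewrite envX_cat revK size_rev -/k map_rev -/uss [sh3 k c]sh3E huss.
  by have -> : tk (3 * k) c = tk (size (cds k)) c by rewrite size_cds.
apply: (@def_eq _ _ _ (fun G r c => exS (cds k) (fun cs => ifpV (cds k) (B G r c) cs &&
    (decs (Dt (size xs) (size Xs) r c) uss cs == rev (vals xs Xs ws r c))))) => [G r c hG hc|].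
  rewrite eval_ifp lookups // [RHS]/= all_isSome_map pmap_Some_map andTb.
  set d := Dt _ _ _ _; set ts := vals _ _ _ _ _.
  have dm : forall s x y z, wsort cd [:: x; y; z] -> matches s (d s x y z) by move=> *; apply: dec_match.
  have ds := @dec_surj _ (sh (size Xs) r) _ hG (sorted_base3 hc).
  pose BA P t := eval tau' _ g (assign (set_rv (EX xs Xs r c) X P) us t).
  have H j : forall t, stage (map fst us) BA j t = exS (cds k) (fun cs => stage (cds k) (B G r c) j cs && (decs d uss cs == rev t)).
    elim: j => [|j IH] t; first by apply/esym/negbTE/exSP => -[].
    rewrite stageS IH.
    have -> : stage (map fst us) BA j = lift G r c (stage (cds k) (B G r c) j).
      by apply: functional_extensionality.
    apply/orP/exSP => [[/exSP [cs h1 /andP [h2 h3]]|/andP [h1 h2]]|[cs h1 /andP []]].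
    - by exists cs => //; rewrite stageS h2.
    - have [cs h3 h4] := decs_surj ds (wsort_rev h1).
      rewrite size_rev size_map -/k in h3.
      exists cs => //; rewrite stageS h3 /B h4 revK eqxx andbT; apply/orP; right.
      by apply: h2.
    - rewrite stageS => /orP [h2|/andP [_ h2]] /eqP h3.
        by left; apply/exSP; exists cs => //; rewrite h2 h3 eqxx.
      right; have h4 : rev (decs d uss cs) = t by rewrite h3 revK.
      rewrite -h4; apply/andP; split => //.
      by rewrite -[map fst us]revK; apply/wsort_rev/decs_wsort; rewrite ?huss.
  rewrite -/(stage (map fst us) BA (#|car (St (size xs) (size Xs) r c)|.+1 ^ size us) ts).
  have := @stage_ge _ (map fst us) BA (#|car G|.+1 ^ (size (cds k)).+1).
  rewrite size_map => <-; first by rewrite H.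
  rewrite size_cds expnS expnM; apply: leq_trans (leq_pmull _ _) => //.
  rewrite -/k; case: (k) => // m; rewrite leq_exp2r //; apply: S_size => //; exact: sorted_base3 hc.
apply: (def_exS (P := fun G r c cs => ifpV (cds k) (B G r c) cs &&
    (decs (Dt (size xs) (size Xs) r c) uss cs == rev (vals xs Xs ws r c)))).
apply: def_and; first exact: hB.
by have := def_codes_eq' Xs uss hws; rewrite huss.
Qed.

(** [def_let] passes the set of codes of the elements satisfying [g] to the relation variable over
    which [dec_cnt] counts. *)
Lemma pull_count x g : pulls g -> pulls_t (TCount x g).
Proof.
move=> hg xs Xs.
pose P G (r : rvs G) c (Z : seq (value G) -> bool) :=
  #|[pred a | exS cd (fun cs => Z cs && (dec3 (Dt (size xs) (size Xs) r (sh 3 c)) SE cs == inl a))]|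
   == nv (dec3 (Dt (size xs) (size Xs) r (sh 3 c)) SN (tk 3 c)).
pose Q G (r : rvs G) c (cs : seq (value G)) := eval tau' _ g
  (assign1 (EX xs Xs r (sh 3 c)) (SE, x) (dec3 (Dt (size xs) (size Xs) r (sh 3 c)) SE cs)).
have hP : Def tau (cd :: rsX Xs ++ rs0) (cd ++ cds (size xs) ++ ss0) (fun G r c => P G (fun k => r k.+1) c (r 0)).
  have h : isvs ((cd ++ cds (size xs)) ++ ss0) cd (iota 0 3).
    exact: (@isvs_cds (size xs).+1 0 ss0 isT).
  have h1 := @def_move tau (cd ++ cds (size xs)) cd (cd :: rs0) ss0 _ (fun G r cs c =>
     #|[pred a | exS cd (fun cs => r 0 cs && (dec3 (Dc (fun k => r k.+1) c) SE cs == inl a))]|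
      == nv (dec3 (Dc (fun k => r k.+1) c) SN cs)) h dec_cnt.
  have h2 := @def_rename tau (fun k => if k is k'.+1 then (size Xs + k').+1 else 0) (cd :: rs0) (cd :: rsX Xs ++ rs0) _ _ _ h1.
  have h3 : forall k, k < size (cd :: rs0) -> (if k is k'.+1 then (size Xs + k').+1 else 0) < size (cd :: rsX Xs ++ rs0) /\
     nth [::] (cd :: rsX Xs ++ rs0) (if k is k'.+1 then (size Xs + k').+1 else 0) = nth [::] (cd :: rs0) k.
    case=> [|k] //= hk; rewrite size_cat size_rsX nth_cat size_rsX ltnS ltn_add2l.
    by rewrite [_ + k < _]ltnNge leq_addr /= addKn.
  have := h2 h3; rewrite -catA; apply: def_eq => G r c hG hc; rewrite /P size_cat shD -sh3E.
  have -> : (fun k => r (size Xs + k).+1) = sh (size Xs) (fun k => r k.+1).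
    by apply: functional_extensionality => k; rewrite shE.
  by rewrite map_iota_tk.
have hQ : Def tau (rsX Xs ++ rs0) (cd ++ cd ++ cds (size xs) ++ ss0) (fun G r c => Q G r (sh 3 c) (tk 3 c)).
  have := @def_insert tau cd cd _ (cds (size xs) ++ ss0) _ (hg ((SE, x) :: xs) Xs).
  apply: def_eq => G r c hG hc; rewrite EX_cons //.
  by rewrite /= !wsort_cons (hc 0 isT) (hc 1 isT) (hc 2 isT).
have := def_let (P := P) (Q := Q) hP hQ.
apply: def_eq => G r c hG hc; rewrite teval_count /P.
have hb : sorted_ctx ss0 (sh3 (size xs) (sh 3 c)) by apply: (@sorted_base3 (size xs).+1).
have hw : wsort cd (tk 3 c) by rewrite /= !wsort_cons (hc 0 isT) (hc 1 isT) (hc 2 isT).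
rewrite /Q; set d := Dt _ _ _ _.
have -> : #|[pred a | exS cd (fun cs => eval tau' _ g (assign1 (EX xs Xs r (sh 3 c)) (SE, x) (dec3 d SE cs)) && (dec3 d SE cs == inl a))]| =
   #|[pred a | eval tau' _ g (set_elt (EX xs Xs r (sh 3 c)) x a)]|.
  apply: eq_card => a; rewrite !inE; apply/exSP/idP => [[cs h1 /andP [h2 /eqP h3]]|h].
    by rewrite h3 in h2.
  have [cs h1 h2] := @dec_surj _ (sh (size Xs) r) _ hG hb SE (inl a) isT.
  by exists cs => //; rewrite h2 eqxx andbT.
have := @dec3_match _ (sh (size Xs) r) (sh3 (size xs) (sh 3 c)) SN _ hw.
rewrite -/d -[d SN _ _ _]/(dec3 d SN (tk 3 c)).
case: (dec3 d SN _) => // b _; rewrite nvN /=.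
set N := #|_|; have hN : N < #|car (St (size xs) (size Xs) r (sh 3 c))|.+1 by rewrite ltnS max_card.
apply/eqP/eqP => [h|[h]]; first by congr (Some (inr _)); apply: val_inj; rewrite /= inordK.
by rewrite -h inordK.
Qed.

Theorem pull_formula f : pulls f.
Proof.
apply: (formula_nterm_ind (P := pulls_t) (P0 := pulls)).
- exact: pull_var.
- exact: pull_count.
- exact: pull_eqE.
- by move=> s hs t ht; apply: pull_eqN.
- by move=> s hs t ht; apply: pull_leN.
- exact: pull_rel.
- exact: pull_rvar.
- exact: pull_not.
- by move=> s hs t ht; apply: pull_and.
- by move=> s hs t ht; apply: pull_or.
- by move=> x g; apply: pull_exE.
- by move=> x g; apply: pull_exN.
- by move=> X us g hg ws; apply: pull_ifp.
Qed.
End Interpretation.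

(** * From given queries to definable predicates *)

Section Queries.
Variable tau : seq nat.

Definition pick3 (G : structure) (r : rvs G) (c : ctx G) (s : sort) (x y z : value G) : value G :=
  if s is SE then x else y.

Lemma decs_pick3 (G : structure) (r : rvs G) (c0 : ctx G) n (c : ctx G) :
  decs (@pick3 G r c0) (nseq n SE) (tk (3 * n) c) = [seq c i | i <- [seq 3 * k | k <- iota 0 n]].
Proof.
elim: n c => [|n IH] c; first by [].
rewrite mulnS !addSn add0n /= IH muln0; congr cons.
by rewrite -(addn0 1) iotaDl -!map_comp; apply: eq_map => k /=; rewrite mulnDr muln1.
Qed.

(** The formulas of a given transduction use arbitrary variable names, which may clash with the
    conventions of [Def]. Pulling them back along the identity interpretation brings them into the
    standard form. *)
Lemma pull_identity f xs : Def tau [::] (cds (size xs)) (fun G r c =>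
  eval tau G f (envX (pick3 r c) xs [::] r c)).
Proof.
rewrite -[cds _]cats0.
have H := @pull_formula tau tau [::] [::] (fun G _ _ => G) pick3.
have := H _ _ _ _ _ _ _ f xs [::]; apply => {H}.
- by move=> G r c [] x y z; rewrite !wsort_cons => /and4P [].
- move=> G r c hG _ s v hv; have [x0 _] := card_gt0P hG.
  case: s hv => hv; [exists [:: v; nz; nz] | exists [:: inl x0; v; nz]] => //;
    by rewrite !wsort_cons hv.
- by move=> G r c hG _; rewrite expnS leq_pmulr // expn_gt0.
- case; [exact: (@def_eqval _ _ _ SE 0 3) | exact: (@def_eqval _ _ _ SN 1 4)].
- exact: def_le.
- move=> i hi n; apply: def_eq (@def_relV tau [::] (cds n ++ [::]) i [seq 3 * k | k <- iota 0 n] _).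
    by move=> G r c _ _; rewrite decs_pick3.
  rewrite hi size_map size_iota eqxx /=; apply/allP => _ /mapP [k hk ->].
  rewrite mem_iota in hk; have h3 : k < n by lia.
  have /andP [/eqP e1 /= e2] := isvs_cds [::] h3.
  rewrite /isv; case: e1 e2 => -> _ _ /=; by case/andP=> ->.
- apply: (@def_eq _ _ _ (fun G r c => cntE (fun v => exS cd (fun cs => r 0 cs && (nth nz cs 0 == v))) == nv (c 1))) => //.
  by dfn.
Qed.

Lemma def_query q ss rs is_ js : wf_query q is_ -> isvs ss is_ js ->
  Def tau rs ss (fun G r c => qeval tau G q [seq c j | j <- js]).
Proof.
move=> [hq1 [hq2 hq3]] hjs; set xs := rev q.1.
have hsz : size js = size q.1 by rewrite (isvs_size hjs) -hq1 size_map.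
pose code k := if nth SE is_ k is SE then [:: (nth 0 js k).+2; 0; 0] else [:: 1; (nth 0 js k).+2; 0].
pose ks := flatten [seq code k | k <- rev (iota 0 (size js))].
have hks : isvs [:: SN, SE & ss] (cds (size xs)) ks.
  rewrite size_rev -hsz /ks -{1}(size_iota 0 (size js)) -size_rev.
  have : all (fun k => k < size js) (rev (iota 0 (size js))).
    by rewrite all_rev; apply/allP => k; rewrite mem_iota.
  elim: (rev _) => //= k l IH /andP [hk hl].
  apply: (@isvs_cat _ cd _ (code k)); last exact: IH.
  case/andP: (hjs) => /eqP h1 /allP h2; rewrite /code -h1 (nth_map 0) //.
  have h3 := h2 _ (mem_nth 0 hk).
  by case E: (nth SE ss (nth 0 js k)); rewrite /isvs /= !eqseq_cons E /= ?eqxx /= !ltnS h3.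
have hq : Def tau rs [:: SN, SE & ss] (fun A r c => qeval tau A q [seq c j.+2 | j <- js]).
  have := def_weakens rs (def_call (fun A c => c) hks (pull_identity q.2 xs)); rewrite cats0.
  apply: def_eq => A r c hA hc; rewrite /qeval hq1.
  have hw : wsort is_ [seq c j.+2 | j <- js].
    by apply: (isvs_wsort (c := fun i => c i.+2) _ hjs) => i hi; apply: (hc i.+2).
  rewrite hw andTb; set d := pick3 _ _; set cc := catc _ _.
  have E : envE d xs cc = assign env0 q.1 [seq c j.+2 | j <- js].
    rewrite -[xs]cats0 envE_cat /xs revK; congr (assign _ _ _).
    have hn : size [seq c j | j <- ks] = 3 * size (rev q.1).
      by rewrite size_map (isvs_size hks) size_cds.
    rewrite -hn /cc tk_catc map_rev hq1 -[RHS]revK; congr rev.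
    have -> : [seq c j.+2 | j <- js] = [seq c (nth 0 js k).+2 | k <- iota 0 (size js)].
      by rewrite -{1}(mkseq_nth 0 js) /mkseq -map_comp.
    rewrite /ks -map_rev.
    have -> : rev is_ = [seq nth SE is_ k | k <- rev (iota 0 (size js))].
      by rewrite -[in LHS](mkseq_nth SE is_) (isvs_size hjs) map_rev.
    elim: (rev (iota _ _)) => //= k l IH.
    by rewrite map_cat /code; case: (nth SE is_ k) => /=; rewrite IH.
  rewrite /envX E /=; congr eval.
  by case: (assign env0 _ _) (@rv_assign A env0 q.1 [seq c j.+2 | j <- js]) => /= ? ? ? ->.
have := def_exV (P := fun A r c _ => exV SN (fun _ : value A => qeval tau A q [seq c j | j <- js]))
   (def_exV (P := fun A r c _ => qeval tau A q [seq c j.+1 | j <- js]) hq).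
apply: def_eq => A r c hA _; have [x0 _] := card_gt0P hA.
apply/exVP/idP => [[v _ /exVP [z _]] //|h].
by exists (inl x0) => //; apply/exVP; exists nz.
Qed.
End Queries.

Section Shifting.
Lemma isvs_shift pre ss us js : isvs ss us js -> isvs (pre ++ ss) us [seq size pre + j | j <- js].
Proof.
case/andP => /eqP <- /allP h; apply/andP; split.
  rewrite -map_comp; apply/eqP/eq_map => j /=; by rewrite nth_cat ltnNge leq_addr addKn.
by apply/allP => _ /mapP [j /h hj ->]; rewrite size_cat ltn_add2l.
Qed.
Lemma map_shift T (c : nat -> T) k js : [seq c j | j <- [seq k + j | j <- js]] = [seq sh k c j | j <- js].
Proof. by rewrite -map_comp; apply: eq_map => j /=; rewrite shE. Qed.
Lemma isvs_take ss us us' js : isvs ss (us ++ us') js ->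
  isvs ss us (take (size us) js) /\ isvs ss us' (drop (size us) js).
Proof.
case/andP => /eqP h1 h2; rewrite /isvs.
have h3 : all (fun j => j < size ss) (take (size us) js ++ drop (size us) js) by rewrite cat_take_drop.
move: h3; rewrite all_cat => /andP [-> ->]; rewrite map_take map_drop h1.
by rewrite take_size_cat ?drop_size_cat // !eqxx.
Qed.
Lemma isvs_head us ss : isvs (us ++ ss) us (iota 0 (size us)).
Proof. exact: (isvs_mid [::]). Qed.

Lemma def_exS_app tau rs ss us (P : forall A, rvs A -> ctx A -> seq (value A) -> bool) :
  Def tau rs (us ++ ss) (fun A r c => P A r (sh (size us) c) [seq c j | j <- iota 0 (size us)]) ->
  Def tau rs ss (fun A r c => exS us (P A r c)).
Proof.
by move=> h; apply: def_exS; apply: def_eq h => A r c _ _; rewrite map_iota_tk.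
Qed.
End Shifting.

(** * Output structure of a transduction *)

Section OutputFormulas.
Variables (tau tau2 : seq nat) (T : transduction).
Hypothesis wfT : wf_transduction tau2 T.
Local Notation Def := (Def tau).
Local Notation par := (t_par T).
Local Notation srt := (t_srt T).
Local Notation srts n := (flatten (nseq n srt)).

Section Relations.
Variable A : structure.
Implicit Types (p t a b : seq (value A)).
Definition inU p t := qeval tau A (t_U T) (p ++ t).
Definition stepT p a b := [&& inU p a, inU p b &
  qeval tau A (t_eq T) (p ++ a ++ b) || qeval tau A (t_eq T) (p ++ b ++ a)].
Definition gen p a b := connT srt (stepT p) a b.
Fixpoint genN p n f g : bool := if n is n'.+1 then
  gen p (take (size srt) f) (take (size srt) g) && genN p n' (drop (size srt) f) (drop (size srt) g) else true.
Definition relN i n p f := exS (srts n) (fun g => genN p n f g &&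
  qeval tau A (nth dflt_query (t_rel T) i) (p ++ g)).
Definition inD p := qeval tau A (t_dom T) p && exS srt (inU p).
End Relations.
Arguments gen : simpl never.

Lemma def_inU rs ss ps is_ : isvs ss par ps -> isvs ss srt is_ ->
  Def rs ss (fun A r c => inU [seq c j | j <- ps] [seq c j | j <- is_]).
Proof.
move=> h1 h2; have [_ hU _ _ _] := wfT.
apply: def_eq (def_query tau rs hU (isvs_cat h1 h2)) => A r c _ _.
by rewrite map_cat.
Qed.
Lemma def_gen rs ss ps is_ js : isvs ss par ps -> isvs ss srt is_ -> isvs ss srt js ->
  Def rs ss (fun A r c => gen [seq c j | j <- ps] [seq c j | j <- is_] [seq c j | j <- js]).
Proof.
move=> h1 h2 h3; have [_ _ hE _ _] := wfT.
apply: (def_connT (S := fun A r c => stepT [seq c j | j <- ps])) => //.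
set n := size srt.
have ha : isvs ((srt ++ srt) ++ ss) srt (iota 0 n) by rewrite -catA; apply: isvs_head.
have hb : isvs ((srt ++ srt) ++ ss) srt (iota n n) by rewrite -catA; apply: isvs_mid.
have hp : isvs ((srt ++ srt) ++ ss) par [seq size (srt ++ srt) + j | j <- ps] by apply: isvs_shift.
rewrite catA; apply: (@def_eq _ _ _ (fun A r c => stepT [seq c j | j <- [seq size (srt ++ srt) + j | j <- ps]]
   [seq c j | j <- iota 0 n] [seq c j | j <- iota n n])).
  by move=> A r c _ _; rewrite map_shift !map_iota_tk size_cat shD.
rewrite /stepT; apply: def_and; first exact: def_inU.
apply: def_and; first exact: def_inU.
apply: def_or.
  by apply: def_eq (def_query tau rs hE (isvs_cat hp (isvs_cat ha hb))) => A r c _ _; rewrite !map_cat.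
by apply: def_eq (def_query tau rs hE (isvs_cat hp (isvs_cat hb ha))) => A r c _ _; rewrite !map_cat.
Qed.
Lemma def_genN n rs ss ps is_ js : isvs ss par ps -> isvs ss (srts n) is_ -> isvs ss (srts n) js ->
  Def rs ss (fun A r c => genN [seq c j | j <- ps] n [seq c j | j <- is_] [seq c j | j <- js]).
Proof.
elim: n is_ js => [|n IH] is_ js hp h1 h2; first exact: def_true.
have [a1 a2] := isvs_take h1; have [b1 b2] := isvs_take h2.
apply: def_eq (def_and (def_gen rs hp a1 b1) (IH _ _ hp a2 b2)) => A r c _ _.
by rewrite /= !map_take !map_drop.
Qed.
Lemma def_relN i n rs ss ps is_ : i < size tau2 -> arity tau2 i = n ->
  isvs ss par ps -> isvs ss (srts n) is_ ->
  Def rs ss (fun A r c => relN i n [seq c j | j <- ps] [seq c j | j <- is_]).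
Proof.
move=> hi hn hp h; have [_ _ _ _ hR] := wfT; have := hR _ hi; rewrite hn => hq.
apply: (def_exS_app (P := fun A r c g => genN [seq c j | j <- ps] n [seq c j | j <- is_] g &&
   qeval tau A (nth dflt_query (t_rel T) i) ([seq c j | j <- ps] ++ g))).
have hp' := isvs_shift (srts n) hp; have h' := isvs_shift (srts n) h.
have h0 := isvs_head (srts n) ss.
apply: def_eq (def_and (def_genN rs hp' h' h0) (def_query tau rs hq (isvs_cat hp' h0))) => A r c _ _.
by rewrite !map_cat !map_shift.
Qed.
Lemma def_inD rs ss ps : isvs ss par ps -> Def rs ss (fun A r c => inD [seq c j | j <- ps]).
Proof.
move=> hp; have [hD _ _ _ _] := wfT; apply: def_and; first exact: def_query hD hp.
apply: (def_exS_app (P := fun A r c t => inU [seq c j | j <- ps] t)).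
apply: def_eq (def_inU rs (isvs_shift srt hp) (isvs_head srt ss)) => A r c _ _.
by rewrite map_shift.
Qed.

Definition pos A i j p d t : bool :=
  rankT srt (fun t => inU p t && relN i 1 p t) (fun a b => relN j 2 p (a ++ b)) d (t : seq (value A)).
Lemma def_pos i j rs ss ps k is_ : i < size tau2 -> arity tau2 i = 1 -> j < size tau2 -> arity tau2 j = 2 ->
  isvs ss par ps -> isv ss SN k -> isvs ss srt is_ ->
  Def rs ss (fun A r c => pos i j [seq c j | j <- ps] (nv (c k)) [seq c j | j <- is_]).
Proof.
move=> hi ai hj aj hp hk his.
apply: (def_rankT (D := fun A r c t => inU [seq c j | j <- ps] t && relN i 1 [seq c j | j <- ps] t)
  (Le := fun A r c a b => relN j 2 [seq c j | j <- ps] (a ++ b))) => //.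
  have hp' := isvs_shift srt hp; have h0 := isvs_head srt ss.
  have h0' : isvs (srt ++ ss) (srts 1) (iota 0 (size srt)) by rewrite /= cats0.
  apply: def_eq (def_and (def_inU rs hp' h0) (def_relN rs hi ai hp' h0')) => A r c _ _.
  by rewrite !map_shift map_iota_tk.
set n := size srt.
have ha : isvs ((srt ++ srt) ++ ss) srt (iota 0 n) by rewrite -catA; apply: isvs_head.
have hb : isvs ((srt ++ srt) ++ ss) srt (iota n n) by rewrite -catA; apply: isvs_mid.
have hab : isvs ((srt ++ srt) ++ ss) (srts 2) (iota 0 n ++ iota n n) by rewrite /= cats0; apply: isvs_cat.
rewrite catA; apply: def_eq (def_relN rs hj aj (isvs_shift (srt ++ srt) hp) hab) => A r c _ _.
by rewrite map_shift map_cat !map_iota_tk size_cat shD.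
Qed.
End OutputFormulas.

Section OutputStructure.
Variables (tau : seq nat) (T : transduction) (A : structure) (p : seq (value A)).
Hypothesis hp : wsort (t_par T) p.
Local Notation srt := (t_srt T).
Local Notation srts n := (flatten (nseq n srt)).
Local Notation dom := (dom_t T A).
Local Notation U := (Uset tau T A p).
Local Notation B := (out_struct tau T A p).
Local Notation eqg := (eqgen tau T A p).
Local Notation gen := (gen tau T p).
Local Notation inU := (inU tau T p).
Hypothesis wfU : wf_query (t_U T) (t_par T ++ srt).

Lemma inUE (a : dom) : (a \in U) = inU a.
Proof. by rewrite inE. Qed.
Lemma inU_wsort t : inU t -> wsort srt t.
Proof.
case: wfU => h _; rewrite /inU /qeval h => /andP [].
by rewrite wsort_cat ?(wsort_size hp) // hp.
Qed.
Lemma tuple_of t : wsort srt t -> exists a : dom, tval a = t.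
Proof. by move=> /wsort_size h; exists (tcast h (in_tuple t)); rewrite val_tcast. Qed.

Lemma eqgenU a b : eqg a b -> (a \in U) = (b \in U).
Proof.
move=> /connectP [q hq ->]; elim: q a hq => //= x q IH a /andP [/and3P [h1 h2 _] /IH <-].
by rewrite h1 h2.
Qed.

(** [connT] follows paths of well-sorted tuples and [connect] paths of tuples of the right length.
    They agree because every step stays in the set defined by [t_U], whose members are
    well-sorted. *)
Lemma genE (a b : dom) : wsort srt a -> wsort srt b -> gen a b = eqg a b.
Proof.
move=> ha hb; apply/(connTP _ ha hb)/connectP.
  case=> q [hq hpath hlast].
  elim: q a ha hq hpath hlast => [|x q IH] a ha /=.
    by move=> _ _ h; exists [::] => //; apply/val_inj; rewrite /= h.
  move=> /andP [hx hq] /andP [hs hpath] hl.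
  have [x' hx'] := tuple_of hx; rewrite -hx' in hs hpath hl hx.
  have [q' h1 h2] := IH x' hx hq hpath hl.
  by exists (x' :: q') => //=; rewrite h1 andbT /eqstep !inUE.
case=> q hq ->; exists (map (@tval _ _) q); split; last by rewrite last_map.
  elim: q a {ha} hq => //= x q IH a /andP [/and3P [_ hx _] /IH ->]; rewrite andbT.
  by apply: inU_wsort; rewrite -inUE.
elim: q a {ha} hq => //= x q IH a /andP [h /IH ->]; rewrite andbT.
by move: h; rewrite /eqstep /stepT !inUE.
Qed.

Hypothesis U0 : U != set0.

Lemma class_in (a : dom) : a \in U -> [set b | eqg a b] \in classes tau T A p.
Proof. by move=> h; apply: imset_f. Qed.
Lemma car_class (x : car B) : exists2 a, a \in U & val x = [set b | eqg a b].
Proof. by case/imsetP: (valP x) => a ha E; exists a. Qed.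

Lemma some_class : exists x : car B, true.
Proof. by case/set0Pn: U0 => a ha; exists (exist (fun c => c \in classes tau T A p) _ (class_in ha)). Qed.

Variable x0 : car B.
Definition cl (t : seq (value A)) : car B :=
  if insub t is Some a then insubd x0 [set b | eqg a b] else x0.
Lemma clE (a : dom) : a \in U -> val (cl a) = [set b | eqg a b].
Proof.
move=> h; rewrite /cl; have -> : insub (tval a) = Some a by exact: valK.
by rewrite insubdK // class_in.
Qed.
Lemma cl_surj (x : car B) : exists t, [/\ wsort srt t, inU t & cl t = x].
Proof.
have [a ha E] := car_class x; exists a; split.
- by apply: inU_wsort; rewrite -inUE.
- by rewrite -inUE.
- by apply: val_inj; rewrite E clE.
Qed.
Lemma mem_cl (a b : dom) : a \in U -> (b \in val (cl a)) = eqg a b.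
Proof. by move=> h; rewrite clE // inE. Qed.

Lemma genN_all2 (ts ss' : seq dom) : size ts = size ss' -> all (fun t => t \in U) ts ->
  all (fun t : dom => wsort srt t) ss' ->
  genN tau T p (size ts) (flatten (map val ts)) (flatten (map val ss')) =
  all2 (fun (c : car B) (t : dom) => t \in val c) [seq cl (tval t) | t <- ts] ss'.
Proof.
elim: ts ss' => [|t ts IH] [|s ss'] //= [h] /andP [h1 h2] /andP [h3 h4].
rewrite !take_size_cat ?drop_size_cat ?size_tuple // IH // mem_cl // genE //.
by apply: inU_wsort; rewrite -inUE.
Qed.

Lemma wsort_srts n g : wsort (srts n) g ->
  exists ss' : seq dom, [/\ size ss' = n, g = flatten (map val ss') & all (fun t : dom => wsort srt t) ss'].
Proof.
elim: n g => [|n IH] g; first by case: g => // _; exists [::].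
rewrite /= -[g](cat_take_drop (size srt)) => h.
have hsz : size (take (size srt) g) = size srt.
  by rewrite size_takel //; have := wsort_size h; rewrite cat_take_drop size_cat; lia.
move: h; rewrite wsort_cat // => /andP [h1 /IH [ss' [h2 h3 h4]]].
have [a ha] := tuple_of h1.
by exists (a :: ss'); split; rewrite /= ?h2 ?ha ?h1 ?h4 // h3.
Qed.

Lemma out_relE i (ts : seq dom) : all (fun t => t \in U) ts ->
  srel B i [seq cl (tval t) | t <- ts] = relN tau T i (size ts) p (flatten (map val ts)).
Proof.
move=> hts; rewrite /= /out_rel; apply/existsP/exSP => [[ss' /andP [h1 h2]]|[g hg /andP [h1 h2]]].
  have hss : all (fun t : dom => wsort srt t) ss'.
    move: (val ss') h1 {h2} => s'; elim: (ts) s' hts => [|t ts' IH] [|s s'] //= /andP [h1 h2] /andP [h3 h4].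
    rewrite (IH s') // andbT; apply: inU_wsort; rewrite -inUE.
    by move: h3; rewrite mem_cl // => /eqgenU <-.
  have hsz : size ss' = size ts by rewrite size_tuple size_map.
  exists (flatten (map val ss')).
    move: hss hsz; clear; move: (val ss').
    elim: (ts) => [|t ts' IH] [|s s'] //= /andP [h3 h4] [h5].
    by rewrite wsort_cat ?size_tuple // h3 IH.
  by rewrite h2 genN_all2 ?h1.
have [ss' [h3 h4 h5]] := wsort_srts hg.
have h6 : size ss' = size [seq cl (tval t) | t <- ts] by rewrite size_map.
exists (tcast h6 (in_tuple ss')); rewrite val_tcast /=; rewrite h4 in h1 h2.
by rewrite h2 andbT -genN_all2.
Qed.
End OutputStructure.

Lemma rank_bij (X Y : finType) (g : X -> Y) D le D' le' x : bijective g ->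
  (forall x, D x = D' (g x)) -> (forall x y, le x y = le' (g x) (g y)) ->
  rank D le x = rank D' le' (g x).
Proof.
move=> hg hD hle; rewrite /rank -!sum1_card [RHS](reindex g); last exact: onW_bij.
by apply: eq_bigl => y; rewrite !inE hD hle.
Qed.

(** * Canonical numbering of an LO-colored graph *)

Section CanonicalNumbers.
Variable T : transduction.
Local Notation tau2 := (lo_voc ++ [:: 2]).
Hypothesis wfT : wf_transduction tau2 T.
Local Notation par := (t_par T).
Local Notation srt := (t_srt T).
Local Notation srts n := (flatten (nseq n srt)).
Local Notation num4 := [:: SN; SN; SN; SN].

Section OnStructure.
Variable A : structure.
Implicit Types (p s : seq (value A)).
(** The index 5 is [size lo_voc], the order produced by the transduction. Colours are ranked along
    the order of [M] instead: it is preserved by the isomorphism with the input, so that a colour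
    keeps the rank it has there. *)
Local Notation posV := (pos lo_voc T 0 5).
Local Notation posM := (pos lo_voc T 2 3).
Local Notation relN := (relN lo_voc T).

(* The 4-ary relation codes two relations: for f = 0 the edges (b, x) between
   the b-th and the x-th vertex, otherwise the colour (b, x, y) of the b-th
   vertex, numbering vertices along the output order and colours along the
   order of M. *)
Definition Wp p s : bool :=
  if nv (nth nz s 0) == 0 then
    exS srt (fun t => exS srt (fun u => [&& posV p (nv (nth nz s 1)) t, posV p (nv (nth nz s 2)) u &
       relN 1 2 p (t ++ u)]))
  else exS srt (fun t => exS srt (fun u => exS srt (fun w =>
    [&& posV p (nv (nth nz s 1)) t, posM p (nv (nth nz s 2)) u, posM p (nv (nth nz s 3)) w &
       relN 4 3 p (t ++ u ++ w)]))).
(* Parameters are eliminated by keeping those whose canon is least for the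
   first-difference order; all of these yield the same canon. *)
Definition best p := inD lo_voc T p && ~~ exS par (fun p' => inD lo_voc T p' && precedes num4 (Wp p') (Wp p)).
Definition W s := exS par (fun p => best p && Wp p s).
End OnStructure.

Lemma isvs_nth ss us js k : isvs ss us js -> k < size us -> isv ss (nth SE us k) (nth 0 js k).
Proof.
move=> h hk; have hs := isvs_size h; case/andP: h => /eqP <- /allP h.
by rewrite /isv (nth_map 0) ?hs // eqxx andbT h // mem_nth // hs.
Qed.

Lemma def_Wp rs ss ps js : isvs ss par ps -> isvs ss num4 js ->
  Def lo_voc rs ss (fun A r c => Wp [seq c j | j <- ps] [seq c j | j <- js]).
Proof.
move=> hp hj.
have hn k : k < 4 -> isv ss SN (nth 0 js k) by move=> hk; have := isvs_nth hj hk; case: k hk => [|[|[|[|]]]].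
have hnth A (c : ctx A) k : k < 4 -> nth nz [seq c j | j <- js] k = c (nth 0 js k).
  by move=> hk; rewrite (nth_map 0) // (isvs_size hj).
have s4 := isvs_size hj.
have hV pre k is_ : k < 4 -> isvs (pre ++ ss) srt is_ -> Def lo_voc rs (pre ++ ss) (fun A r c =>
    pos lo_voc T 0 5 [seq c j | j <- [seq size pre + j | j <- ps]] (nv (c (size pre + nth 0 js k))) [seq c j | j <- is_]).
  move=> hk his; apply: (def_pos lo_voc wfT) => //; first exact: isvs_shift.
  have := isvs_shift pre (isvs1 (hn k hk)); case/andP => /= /eqP [h1]; rewrite andbT => h2.
  by rewrite /isv h1 h2 eqxx.
have hM pre k is_ : k < 4 -> isvs (pre ++ ss) srt is_ -> Def lo_voc rs (pre ++ ss) (fun A r c =>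
    pos lo_voc T 2 3 [seq c j | j <- [seq size pre + j | j <- ps]] (nv (c (size pre + nth 0 js k))) [seq c j | j <- is_]).
  move=> hk his; apply: (def_pos lo_voc wfT) => //; first exact: isvs_shift.
  have := isvs_shift pre (isvs1 (hn k hk)); case/andP => /= /eqP [h1]; rewrite andbT => h2.
  by rewrite /isv h1 h2 eqxx.
set n := size srt.
have tks (G : structure) (c : ctx G) : tk n c = [seq c j | j <- iota 0 n] by rewrite tkE.
rewrite /Wp; apply: def_if.
  by apply: def_eq (def_eq0 lo_voc rs (hn 0 isT)) => A r c _ _; rewrite hnth.
  apply: (def_exS (P := fun A r c t => exS srt (fun u =>
     [&& pos lo_voc T 0 5 [seq c j | j <- ps] (nv (nth nz [seq c j | j <- js] 1)) t,
         pos lo_voc T 0 5 [seq c j | j <- ps] (nv (nth nz [seq c j | j <- js] 2)) u &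
         relN lo_voc T 1 2 [seq c j | j <- ps] (t ++ u)]))).
  apply: (def_exS (P := fun A r c u =>
     [&& pos lo_voc T 0 5 [seq sh n c j | j <- ps] (nv (nth nz [seq sh n c j | j <- js] 1)) (tk n c),
         pos lo_voc T 0 5 [seq sh n c j | j <- ps] (nv (nth nz [seq sh n c j | j <- js] 2)) u &
         relN lo_voc T 1 2 [seq sh n c j | j <- ps] (tk n c ++ u)])).
  rewrite catA -/n.
  have hu : isvs ((srt ++ srt) ++ ss) srt (iota 0 n) by rewrite -catA; apply: isvs_head.
  have ht : isvs ((srt ++ srt) ++ ss) srt (iota n n) by rewrite -catA; apply: isvs_mid.
  apply: def_and; last apply: def_and.
  - apply: def_eq (hV (srt ++ srt) 1 _ isT ht) => A r c _ _.
    by rewrite hnth // map_shift map_iota_tk size_cat !shD !shE addnA.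
  - apply: def_eq (hV (srt ++ srt) 2 _ isT hu) => A r c _ _.
    by rewrite hnth // map_shift map_iota_tk size_cat !shD !shE addnA.
  - have htu : isvs ((srt ++ srt) ++ ss) (srts 2) (iota n n ++ iota 0 n) by rewrite /= cats0; apply: isvs_cat.
    have := def_relN lo_voc wfT rs (i := 1) (n := 2) isT erefl (isvs_shift (srt ++ srt) hp) htu.
    by apply: def_eq => A r c _ _; rewrite map_shift map_cat !map_iota_tk size_cat shD.
apply: (def_exS (P := fun A r c t => exS srt (fun u => exS srt (fun w =>
   [&& pos lo_voc T 0 5 [seq c j | j <- ps] (nv (nth nz [seq c j | j <- js] 1)) t,
       pos lo_voc T 2 3 [seq c j | j <- ps] (nv (nth nz [seq c j | j <- js] 2)) u,
       pos lo_voc T 2 3 [seq c j | j <- ps] (nv (nth nz [seq c j | j <- js] 3)) w &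
       relN lo_voc T 4 3 [seq c j | j <- ps] (t ++ u ++ w)])))).
apply: (def_exS (P := fun A r c u => exS srt (fun w =>
   [&& pos lo_voc T 0 5 [seq sh n c j | j <- ps] (nv (nth nz [seq sh n c j | j <- js] 1)) (tk n c),
       pos lo_voc T 2 3 [seq sh n c j | j <- ps] (nv (nth nz [seq sh n c j | j <- js] 2)) u,
       pos lo_voc T 2 3 [seq sh n c j | j <- ps] (nv (nth nz [seq sh n c j | j <- js] 3)) w &
       relN lo_voc T 4 3 [seq sh n c j | j <- ps] (tk n c ++ u ++ w)]))).
apply: (def_exS (P := fun A r c w =>
   [&& pos lo_voc T 0 5 [seq sh n (sh n c) j | j <- ps] (nv (nth nz [seq sh n (sh n c) j | j <- js] 1)) (tk n (sh n c)),
       pos lo_voc T 2 3 [seq sh n (sh n c) j | j <- ps] (nv (nth nz [seq sh n (sh n c) j | j <- js] 2)) (tk n c),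
       pos lo_voc T 2 3 [seq sh n (sh n c) j | j <- ps] (nv (nth nz [seq sh n (sh n c) j | j <- js] 3)) w &
       relN lo_voc T 4 3 [seq sh n (sh n c) j | j <- ps] (tk n (sh n c) ++ tk n c ++ w)])).
have E : srt ++ srt ++ srt ++ ss = (srt ++ srt ++ srt) ++ ss by rewrite -!catA.
rewrite -/n E.
have hw : isvs ((srt ++ srt ++ srt) ++ ss) srt (iota 0 n) by rewrite -!catA; apply: isvs_head.
have hu : isvs ((srt ++ srt ++ srt) ++ ss) srt (iota n n) by rewrite -!catA; apply: isvs_mid.
have ht : isvs ((srt ++ srt ++ srt) ++ ss) srt (iota (n + n) n).
  by rewrite -!catA {2}/n -size_cat (catA srt); apply: isvs_mid.
apply: def_and; last apply: def_and; last apply: def_and.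
- apply: def_eq (hV (srt ++ srt ++ srt) 1 _ isT ht) => A r c _ _.
  by rewrite hnth // map_shift map_iota_tk !size_cat !shD !shE !addnA.
- apply: def_eq (hM (srt ++ srt ++ srt) 2 _ isT hu) => A r c _ _.
  by rewrite hnth // map_shift map_iota_tk !size_cat !shD !shE !addnA.
- apply: def_eq (hM (srt ++ srt ++ srt) 3 _ isT hw) => A r c _ _.
  by rewrite hnth // map_shift map_iota_tk !size_cat !shD !shE !addnA.
- have h3 : isvs ((srt ++ srt ++ srt) ++ ss) (srts 3) (iota (n + n) n ++ iota n n ++ iota 0 n).
    by rewrite /= cats0; apply: isvs_cat => //; apply: isvs_cat.
  have := def_relN lo_voc wfT rs (i := 4) (n := 3) isT erefl (isvs_shift (srt ++ srt ++ srt) hp) h3.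
  by apply: def_eq => A r c _ _; rewrite map_shift !map_cat !map_iota_tk !size_cat !shD.
Qed.

Lemma def_precedes rs ss ps qs : isvs ss par ps -> isvs ss par qs ->
  Def lo_voc rs ss (fun A r c => precedes num4 (Wp [seq c j | j <- ps]) (Wp [seq c j | j <- qs])).
Proof.
move=> hp hq; apply: (def_exS_app (P := fun A r c s => [&& Wp [seq c j | j <- ps] s, ~~ Wp [seq c j | j <- qs] s &
   allS num4 (fun t => ltx t s ==> (Wp [seq c j | j <- ps] t == Wp [seq c j | j <- qs] t))])).
have hp4 := isvs_shift num4 hp; have hq4 := isvs_shift num4 hq; have h0 := isvs_head num4 ss.
apply: def_and.
  by apply: def_eq (def_Wp rs hp4 h0) => A r c _ _; rewrite map_shift.
apply: def_and.
  by apply: def_not; apply: def_eq (def_Wp rs hq4 h0) => A r c _ _; rewrite map_shift.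
apply: (def_allS (P := fun A r c t => ltx t [seq c j | j <- iota 0 4] ==>
   (Wp [seq sh 4 c j | j <- ps] t == Wp [seq sh 4 c j | j <- qs] t))).
have hp8 := isvs_shift (num4 ++ num4) hp; have hq8 := isvs_shift (num4 ++ num4) hq.
have h08 : isvs ((num4 ++ num4) ++ ss) num4 (iota 0 4) by rewrite -catA; apply: isvs_head.
apply: def_imp; first by rewrite /=; dfn.
apply: def_eqb.
  by apply: def_eq (def_Wp rs hp8 h08) => A r c _ _; rewrite map_shift.
by apply: def_eq (def_Wp rs hq8 h08) => A r c _ _; rewrite map_shift.
Qed.

Lemma def_W : Def lo_voc [::] num4 (fun A r c => W [:: c 0; c 1; c 2; c 3]).
Proof.
apply: (def_exS_app (P := fun A r c p => best p && Wp p [:: c 0; c 1; c 2; c 3])).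
have h0 := isvs_head par num4.
have h4 : isvs (par ++ num4) num4 [seq size par + j | j <- iota 0 4] by apply: isvs_shift.
apply: def_and; last first.
  by apply: def_eq (def_Wp [::] h0 h4) => A r c _ _; rewrite map_shift.
apply: def_and; first exact: (def_inD lo_voc wfT).
apply: def_not; apply: (def_exS_app (P := fun A r c p' => inD lo_voc T p' &&
   precedes num4 (Wp p') (Wp [seq c j | j <- iota 0 (size par)]))).
have hh := isvs_head par (par ++ num4).
apply: def_and; first exact: (def_inD lo_voc wfT).
by apply: def_eq (def_precedes [::] hh (isvs_shift par h0)) => A r c _ _; rewrite map_shift.
Qed.
End CanonicalNumbers.

(** * Correctness of the numbering *)

Section Correctness.
Variables (T : transduction) (A : structure).
Local Notation tau2 := (lo_voc ++ [:: 2]).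
Hypothesis wfT : wf_transduction tau2 T.
Hypothesis loA : is_LO_colored A.
Hypothesis canA : canonizes lo_voc T A.
Local Notation par := (t_par T).
Local Notation srt := (t_srt T).
Local Notation V := (loV A).
Local Notation M := (loM A).
Local Notation k := #|V|.

Definition rkM (m : car A) := rank M (loLe A) m.

(** The enumeration [fV] itself is not definable; only the relation [R] that it induces on numbers
    is. *)
Definition numbering (fV : nat -> car A) (R : seq (value A) -> bool) :=
  [/\ (forall b, b < k -> V (fV b)),
      (forall b b', b < k -> b' < k -> fV b = fV b' -> b = b'),
      (forall v, V v -> exists2 b, b < k & fV b = v) &
      (forall f b x y : 'I_#|car A|.+1, R [:: inr f; inr b; inr x; inr y] =
         if f == 0 :> nat then [&& b < k, x < k & loE A (fV b) (fV x)]
         else (b < k) && [exists u, exists w, [&& M u, rkM u == x, M w, rkM w == y & loL A (fV b) u w]])].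

Lemma loA_le : [/\ (forall x y, M x -> M y -> loLe A x y || loLe A y x),
  (forall x y, M x -> M y -> loLe A x y -> loLe A y x -> x = y) &
  (forall x y z, M x -> M y -> M z -> loLe A x y -> loLe A y z -> loLe A x z)].
Proof.
case: loA => [_ [_ [_ [_ [_ [_ [[h1 h2 h3 h4 h5] _]]]]]]]; split.
- by move=> x y hx hy; apply/orP; apply: h5.
- by move=> x y _ _; apply: h3.
- by move=> x y z _ _ _; apply: h4.
Qed.

Section OneParameter.
Variable p : seq (value A).
Hypothesis domp : in_domain lo_voc T A p.
Local Notation B := (out_struct lo_voc T A p).

Lemma Wp_numbering : exists fV, numbering fV (Wp T p).
Proof.
have hp : wsort par p by case/and3P: domp.
have U0 : Uset lo_voc T A p != set0 by case/and3P: domp.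
have wfU : wf_query (t_U T) (par ++ srt) by case: wfT.
have [x0 _] := some_class U0.
have [_ /(_ p domp) [[g [hg hiso]] [le_refl [le_anti [le_trans le_total]]]]] := canA.
set le5 := (fun x y : car B => srel B 5 [:: x; y]).
set le3 := (fun x y : car B => srel B 3 [:: x; y]).
set VB := (fun x : car B => srel B 0 [:: x]); set MB := (fun x : car B => srel B 2 [:: x]).
pose c := cl x0.
have hVB x : VB x = V (g x) by apply: (hiso 0).
have hMB x : MB x = M (g x) by apply: (hiso 2).
have hEB x y : srel B 1 [:: x; y] = loE A (g x) (g y) by apply: (hiso 1).
have hle3 x y : le3 x y = loLe A (g x) (g y) by apply: (hiso 3).
have hLB x y z : srel B 4 [:: x; y; z] = loL A (g x) (g y) (g z) by apply: (hiso 4).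
have ginj : injective g by apply: bij_inj.
have hinU (a : dom_t T A) : inU lo_voc T p a -> a \in Uset lo_voc T A p by rewrite inUE.
have tup t : inU lo_voc T p t -> exists2 a : dom_t T A, tval a = t & a \in Uset lo_voc T A p.
  by move=> h; have [a ha] := tuple_of (inU_wsort hp wfU h); exists a => //; rewrite inUE ha.
have r1 i t : inU lo_voc T p t -> relN lo_voc T i 1 p t = srel B i [:: c t].
  move=> /tup [a <- ha]; have := out_relE hp wfU U0 x0 i (ts := [:: a]).
  by rewrite /= ha cats0 => ->.
have r2 i t u : inU lo_voc T p t -> inU lo_voc T p u -> relN lo_voc T i 2 p (t ++ u) = srel B i [:: c t; c u].
  move=> /tup [a <- ha] /tup [b <- hb]; have := out_relE hp wfU U0 x0 i (ts := [:: a; b]).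
  by rewrite /= ha hb cats0 => ->.
have r3 i t u w : inU lo_voc T p t -> inU lo_voc T p u -> inU lo_voc T p w ->
    relN lo_voc T i 3 p (t ++ u ++ w) = srel B i [:: c t; c u; c w].
  move=> /tup [a <- ha] /tup [b <- hb] /tup [d <- hd]; have := out_relE hp wfU U0 x0 i (ts := [:: a; b; d]).
  by rewrite /= ha hb hd cats0 => ->.
have [ltot lanti ltrans] := loA_le.
have surj x : exists t, [/\ wsort srt t, inU lo_voc T p t & c t = x] := cl_surj hp wfU x0 x.
have posV d t : wsort srt t -> pos lo_voc T 0 5 p d t =
   [&& inU lo_voc T p t, VB (c t) & rank VB le5 (c t) == d].
  move=> ht; rewrite /pos (@rankTE A srt _ _ (car B) VB le5 c) //.
  - by case h: (inU _ _ _ _) => //=; rewrite r1.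
  - by move=> x y _ _; apply/orP; apply: le_total.
  - by move=> x y _ _; apply: le_anti.
  - by move=> x y z _ _ _; apply: le_trans.
  - by move=> u hu /andP [h1]; rewrite r1.
  - by move=> x hx; have [u [h1 h2 h3]] := surj x; exists u; rewrite h2 r1 // h3.
  - by move=> u w _ _ /andP [h1 _] /andP [h2 _]; rewrite r2.
have posM d t : wsort srt t -> pos lo_voc T 2 3 p d t =
   [&& inU lo_voc T p t, MB (c t) & rkM (g (c t)) == d].
  move=> ht; rewrite /pos (@rankTE A srt _ _ (car B) MB le3 c) //.
  - case h: (inU _ _ _ _) => //=; rewrite r1 //; congr andb.
    by rewrite /rkM (rank_bij (g := g) (D' := M) (le' := loLe A)).
  - by move=> x y; rewrite !hMB !hle3; apply: ltot.
  - by move=> x y; rewrite !hMB !hle3 => h1 h2 h3 h4; apply: ginj; apply: lanti.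
  - by move=> x y z; rewrite !hMB !hle3; apply: ltrans.
  - by move=> u hu /andP [h1]; rewrite r1.
  - by move=> x hx; have [u [h1 h2 h3]] := surj x; exists u; rewrite h2 r1 // h3.
  - by move=> u w _ _ /andP [h1 _] /andP [h2 _]; rewrite r2.
have hk : #|VB| = k.
  rewrite -!sum1_card [RHS](reindex g); last exact: onW_bij.
  by apply: eq_bigl => x; rewrite !unfold_in; apply: hVB.
have vtot x y : VB x -> VB y -> le5 x y || le5 y x by move=> _ _; apply/orP; apply: le_total.
have vanti x y : VB x -> VB y -> le5 x y -> le5 y x -> x = y by move=> _ _; apply: le_anti.
have vtrans x y z : VB x -> VB y -> VB z -> le5 x y -> le5 y z -> le5 x z by move=> _ _ _; apply: le_trans.
pose xV b := odflt x0 [pick x | VB x && (rank VB le5 x == b)].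
have xVP b : b < k -> VB (xV b) /\ rank VB le5 (xV b) = b.
  rewrite -hk => /(rank_onto vtot vanti vtrans) [x h1 h2]; rewrite /xV; case: pickP => /= [y /andP [h3 /eqP h4] //|].
  by move=> /(_ x); rewrite h1 h2 eqxx.
have xVE x : VB x -> xV (rank VB le5 x) = x.
  move=> hx; have [h1 h2] := xVP _ (leq_trans (rank_lt vtot hx) (eq_leq hk)).
  exact: (rank_inj vtot vanti vtrans h1 hx h2).
exists (fun b => g (xV b)); split.
- by move=> b hb; rewrite -hVB; case: (xVP b hb).
- by move=> b b' /xVP [_ h1] /xVP [_ h2] /ginj h; rewrite -h1 h h2.
- move=> v hv; have [g' g1 g2] := hg; exists (rank VB le5 (g' v)).
    by rewrite -hk; apply: rank_lt => //; rewrite hVB g2.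
  by rewrite xVE ?g2 // hVB g2.
move=> f b x y; rewrite /Wp [nth _ _ 0]/= [nth _ _ 1]/= [nth _ _ 2]/= [nth _ _ 3]/= !nvN.
have toB d t : wsort srt t -> pos lo_voc T 0 5 p d t -> [/\ d < k, inU lo_voc T p t & c t = xV d].
  by move=> /posV -> /and3P [h1 h2 /eqP <-]; split; rewrite ?xVE // -hk; apply: rank_lt.
have fromB d : d < k -> exists t, [/\ wsort srt t, inU lo_voc T p t, pos lo_voc T 0 5 p d t & c t = xV d].
  move=> /xVP [h1 h2]; have [t [h3 h4 h5]] := surj (xV d); exists t; split=> //.
  by rewrite posV // h4 h5 h1 h2 eqxx.
case: eqP => _.
  apply/exSP/and3P => [[t ht /exSP [u hu /and3P [/(toB _ _ ht) [h1 h2 h3] /(toB _ _ hu) [h4 h5 h6]]]]|[h1 h2 h3]].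
    by rewrite r2 // h3 h6 hEB.
  have [t [t1 t2 t3 t4]] := fromB _ h1; have [u [u1 u2 u3 u4]] := fromB _ h2.
  by exists t => //; apply/exSP; exists u => //; rewrite t3 u3 r2 // t4 u4 hEB.
apply/exSP/andP => [[t ht /exSP [u hu /exSP [w hw /and4P [/(toB _ _ ht) [h1 h2 h3]]]]]|[h1 /existsP [u /existsP [w /and5P [u1 /eqP u2 w1 /eqP w2 hL]]]]].
  rewrite !posM // => /and3P [a1 a2 a3] /and3P [b1 b2 b3]; rewrite r3 // hLB h3 => h4; split=> //.
  by apply/existsP; exists (g (c u)); apply/existsP; exists (g (c w)); rewrite -!hMB a2 b2 a3 b3.
have [g' g1 g2] := hg.
have [t [t1 t2 t3 t4]] := fromB _ h1.
have [t' [t1' t2' t3']] := surj (g' u); have [t'' [t1'' t2'' t3'']] := surj (g' w).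
exists t => //; apply/exSP; exists t' => //; apply/exSP; exists t'' => //.
by rewrite t3 !posM // t2' t2'' !hMB r3 // hLB t4 t3' t3'' !g2 u1 u2 w1 w2 !eqxx.
Qed.
End OneParameter.

Theorem W_numbering : exists fV, numbering fV (W T (A := A)).
Proof.
have [_ wfU _ _ _] := wfT.
have indom (p : seq (value A)) : wsort par p -> inD lo_voc T p = in_domain lo_voc T A p.
  move=> hp; rewrite /inD /in_domain hp /=; congr andb.
  apply/exSP/set0Pn => [[t ht h]|[a]]; last by rewrite inE => h; exists (tval a); [exact: (inU_wsort hp wfU h) | exact: h].
  by have [a ha] := tuple_of ht; exists a; rewrite inE ha.
have [[p0 hp0] _] := canA.
have hw0 : wsort par p0 by case/and3P: hp0.
pose P (q : (size par).-tuple (value A)) := wsort par q && in_domain lo_voc T A q.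
pose lt (q q' : (size par).-tuple (value A)) := precedes [:: SN; SN; SN; SN] (Wp T q) (Wp T q').
have [|||q hq hmin] := @finite_minimal _ P lt (tcast (wsort_size hw0) (in_tuple p0)).
- by move=> q; apply: (precedes_irr 4).
- by move=> x y z; apply: (precedes_trans (k := 4)).
- by rewrite /P val_tcast /= hw0 hp0.
have [hqw hqd] := andP hq.
have hbest : best T q.
  rewrite /best indom // hqd; apply/exSP => [[p' hp' /andP []]]; rewrite indom // => h1 h2.
  have := hmin (tcast (wsort_size hp') (in_tuple p')); rewrite /P /lt val_tcast /= hp' h1 => /(_ isT).
  by rewrite h2.
have hW s : wsort [:: SN; SN; SN; SN] s -> W T s = Wp T q s.
  move=> hs; apply/exSP/idP => [[p' hp' /andP [/andP []]]|h]; last by exists (val q) => //; rewrite hbest.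
  rewrite indom // => h1 /exSP h2 h3.
  case: (precedes_total 4 (Wp T q) (Wp T p')) => [h|h|->] //.
    by case: h2; exists (val q) => //; rewrite indom // hqd.
  have := hmin (tcast (wsort_size hp') (in_tuple p')); rewrite /P /lt val_tcast /= hp' h1 => /(_ isT).
  by rewrite h.
have [fV [h1 h2 h3 h4]] := Wp_numbering hqd.
by exists fV; split=> // f b x y; rewrite hW.
Qed.
End Correctness.

(** * Modular decomposition *)

Section Blocks.
Variables (V : finType) (adj : rel V).
Hypothesis adj_sym : symmetric adj.
Variable S : {set V}.

Definition within (e : rel V) : rel V := fun a b => [&& a \in S, b \in S & e a b].
(** For [c = true] this is connectivity in the induced subgraph, for [c = false] in its complement,
    where the additional loops are harmless. *)
Definition conn (c : bool) := connect (within (fun a b => adj a b == c)).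
Definition disc c := [exists u in S, exists w in S, ~~ conn c u w].
(* b forces z into every module containing u and b *)
Definition splits u : rel V := within (fun b z => adj z b != adj z u).
(** The least module containing [u] and [v], called [clo u v] below, consists of [u] and of what
    [splits u] reaches from [v]. The two are related when it misses some vertex of [S]. *)
Definition modrel u v := (u == v) || [exists w in S, (w != u) && ~~ connect (splits u) v w].
Definition blk u v := if disc true then conn true u v else if disc false then conn false u v else modrel u v.

Definition module_in (X : {set V}) := X \subset S /\
  forall z x x', z \in S -> z \notin X -> x \in X -> x' \in X -> adj z x = adj z x'.

Lemma conn_sym c : symmetric (conn c).
Proof.
apply: sym_connect_sym => a b; rewrite /within adj_sym; by rewrite andbCA.
Qed.
Lemma conn_adj c u w : u \in S -> w \in S -> adj u w = c -> conn c u w.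
Proof. by move=> hu hw h; apply: connect1; rewrite /within hu hw h eqxx. Qed.
Lemma conn_cross c (X : {set V}) u w : (forall a b, a \in S -> b \in S -> a \in X -> b \notin X -> adj a b != c) ->
  u \in X -> w \notin X -> ~~ conn c u w.
Proof.
move=> h hu; apply: contra => /connectP [q hq ->]; elim: q u hu hq => //= x q IH u hu /andP [/and3P [h1 h2 h3]].
by apply: IH; apply: contraLR h3 => hx; apply: h.
Qed.

Definition clo u v := u |: [set w | connect (splits u) v w].
(** A vertex that distinguishes some y of the closure from [u] is added through y. Hence a vertex
    left outside sees the whole closure as it sees [u]. *)
Lemma clo_module u v : u \in S -> v \in S -> module_in (clo u v).
Proof.
move=> hu hv; have hsub : clo u v \subset S.
  apply/subsetP => w; rewrite !inE => /orP [/eqP -> //|/connectP [q hq ->]].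
  by elim: q v hv hq => //= x q IH v hv /andP [/and3P [_ h2 _]]; apply: IH.
split=> // z x x' hz hzn.
suff H y : y \in clo u v -> adj z y = adj z u by move=> /H -> /H ->.
move=> hy; apply/eqP/negPn/negP => hne; case/negP: hzn.
move: (hy); rewrite !inE => /orP [/eqP E|h]; first by rewrite E eqxx in hne.
apply/orP; right; apply: connect_trans h (connect1 _).
by rewrite /splits /within hz hne (subsetP hsub).
Qed.
Lemma clo_min u v X : module_in X -> u \in X -> v \in X -> clo u v \subset X.
Proof.
move=> [hX hm] hu hv; apply/subsetP => w; rewrite !inE => /orP [/eqP -> //|/connectP [q hq ->]].
elim: q v hv hq => //= x q IH v hv /andP [/and3P [h1 h2 h3]]; apply: IH.
by apply: contraR h3 => hx; apply/eqP; apply: hm.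
Qed.

Lemma modrelP u v : u \in S -> v \in S -> 1 < #|S| ->
  reflect (exists X, [/\ module_in X, X != S, u \in X & v \in X]) (modrel u v).
Proof.
move=> hu hv hS; apply: (iffP idP).
  rewrite /modrel; case: eqP => [<- _|_ /= /existsP [w /andP [hw /andP [h1 h2]]]].
    exists [set u]; rewrite !inE eqxx; split=> //.
      split; first by rewrite sub1set.
      by move=> z x x' _ _; rewrite !inE => /eqP -> /eqP ->.
    by apply/eqP => E; rewrite -E cards1 in hS.
  exists (clo u v); split; rewrite ?inE ?eqxx ?connect0 ?orbT //; first exact: clo_module.
  by apply/eqP => /setP /(_ w); rewrite hw !inE (negPf h1) (negPf h2).
move=> [X [hX hne huX hvX]].
have hsub := clo_min hX huX hvX.
have : ~~ (S \subset clo u v).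
  apply: contra hne => h; rewrite eqEsubset hX.1 /=; exact: subset_trans h hsub.
case/subsetPn => w hw; rewrite !inE negb_or => /andP [h1 h2].
by apply/orP; right; apply/existsP; exists w; rewrite hw h1 h2.
Qed.

Hypothesis S2 : 1 < #|S|.

Lemma disc_proper c u : disc c -> u \in S -> exists2 w, w \in S & ~~ conn c u w.
Proof.
case/existsP => a /andP [ha /existsP [b /andP [hb hn]]] hu.
case h: (conn c u a); last by exists a; rewrite ?h.
exists b => //; apply: contra hn; apply: connect_trans; rewrite -/(conn c a u).
by rewrite conn_sym.
Qed.

Section PrimeCase.
Hypothesis nd : forall c, ~~ disc c.
Lemma allconn c u w : u \in S -> w \in S -> conn c u w.
Proof.
move=> hu hw; apply/negPn/negP => h; case/negP: (nd c).
by apply/existsP; exists u; rewrite hu; apply/existsP; exists w; rewrite hw.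
Qed.

(* two overlapping modules covering S would make S or its complement disconnected *)
Lemma module_union X Y u : module_in X -> module_in Y -> X != S -> Y != S ->
  u \in X -> u \in Y -> module_in (X :|: Y) /\ X :|: Y != S.
Proof.
move=> [hX mX] [hY mY] nX nY uX uY; split.
  split; first by rewrite subUset hX.
  move=> z x x' hz; rewrite inE negb_or => /andP [zX zY].
  have H y : y \in X :|: Y -> adj z y = adj z u.
    by rewrite inE => /orP [h|h]; [apply: mX | apply: mY].
  by move=> /H -> /H ->.
apply/eqP => E.
have [w wS wX] : exists2 w, w \in S & w \notin X.
  by apply/subsetPn; apply: contra nX => h; rewrite eqEsubset hX.
have [z zS zY] : exists2 z, z \in S & z \notin Y.
  by apply/subsetPn; apply: contra nY => h; rewrite eqEsubset hY.
have inY a : a \in S -> a \notin X -> a \in Y by rewrite -E inE => /orP [->|].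
have inX a : a \in S -> a \notin Y -> a \in X by rewrite -E inE => /orP [|->].
(* Exchange [a] for [z] inside the module [X], then [b] for [w] inside [Y]: all pairs across [X]
   have the adjacency of the single pair [z], [w], so connectivity of the opposite kind cannot leave
   [X]. *)
have H a b : a \in S -> b \in S -> a \in X -> b \notin X -> adj a b = adj z w.
  move=> ha hb aX bX; rewrite adj_sym (mX b a z) //; last exact: inX.
  by rewrite adj_sym (mY z b w) //; apply: inY.
have hcc a b : a \in S -> b \in S -> a \in X -> b \notin X -> adj a b != ~~ adj z w.
  by move=> ha hb aX bX; rewrite H //; case: (adj z w).
by have := conn_cross hcc uX wX; rewrite allconn // (subsetP hX).
Qed.

(** By [module_union], a proper module through [u] of maximal size absorbs every other proper module
    through [u]. *)
Lemma max_module u : u \in S -> exists X, [/\ module_in X, X != S, u \in X &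
  forall v, v \in S -> modrel u v = (v \in X)].
Proof.
move=> hu.
pose P (X : {set V}) := [&& X \subset S, X != S, u \in X & [forall z in S, (z \notin X) ==> [forall x in X, forall x' in X, adj z x == adj z x']]].
have PP X : reflect [/\ module_in X, X != S & u \in X] (P X).
  apply: (iffP and4P) => [[h1 h2 h3 h4]|[[h1 h4] h2 h3]]; split=> //.
    split=> // z x x' hz zX xX x'X.
    by have := forall_inP h4 z hz => /implyP /(_ zX) /forall_inP /(_ x xX) /forall_inP /(_ x' x'X) /eqP.
  apply/forall_inP => z hz; apply/implyP => zX; apply/forall_inP => x xX; apply/forall_inP => x' x'X.
  by apply/eqP; apply: h4.
have [X0 [a0 b0 c0 _]] : exists X, [/\ module_in X, X != S, u \in X & u \in X].
  by apply/(modrelP hu hu S2); rewrite /modrel eqxx.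
have hP0 : P X0 by apply/PP.
case: (@arg_maxnP _ X0 P (fun X : {set V} => #|X|) hP0) => X /PP [h1 h2 h3] hmax.
exists X; split=> // v hv; apply/(modrelP hu hv S2)/idP => [[Y [g1 g2 g3 g4]]|hvX]; last by exists X.
have [m1 m2] := module_union h1 g1 h2 g2 h3 g3.
have hPU : P (X :|: Y) by apply/PP; rewrite inE h3.
have := hmax _ hPU => hle.
have /eqP -> : X == X :|: Y by rewrite eqEcard subsetUl.
by rewrite inE g4 orbT.
Qed.
End PrimeCase.

Lemma nd_of : disc true = false -> disc false = false -> forall c, ~~ disc c.
Proof. by move=> h1 h2 []; rewrite ?h1 ?h2. Qed.

Lemma blk_refl u : u \in S -> blk u u.
Proof. by move=> hu; rewrite /blk; do 2 (case: ifP => _; first exact: connect0); rewrite /modrel eqxx. Qed.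
Lemma blk_sym u v : u \in S -> v \in S -> blk u v = blk v u.
Proof.
move=> hu hv; rewrite /blk; do 2 (case: ifP => ?; first exact: conn_sym).
by apply/modrelP/modrelP => // [] [X [a b c d]]; exists X.
Qed.
Lemma blk_trans u v w : u \in S -> v \in S -> w \in S -> blk u v -> blk v w -> blk u w.
Proof.
move=> hu hv hw; rewrite /blk; case: ifP => h1; first exact: connect_trans.
case: ifP => h2; first exact: connect_trans.
have [X [a b c d]] := max_module (nd_of h1 h2) hv.
rewrite -!/(blk _ _) => huv; rewrite d // => hwX.
have huX : u \in X.
  rewrite -d //; apply/(modrelP hv hu S2); by have /(modrelP hu hv S2) [Y [? ? ? ?]] := huv; exists Y.
by apply/(modrelP hu hw S2); exists X.
Qed.
Lemma blk_proper u : u \in S -> exists2 w, w \in S & ~~ blk u w.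
Proof.
move=> hu; rewrite /blk; case h1: (disc true); first exact: disc_proper.
case h2: (disc false); first exact: disc_proper.
have [X [[a _] b c d]] := max_module (nd_of h1 h2) hu.
have /subsetPn [w hw hwX] : ~~ (S \subset X) by apply: contra b => h; rewrite eqEsubset a.
by exists w; rewrite ?d.
Qed.

Lemma blk_disc u w : disc true -> u \in S -> w \in S -> ~~ blk u w -> adj u w = false.
Proof. by rewrite /blk => -> hu hw; apply: contraNF => h; apply: conn_adj. Qed.
Lemma blk_codisc u w : disc true = false -> disc false -> u \in S -> w \in S -> ~~ blk u w -> adj u w.
Proof. by rewrite /blk => -> -> hu hw; apply: contraR => h; apply: conn_adj => //; apply: negbTE. Qed.

(** Different components have no edges between them, different co-components all edges. In the
    remaining case the blocks are disjoint modules, and one endpoint at a time can be exchanged. *)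
Lemma blk_uniform u u' w w' : u \in S -> u' \in S -> w \in S -> w' \in S ->
  blk u u' -> blk w w' -> ~~ blk u w -> adj u w = adj u' w'.
Proof.
move=> hu hu' hw hw' b1 b2 b3.
have b4 : ~~ blk u' w'.
  apply: contra b3 => h; apply: blk_trans b1 _ => //; apply: blk_trans h _ => //.
  by rewrite blk_sym.
case h1: (disc true); first by rewrite !blk_disc.
case h2: (disc false); first by rewrite !blk_codisc.
have [X [[_ mX] _ c d]] := max_module (nd_of h1 h2) hu.
have [Y [[_ mY] _ c' d']] := max_module (nd_of h1 h2) hw.
have e1 : u' \in X by move: b1; rewrite /blk h1 h2 d.
have e2 : w' \in Y by move: b2; rewrite /blk h1 h2 d'.
have e3 : w \notin X by move: b3; rewrite /blk h1 h2 d.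
have e4 : u' \notin Y.
  rewrite -d' //; have -> : modrel w u' = blk w u' by rewrite /blk h1 h2.
  by apply: contra b3 => h; apply: blk_trans b1 _ => //; rewrite blk_sym.
by rewrite adj_sym (mX w u u') // adj_sym (mY u' w w').
Qed.

(** Otherwise the block of [u] would be cut off from the rest of [S] in the graph or in its
    complement. This yields the four blocks of a prime quotient. *)
Lemma prime_neighbour c u : (forall c, ~~ disc c) -> u \in S ->
  exists w, [/\ w \in S, ~~ blk u w & adj u w = c].
Proof.
move=> nd hu; have [w0 hw0 hn0] := blk_proper hu.
case: (boolP [exists w in S, ~~ blk u w && (adj u w == c)]) => [/existsP [w /and3P [a b /eqP d]]|h]; first by exists w.
have := @conn_cross c [set x in S | blk u x] u w0; rewrite !inE hu hw0 blk_refl // (negPf hn0) allconn // => hh.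
suff : false by []. apply: hh => // a b ha hb; rewrite !inE ha hb /= => e1 e2.
apply: contra h => /eqP E; apply/existsP; exists b; rewrite hb e2 /=.
have hba : ~~ blk a b by apply: contra e2 => e; apply: blk_trans e1 e.
by rewrite -(@blk_uniform a u b b) ?E ?eqxx // ?blk_refl // blk_sym.
Qed.

(** Vertices in a common proper module are related by [modrel]. Applied to a union of blocks, this
    gives primality of the quotient. *)
Lemma prime_quotient (X : {set V}) : (forall c, ~~ disc c) -> module_in X ->
  (exists x, x \in X) -> X = S \/ (forall x x', x \in X -> x' \in X -> blk x x').
Proof.
move=> nd hX _; case: (eqVneq X S) => [->|hne]; [by left | right] => x x' hx hx'.
rewrite /blk !(negPf (nd _)); apply/modrelP => //; try exact: (subsetP hX.1).
by exists X.
Qed.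
End Blocks.

(** * Definability of the successive partitions *)

Definition reachV (A : structure) (R : value A -> value A -> bool) (x y : value A) : bool :=
  connT [:: SE] (fun a b => R (nth nz a 0) (nth nz b 0)) [:: x] [:: y].
Arguments reachV {A} : simpl never.

Lemma def_reachV tau rs ss (R : forall A, rvs A -> ctx A -> value A -> value A -> bool) i j :
  isv ss SE i -> isv ss SE j ->
  Def tau rs (SE :: SE :: ss) (fun A r c => R A r (fun i => c i.+2) (c 0) (c 1)) ->
  Def tau rs ss (fun A r c => reachV (R A r c) (c i) (c j)).
Proof.
move=> hi hj h; exact: (@def_connT tau rs ss [:: SE]
  (fun A r c a b => R A r c (nth nz a 0) (nth nz b 0)) [:: i] [:: j] (isvs1 hi) (isvs1 hj) h).
Qed.

Lemma wsort_SE A (a : seq (value A)) : wsort [:: SE] a -> exists x, a = [:: inl x].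
Proof.
by move=> h; have hs := wsort_size h; case: a h hs => [|[x|i] [|]] // _ _; exists x.
Qed.
Lemma reachVE A (R : value A -> value A -> bool) (e : rel (car A)) x y :
  (forall a b, R (inl a) (inl b) = e a b) -> reachV R (inl x) (inl y) = connect e x y.
Proof.
move=> hR.
have h1 z : wsort [:: SE] [:: inl z : value A] by [].
apply/(connTP _ (h1 x) (h1 y))/connectP => [[q [hq hp hl]]|[q hq ->]].
  elim: q x hq hp hl => [|a q IH] x /=; first by move=> _ _ [->]; exists [::].
  case/andP => /wsort_SE [a' ->] hq /andP [ha hp] hl; have [q' h2 h3] := IH a' hq hp hl.
  by exists (a' :: q') => //=; rewrite -hR ha.
exists [seq [:: inl a] | a <- q]; split.
- by rewrite all_map; apply/allP.
- by elim: q x hq => //= a q IH x /andP [h2 h3]; rewrite hR h2 IH.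
- by rewrite (last_map (fun a => [:: inl a])).
Qed.

Ltac dstep3 := first [dstep2 | lazymatch goal with
 | |- Def _ _ _ (fun A r c => reachV _ (c _) (c _)) => apply: def_reachV; [by [] | by [] | rewrite /=]
 end].
Ltac dfn3 := repeat (dstep3; cbv beta).

Section Refinement.
Variable A : structure.
Implicit Types (E : value A -> value A -> bool) (u v : value A).

Definition adjV (x y : value A) := relV 0 [:: x; y].
Definition connV E (c : bool) u := reachV (fun a b => [&& E u a, E u b & adjV a b == c]).
Definition discV E c u := exV SE (fun x => E u x && exV SE (fun y => E u y && ~~ connV E c u x y)).
Definition modV E u v := (u == v) || exV SE (fun w => E u w && ((w != u) &&
  ~~ reachV (fun b z => [&& E u b, E u z & adjV z b != adjV z u]) v w)).
Definition blkV E u v := if discV E true u then connV E true u u v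
  else if discV E false u then connV E false u u v else modV E u v.

(* The classes of level d+1 are the blocks of the classes of level d: components,
   co-components, or maximal proper modules. *)
Fixpoint level (d : nat) : rel (car A) :=
  if d is d'.+1 then fun x y : car A => level d' x y && blk (adj A) [set w | level d' x w] x y
  else fun _ _ => true.
Definition levelV d u v := iterV (fun _ (Z : seq (value A) -> bool) ts =>
   Z [:: nth nz ts 0; nth nz ts 1] && blkV (fun x y => Z [:: x; y]) (nth nz ts 0) (nth nz ts 1))
   (fun _ => true) d [:: u; v].

Lemma connVE E (e : rel (car A)) c x a b : (forall a b, E (inl a) (inl b) = e a b) ->
  connV E c (inl x) (inl a) (inl b) = conn (adj A) [set w | e x w] c a b.
Proof.
move=> hE; rewrite /connV (@reachVE _ _ (within [set w | e x w] (fun a b => adj A a b == c))) // => a' b'.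
by rewrite /within !inE !hE.
Qed.
Lemma discVE E (e : rel (car A)) c x : (forall a b, E (inl a) (inl b) = e a b) ->
  discV E c (inl x) = disc (adj A) [set w | e x w] c.
Proof.
move=> hE; rewrite /discV /disc /exV; apply: eq_existsb => a; rewrite inE hE; congr andb.
by apply: eq_existsb => b; rewrite inE hE (connVE _ _ _ _ hE).
Qed.
Lemma blkVE E (e : rel (car A)) x y : (forall a b, E (inl a) (inl b) = e a b) -> e x y ->
  blkV E (inl x) (inl y) = blk (adj A) [set w | e x w] x y.
Proof.
move=> hE hxy; set S := [set w | e x w].
rewrite /blkV /blk !(discVE _ _ hE) !(connVE _ _ _ _ hE); do 2 (case: (disc _ _ _) => //).
rewrite /modV /modrel; congr orb; rewrite /exV; apply: eq_existsb => w; rewrite inE hE.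
congr (_ && (_ && ~~ _)).
by rewrite (@reachVE _ _ (splits (adj A) S x)) // => a b; rewrite /splits /within !inE !hE.
Qed.
Lemma levelVE d x y : levelV d (inl x) (inl y) = level d x y.
Proof.
elim: d x y => // d IH x y.
have -> : levelV d.+1 (inl x) (inl y) = levelV d (inl x) (inl y) && blkV (levelV d) (inl x) (inl y) by [].
by rewrite IH /=; case: (boolP (level d x y)) => //= h; rewrite (@blkVE _ (level d)).
Qed.

Hypothesis grA : is_graph A.
Lemma adj_sym : symmetric (adj A). Proof. by case: grA. Qed.

Lemma cls1 d x : (forall y, level d y y) -> #|[set w | level d x w]| <= 1 ->
  forall y, level d x y -> x = y.
Proof.
move=> hr hc y hxy; apply/eqP; apply: contraLR hc => hne; rewrite -ltnNge.
apply: (@leq_trans #|[set x; y]|); first by rewrite cards2 hne.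
by apply: subset_leq_card; apply/subsetP => z; rewrite !inE => /orP [] /eqP ->.
Qed.

Lemma level_equiv d : [/\ (forall x, level d x x), (forall x y, level d x y = level d y x) &
  (forall x y z, level d x y -> level d y z -> level d x z)].
Proof.
elim: d => [|d [hr hs ht]]; first by split.
have hcl x y : level d x y -> [set w | level d x w] = [set w | level d y w].
  move=> h; apply/setP => w; rewrite !inE; apply/idP/idP => h'; last exact: ht h h'.
  by apply: ht h'; rewrite hs.
(* The lemmas on [blk] assume a class with at least two vertices; singletons are treated separately
   throughout. *)
have small x : #|[set w | level d x w]| <= 1 -> forall y, level d x y -> x = y by apply: cls1.
split.
- move=> x /=; rewrite hr; case: (leqP #|[set w | level d x w]| 1) => h; last first.
    by apply: blk_refl => //; rewrite inE.
  by apply: blk_refl; rewrite inE.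
- move=> x y /=; case h: (level d x y); last by rewrite hs h.
  rewrite hs h /= -(hcl x y h); case: (leqP #|[set w | level d x w]| 1) => h1.
    by rewrite (small x h1 y h).
  by apply: blk_sym => //; rewrite ?inE //; exact: adj_sym.
- move=> x y z /= /andP [h1 h2] /andP [h3 h4]; rewrite (ht _ _ _ h1 h3) /=.
  case: (leqP #|[set w | level d x w]| 1) => h; first by rewrite -(small x h z (ht _ _ _ h1 h3)) blk_refl // inE.
  rewrite -(hcl _ _ h1) in h4; apply: (blk_trans adj_sym h) h2 h4; rewrite inE //.
  exact: ht h1 h3.
Qed.

(** By [blk_proper] a class with at least two vertices loses a vertex in the next step, so n steps
    are enough to reach singletons. *)
Lemma level_card d x : #|[set w | level d x w]| <= maxn 1 (#|car A| - d).
Proof.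
elim: d x => [|d IH] x; first by rewrite subn0 leq_max max_card orbT.
have [hr hs ht] := level_equiv d; have [hr' hs' ht'] := level_equiv d.+1.
case: (leqP #|[set w | level d x w]| 1) => h.
  rewrite leq_max; apply/orP; left; apply: leq_trans h; apply: subset_leq_card.
  by apply/subsetP => y; rewrite !inE /= => /andP [].
have [w hw hn] := @blk_proper _ _ adj_sym [set w | level d x w] h x ltac:(by rewrite inE).
have : #|[set w | level d.+1 x w]| < #|[set w | level d x w]|.
  apply: proper_card; apply/properP; split; first by apply/subsetP => y; rewrite !inE /= => /andP [].
  by exists w => //; rewrite inE /= (negPf hn) andbF.
move: (IH x) h; rewrite /maxn; case: ifP => _; case: ifP; lia.
Qed.
Lemma level_last x y : level #|car A| x y = (x == y).
Proof.
have [hr _ _] := level_equiv #|car A|.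
apply/idP/eqP => [|->]; last exact: hr.
by apply: cls1 => //; have := level_card #|car A| x; rewrite subnn.
Qed.
End Refinement.
Arguments adjV {A} : simpl never.

Lemma def_blkV tau rs ss i j k : isv ss SE i -> isv ss SE j -> k < size rs -> nth [::] rs k = [:: SE; SE] ->
  0 < size tau -> arity tau 0 = 2 ->
  Def tau rs ss (fun A r c => blkV (fun x y => r k [:: x; y]) (c i) (c j)).
Proof.
move=> hi hj hk hrk ht ht'.
(* In a small fixed context all indices are concrete and [dfn3] can decide its side conditions;
   [def_call] transports the result. *)
suff H : Def tau [:: [:: SE; SE]] [:: SE; SE] (fun A r c => blkV (fun x y => r 0 [:: x; y]) (c 0) (c 1)).
  have h1 := @def_rename tau (fun _ => k) [:: [:: SE; SE]] rs _ _ _ H.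
  have h2 : forall k', k' < size [:: [:: SE; SE]] -> k < size rs /\ nth [::] rs k = nth [::] [:: [:: SE; SE]] k'.
    by case.
  exact: (@def_call tau _ rs ss [:: i; j] (fun _ c => c) _ (isvs_cat (isvs1 hi) (isvs1 hj)) (h1 h2)).
have hadj ss' a b : isv ss' SE a && isv ss' SE b -> Def tau [:: [:: SE; SE]] ss' (fun A r c => adjV (c a) (c b)).
  by case/andP => ha hb; apply: (@def_relV tau _ ss' 0 [:: a; b]); rewrite ht ht' /= ha hb.
rewrite /blkV /discV /connV /modV.
dfn3; try (apply: hadj; by []).
Qed.

Lemma def_levelV tau rs ss d i j : isv ss SN d -> isv ss SE i -> isv ss SE j ->
  0 < size tau -> arity tau 0 = 2 ->
  Def tau rs ss (fun A r c => levelV (nv (c d)) (c i) (c j)).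
Proof.
move=> hd hi hj ht ht'.
apply: (@def_iter tau rs ss [:: SE; SE] (fun A r c _ Z ts => Z [:: nth nz ts 0; nth nz ts 1] &&
    blkV (fun x y => Z [:: x; y]) (nth nz ts 0) (nth nz ts 1)) (fun A r c _ => true) d [:: i; j]) => //.
- exact: isvs_cat (isvs1 hi) (isvs1 hj).
- exact: def_true.
- by rewrite /=; apply: def_and; [dfn | apply: def_blkV].
Qed.

(** * The quotient of a class as an LO-colored graph *)

Section QuotientStructure.
Variables (G : structure) (S : {set car G}) (e' : rel (car G)).
Variable X : car G -> 'I_#|car G|.+1 -> 'I_#|car G|.+1 -> bool.
Implicit Types (u w : car G).

Definition bl u := [set w | e' u w].
Definition blocks := [set bl u | u in S].
Definition block := {b : {set car G} | b \in blocks}.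
(** The colours are the numbers from 0 to n in their natural order, so the relation of a canon is
    literally a set of pairs of colours. *)
Definition lo_car : finType := (block + 'I_#|car G|.+1)%type.
Definition lo_rel (i : nat) (s : seq lo_car) : bool :=
  match i, s with
  | 0, [:: inl _] => true
  | 1, [:: inl b; inl b'] => (val b != val b') &&
      [exists u in S, exists w in S, [&& bl u == val b, bl w == val b' & adj G u w]]
  | 2, [:: inr _] => true
  | 3, [:: inr i; inr j] => i <= j
  | 4, [:: inl b; inr i; inr j] => [exists u in S, (bl u == val b) && X u i j]
  | _, _ => false
  end.
Definition lo_struct := Structure lo_car lo_rel.

Lemma card_lo : #|car lo_struct| = #|blocks| + #|car G|.+1.
Proof. by rewrite card_sum card_ord card_sig; congr (_ + _); apply: eq_card. Qed.
Lemma card_blocks : #|blocks| <= #|car G|.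
Proof. exact: leq_trans (leq_imset_card _ _) (max_card _). Qed.

Definition to_block u (d : car lo_struct) : car lo_struct :=
  if insub (bl u) is Some b then inl b else d.
Lemma to_blockE u d : u \in S -> exists2 b : block, val b = bl u & to_block u d = inl b.
Proof.
move=> hu; have hb : bl u \in blocks by apply: imset_f.
by rewrite /to_block insubT; exists (Sub (bl u) hb).
Qed.

Definition col (z : value G) : car lo_struct := inr (inord (nv z)).
Definition inS (x : value G) := if x is inl u then u \in S else false.
Definition is_bl (x y : value G) := (nv y == 0) && inS x.
(* (u, 0, _) codes the block of u, and (_, y, i) with y <> 0 the colour i.  The
   numbers range over [0, n + 1 + #|blocks|], so they need a flag as well. *)
Definition num_code (y z : value G) := if nv y == 0 then nv z else #|car G|.+1 + minn (nv z) #|blocks|.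
Definition lo_dec (s : sort) (x y z : value G) : value lo_struct :=
  if s is SE then
    inl (if is_bl x y then if x is inl u then to_block u (col z) else col z else col z)
  else inr (inord (num_code y z)).

Lemma num_code_le y z : num_code y z <= #|car lo_struct|.
Proof.
rewrite card_lo /num_code; case: ifP => _; first by apply: leq_trans (ltnW (nv_lt z)) (leq_addl _ _).
by rewrite addnC leq_add2r geq_minr.
Qed.
Lemma nv_lo_dec x y z : nv (lo_dec SN x y z) = num_code y z.
Proof. by rewrite nvN inordK // ltnS num_code_le. Qed.

Lemma lo_dec_surj s v : 0 < #|car G| -> matches s v -> exists2 cs, wsort cd cs & dec3 lo_dec s cs = v.
Proof.
move=> hG; have [x0 _] := card_gt0P hG.
have h1 : 1 <= #|car G| by [].
case: s v => [] [] // [].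
- move=> [b hb] _; have /imsetP [u hu E] := hb.
  exists [:: inl u; nz; nz] => //; rewrite /dec3 /= /is_bl /= hu.
  have [b' h2 ->] := to_blockE (col nz) hu; congr (inl (inl _)); apply: val_inj.
  by rewrite h2 /= -E.
- move=> i _; exists [:: inl x0; nval G 1; inr i] => //; rewrite /dec3 /= /is_bl nv_nval //=.
  by rewrite /col nvN inord_val.
- move=> m hm _; have hm' : m < (#|blocks| + #|car G|.+1).+1 by rewrite -card_lo.
  case: (leqP m #|car G|) => h.
    exists [:: inl x0; nz; nval G m] => //; rewrite /dec3 /=; congr inr; apply: val_inj => /=.
    by rewrite /num_code /= nv_nval // inordK.
  exists [:: inl x0; nval G 1; nval G (m - #|car G|.+1)] => //; rewrite /dec3 /=; congr inr; apply: val_inj => /=.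
  have hb := card_blocks.
  have h2 : m - #|car G|.+1 <= #|blocks| by rewrite leq_subLR; move: hm'; rewrite ltnS addnC.
  rewrite /num_code !nv_nval //; last exact: leq_trans hb.
  by rewrite (minn_idPl h2) /= subnKC // inordK.
Qed.

Lemma lo_size : 0 < #|car G| -> #|car lo_struct|.+1 <= #|car G|.+1 ^ 3.
Proof.
rewrite card_lo => hG; have := card_blocks; move: (#|blocks|) (#|car G|) hG => k n hn hk.
by rewrite !expnS expn0; nia.
Qed.

(** The pullback must be correct for all values of the relation variables, even when [e'] is not an
    equivalence. Equality of the sets [bl u] is one in any case. *)
Definition same u w := (w \in S) && [forall z, e' u z == e' w z].
Lemma sameE u w : u \in S -> same u w = (w \in S) && (bl u == bl w).
Proof.
move=> hu; congr andb; apply/forallP/eqP => [h|h z].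
  by apply/setP => z; rewrite !inE; apply/eqP.
by have /setP /(_ z) := h; rewrite !inE => ->.
Qed.

Lemma ccnt_blocks (E : value G -> value G -> bool) (p : value G -> bool) (q : pred {set car G}) :
  (forall u w, E (inl u) (inl w) = same u w) -> (forall u, p (inl u) = (u \in S) && q (bl u)) ->
  ccnt E p = #|[set b in blocks | q b]|.
Proof.
move=> hE hp; rewrite (@ccntE G same (fun u => (u \in S) && q (bl u))) //.
- have -> : [set b in blocks | q b] = bl @: [set u in S | q (bl u)].
    apply/setP => b; rewrite inE; apply/andP/imsetP => [[/imsetP [u hu ->] hq]|[u]].
      by exists u; rewrite // inE hu.
    by rewrite inE => /andP [hu hq] ->; rewrite imset_f.
  have -> : [set [set w | same u w] | u in [pred u | (u \in S) && q (bl u)]] =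
     (fun b : {set car G} => [set w in S | bl w == b]) @: (bl @: [set u in S | q (bl u)]).
    rewrite -imset_comp; apply/setP => b; apply/imsetP/imsetP => [[u hu ->]|[u hu ->]].
      exists u; first by rewrite inE.
      by apply/setP => w; rewrite !inE sameE 1?eq_sym //; case/andP: hu.
    rewrite inE in hu; exists u => //.
    by apply/setP => w; rewrite !inE sameE 1?[bl w == _]eq_sym //; case/andP: hu.
  rewrite card_in_imset // => b b' /imsetP [u]; rewrite inE => /andP [hu _] -> /imsetP [u' _ ->] /setP /(_ u).
  by rewrite !inE hu eqxx /= => /esym /eqP.
- by move=> u /andP [hu _]; rewrite sameE // hu eqxx.
- by move=> u w /andP [hu hq]; rewrite sameE // => /andP [-> /eqP <-].
- move=> u w /andP [hu hq]; rewrite sameE // => /andP [hw /eqP E0] z.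
  by rewrite !sameE // E0.
Qed.
End QuotientStructure.

Section Definability.
Variable tau : seq nat.
Hypothesis tau_adj : (0 < size tau) && (arity tau 0 == 2).

(* r 0 relates a vertex to the members of its class, r 1 is the equivalence whose
   classes are the blocks, and r 2 gives for each vertex a canon of its block. *)
Definition rs3 := [:: [:: SE; SE]; [:: SE; SE]; [:: SE; SN; SN]].
Section QuotientData.
Variables (G : structure) (r : rvs G) (c : ctx G).
Definition Sset := [set u : car G | r 0 [:: c 0; inl u]].
Definition e1 : rel (car G) := fun u w => r 1 [:: inl u; inl w].
Definition Xr (u : car G) (i j : 'I_#|car G|.+1) := r 2 [:: inl u; inr i; inr j].
Definition LO := lo_struct Sset e1 Xr.
Definition LOdec : sort -> value G -> value G -> value G -> value LO := lo_dec Sset e1 Xr.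

Definition sameV (x x' : value G) := allV SE (fun w => r 1 [:: x; w] == r 1 [:: x'; w]).
Definition isblV (v x y : value G) := (nv y == 0) && r 0 [:: v; x].
Definition ccntV (v : value G) (p : value G -> bool) :=
  ccnt (fun u w => r 0 [:: v; w] && sameV u w) (fun u => r 0 [:: v; u] && p u).

Lemma sameVE u w : sameV (inl u) (inl w) = (bl e1 u == bl e1 w).
Proof.
apply/allVP/eqP => [h|h [w'|//] _]; last by have /setP /(_ w') := h; rewrite !inE /e1 => ->.
by apply/setP => w'; rewrite !inE; apply/eqP/(h (inl w')).
Qed.
Lemma isblVE u y : isblV (c 0) (inl u) y = is_bl Sset (inl u) y.
Proof. by rewrite /isblV /is_bl /= inE. Qed.
Lemma ccntVE p q : (forall u, u \in Sset -> p (inl u) = q (bl e1 u)) ->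
  ccntV (c 0) p = #|[set b in blocks Sset e1 | q b]|.
Proof.
move=> h; apply: (ccnt_blocks (S := Sset)) => [u w|u].
  rewrite /same inE; congr andb; apply/allVP/forallP => [h1 z|h1 [z|//] _]; first exact: (h1 (inl z)).
  exact: h1.
by rewrite inE; case hu: (r 0 _) => //=; apply: h; rewrite inE.
Qed.
Lemma ccntV_true : ccntV (c 0) (fun _ => true) = #|blocks Sset e1|.
Proof. by rewrite (@ccntVE _ (fun _ => true)) //; apply: eq_card => b; rewrite inE andbT. Qed.

Lemma LOdec_E u y z : LOdec SE (inl u) y z =
  if is_bl Sset (inl u) y then inl (to_block u (col Sset e1 Xr z)) else inl (inr (inord (nv z))).
Proof. by rewrite /LOdec /lo_dec; case: ifP. Qed.
Lemma is_bl_in u y : is_bl Sset (inl u) y -> u \in Sset.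
Proof. by case/andP. Qed.

Lemma LOdec_eqE u y z u' y' z' : matches SN z -> matches SN z' ->
  (LOdec SE (inl u) y z == LOdec SE (inl u') y' z') =
  if isblV (c 0) (inl u) y then isblV (c 0) (inl u') y' && sameV (inl u) (inl u')
  else ~~ isblV (c 0) (inl u') y' && (nv z == nv z').
Proof.
move=> hz hz'; rewrite !isblVE !LOdec_E sameVE.
case: ifP => [/is_bl_in hu|_]; case: ifP => [/is_bl_in hu'|_] //=.
- have [b hb ->] := to_blockE (col Sset e1 Xr z) hu.
  have [b' hb' ->] := to_blockE (col Sset e1 Xr z') hu'.
  by rewrite -hb -hb' val_eqE; apply/eqP/eqP => [[]|->].
- by have [b hb ->] := to_blockE (col Sset e1 Xr z) hu.
- by have [b' hb' ->] := to_blockE (col Sset e1 Xr z') hu'.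
- apply/eqP/eqP => [[h]|->] //.
  by have := congr1 val h; rewrite /= !inordK ?nv_lt.
Qed.
Lemma LOdec_eqN x y z x' y' z' :
  (LOdec SN x y z == LOdec SN x' y' z') = (num_code Sset e1 y z == num_code Sset e1 y' z').
Proof.
apply/eqP/eqP => [/(congr1 (@nv LO))|h]; first by rewrite !nv_lo_dec.
by rewrite /LOdec /lo_dec h.
Qed.
End QuotientData.

Lemma def_sameV rs ss i j : isv ss SE i -> isv ss SE j -> 1 < size rs -> nth [::] rs 1 = [:: SE; SE] ->
  Def tau rs ss (fun A r c => sameV r (c i) (c j)).
Proof.
move=> hi hj h1 h2; rewrite /sameV; apply: def_allV; apply: def_eqb; apply: def_rv2; rewrite h1 h2 /=;
  case/andP: hi => a1 /eqP a2; case/andP: hj => b1 /eqP b2; by rewrite ?a2 ?b2 ?eqxx /= ltnS ?a1 ?b1.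
Qed.

Lemma def_ccntV ss v k (p : forall A, rvs A -> ctx A -> value A -> bool) rs :
  isv ss SE v -> isv ss SN k -> 1 < size rs -> nth [::] rs 0 = [:: SE; SE] -> nth [::] rs 1 = [:: SE; SE] ->
  Def tau rs (SE :: ss) (fun A r c => p A r (fun i => c i.+1) (c 0)) ->
  Def tau rs ss (fun A r c => ccntV r (c v) (p A r c) == nv (c k)).
Proof.
move=> hv hk h1 h2 h3 hp; case/andP: (hv) => v1 /eqP v2.
apply: (def_ccnt (E := fun A r c u w => r 0 [:: c v; w] && sameV r u w)
  (P := fun A r c u => r 0 [:: c v; u] && p A r c u)) => //.
  apply: def_and; last exact: def_sameV.
  by apply: def_rv2; rewrite (ltnW h1) h2 /= v2 eqxx /= !ltnS v1.
apply: def_and => //; apply: def_rv2; by rewrite (ltnW h1) h2 /= v2 eqxx /= !ltnS v1.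
Qed.

Lemma LO_eq s : Def tau rs3 (cd ++ cd ++ [:: SE]) (fun G r c =>
  LOdec r (sh 6 c) s (c 0) (c 1) (c 2) == LOdec r (sh 6 c) s (c 3) (c 4) (c 5)).
Proof.
case: s.
  apply: (@def_eq _ _ _ (fun G r c => if isblV r (c 6) (c 0) (c 1)
     then isblV r (c 6) (c 3) (c 4) && sameV r (c 0) (c 3)
     else ~~ isblV r (c 6) (c 3) (c 4) && (nv (c 2) == nv (c 5)))).
    move=> G r c hG hc; have := (hc 0 isT, hc 3 isT, (hc 2 isT, hc 5 isT)); move: (hc 0 isT) (hc 3 isT) (hc 2 isT) (hc 5 isT) => /=.
    case E0: (c 0) => [u|//] _; case E3: (c 3) => [u'|//] _ h2 h5 _.
    by rewrite LOdec_eqE.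
  by rewrite /isblV; apply: def_if; [dfn | apply: def_and; [dfn | apply: def_sameV] | dfn].
(* Codes with flag 0 denote numbers up to n and the others larger ones, so codes with different
   flags are never equal. The offset of the larger ones is capped at the number [k] of blocks. *)
apply: (@def_eq _ _ _ (fun G r c =>
   if nv (c 1) == 0 then (if nv (c 4) == 0 then nv (c 2) == nv (c 5) else false)
   else if nv (c 4) == 0 then false else exV SN (fun k : value G => (ccntV r (c 6) (fun _ => true) == nv k) &&
     ((nv (c 2) == nv (c 5)) || ((nv k <= nv (c 2)) && (nv k <= nv (c 5))))))).
  move=> G r c hG hc; rewrite LOdec_eqN /num_code.
  have h2 := nv_lt (c 2); have h5 := nv_lt (c 5).
  case: eqP => _; case: eqP => _ //.
  - by apply/esym/negbTE; apply: contraTneq h2 => ->; rewrite -leqNgt leq_addr.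
  - by apply/esym/negbTE; apply: contraTneq h5 => <-; rewrite -leqNgt leq_addr.
  - rewrite eqn_add2l; have hk := card_blocks (Sset r (sh 6 c)) (e1 r).
    have E := ccntV_true r (sh 6 c).
    apply/exNP/idP => [[k0 hk0]|h].
      by rewrite -[c 6]/(sh 6 c 0) E nv_nval // => /andP [/eqP <-]; rewrite /minn; case: ifP; case: ifP; lia.
    exists #|blocks (Sset r (sh 6 c)) (e1 r)| => //.
    rewrite -[c 6]/(sh 6 c 0) E nv_nval // eqxx andTb.
    by move: h; rewrite /minn; case: ifP; case: ifP; lia.
apply: def_if; first by dfn.
  by dfn.
apply: def_if; first by dfn.
  by dfn.
apply: def_exV; apply: def_and; last by dfn.
by apply: (def_ccntV (p := fun _ _ _ _ => true)) => //; apply: def_true.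
Qed.

Lemma LO_le : Def tau rs3 (cd ++ cd ++ [:: SE]) (fun G r c =>
  nv (LOdec r (sh 6 c) SN (c 0) (c 1) (c 2)) <= nv (LOdec r (sh 6 c) SN (c 3) (c 4) (c 5))).
Proof.
apply: (@def_eq _ _ _ (fun G r c =>
   if nv (c 1) == 0 then (if nv (c 4) == 0 then nv (c 2) <= nv (c 5) else true)
   else if nv (c 4) == 0 then false else exV SN (fun k : value G => (ccntV r (c 6) (fun _ => true) == nv k) &&
     ((nv (c 2) <= nv (c 5)) || (nv k <= nv (c 5)))))).
  move=> G r c hG hc; rewrite !nv_lo_dec /num_code.
  have h2 := nv_lt (c 2); have h5 := nv_lt (c 5).
  case: eqP => _; case: eqP => _ //.
  - by apply/esym; apply: leq_trans (ltnW h2) (leq_addr _ _).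
  - by apply/esym/negbTE; rewrite -ltnNge; apply: leq_trans h5 (leq_addr _ _).
  - rewrite leq_add2l; have hk := card_blocks (Sset r (sh 6 c)) (e1 r).
    have E := ccntV_true r (sh 6 c).
    apply/exNP/idP => [[k0 hk0]|h].
      by rewrite -[c 6]/(sh 6 c 0) E nv_nval // => /andP [/eqP <-]; rewrite /minn; case: ifP; case: ifP; lia.
    exists #|blocks (Sset r (sh 6 c)) (e1 r)| => //.
    rewrite -[c 6]/(sh 6 c 0) E nv_nval // eqxx andTb.
    by move: h; rewrite /minn; case: ifP; case: ifP; lia.
apply: def_if; first by dfn.
  by dfn.
apply: def_if; first by dfn.
  by dfn.
apply: def_exV; apply: def_and; last by dfn.
by apply: (def_ccntV (p := fun _ _ _ _ => true)) => //; apply: def_true.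
Qed.
End Definability.

Lemma card_sum_pred (X Y : finType) (P : pred (X + Y)) :
  #|P| = #|[pred x | P (inl x)]| + \sum_(y : Y) P (inr y).
Proof.
by rewrite -!sum1_card big_mkcond big_sumType /= -big_mkcond /=; congr (_ + _).
Qed.

Arguments LOdec : simpl never.
Section QuotientRelations.
Variable tau : seq nat.
Hypothesis tau_adj : (0 < size tau) && (arity tau 0 == 2).

Section Cases.
Variables (G : structure) (r : rvs G) (c : ctx G).
Variant lo_dec_spec (u : car G) (z : value G) : bool -> value (LO r c) -> Prop :=
 | DecBlock (b : block (Sset r c) (e1 r)) of u \in Sset r c & val b = bl (e1 r) u :
     lo_dec_spec u z true (inl (inl b))
 | DecColour : lo_dec_spec u z false (inl (inr (inord (nv z)))).
Lemma LOdecP u y z : lo_dec_spec u z (isblV r (c 0) (inl u) y) (LOdec r c SE (inl u) y z).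
Proof.
rewrite isblVE LOdec_E; case: ifP => [/is_bl_in hu|_]; last exact: DecColour.
have [b hb ->] := to_blockE (col (Sset r c) (e1 r) (Xr r) z) hu.
exact: DecBlock.
Qed.
Lemma LOdec_block u y z : isblV r (c 0) (inl u) y ->
  exists b : block (Sset r c) (e1 r), [/\ u \in Sset r c, val b = bl (e1 r) u & LOdec r c SE (inl u) y z = inl (inl b)].
Proof. by have [b hu hb _|//] := LOdecP u y z; exists b. Qed.
Lemma LOdec_blockI u y z b : LOdec r c SE (inl u) y z = inl (inl b) ->
  isblV r (c 0) (inl u) y /\ val b = bl (e1 r) u.
Proof. by have [b' hu hb [<-]|] := LOdecP u y z. Qed.
End Cases.

Definition edgeV A (r : rvs A) (v x x' : value A) := exV SE (fun u => [&& r 0 [:: v; u], sameV r x u &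
  exV SE (fun w => [&& r 0 [:: v; w], sameV r x' w & adjV u w])]).

Lemma def_adjV rs ss i j : isv ss SE i -> isv ss SE j -> Def tau rs ss (fun A r c => adjV (c i) (c j)).
Proof.
move=> hi hj; apply: (@def_relV tau rs ss 0 [:: i; j]).
by case/andP: tau_adj => -> /eqP -> /=; rewrite hi hj.
Qed.

Lemma def_edgeV ss v i j : isv ss SE v -> isv ss SE i -> isv ss SE j ->
  Def tau rs3 ss (fun A r c => edgeV r (c v) (c i) (c j)).
Proof.
move=> hv hi hj; case/andP: (hv) => v1 /eqP v2.
apply: def_exV; apply: def_and; first by apply: def_rv2; rewrite /= v2 ltnS v1.
apply: def_and; first exact: def_sameV.
apply: def_exV; apply: def_and; first by apply: def_rv2; rewrite /= v2 !ltnS v1.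
by apply: def_and; [exact: def_sameV|exact: def_adjV].
Qed.

Definition colV A (r : rvs A) (v x z z' : value A) :=
  exV SE (fun u => [&& r 0 [:: v; u], sameV r x u & r 2 [:: u; z; z']]).

Lemma edgeVE G (r : rvs G) c (u u' : car G) (b b' : block (Sset r c) (e1 r)) :
  val b = bl (e1 r) u -> val b' = bl (e1 r) u' ->
  edgeV r (c 0) (inl u) (inl u') =
  [exists u in Sset r c, exists w in Sset r c, [&& bl (e1 r) u == val b, bl (e1 r) w == val b' & adj G u w]].
Proof.
move=> hb hb'; apply/exVP/existsP => [[[w|//] _ /and3P [h1 h2 /exVP [[w'|//] _ /and3P [h3 h4 h5]]]]|].
  exists w; rewrite inE h1; apply/existsP; exists w'; rewrite inE h3.
  by rewrite !sameVE in h2 h4; rewrite hb hb' (eqP h2) (eqP h4) !eqxx.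
case=> w /andP [h1 /existsP [w' /andP [h3 /and3P [h2 h4 h5]]]]; rewrite !inE in h1 h3.
exists (inl w) => //; rewrite h1 sameVE -hb eq_sym h2; apply/exVP; exists (inl w') => //.
by rewrite h3 sameVE -hb' eq_sym h4.
Qed.

Lemma colVE G (r : rvs G) c (u : car G) (b : block (Sset r c) (e1 r)) (z z' : value G) :
  matches SN z -> matches SN z' -> val b = bl (e1 r) u -> 
  colV r (c 0) (inl u) z z' =
  [exists u in Sset r c, (bl (e1 r) u == val b) && Xr r u (inord (nv z)) (inord (nv z'))].
Proof.
move=> hz hz' hb; rewrite -{1}(nval_nv hz) -{1}(nval_nv hz').
apply/exVP/existsP => [[[w|//] _ /and3P [h1 h2 h3]]|[w /andP [h1 /andP [h2 h3]]]].
  by exists w; rewrite inE h1 hb eq_sym -sameVE h2.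
by rewrite inE in h1; exists (inl w) => //; rewrite h1 sameVE -hb eq_sym h2.
Qed.

Lemma LO_rel i : i < size lo_voc -> let n := arity lo_voc i in
  Def tau rs3 (cds n ++ [:: SE]) (fun G r c =>
    relV i (decs (LOdec r (sh3 n c)) (nseq n SE) (tk (3 * n) c))).
Proof.
case: i => [|[|[|[|[|i]]]]] //= _.
- apply: (@def_eq _ _ _ (fun G r c => isblV r (c 3) (c 0) (c 1))).
    move=> G r c hG hc; move: (hc 0 isT); case: (c 0) => [u|//] _.
    rewrite /= -[c 3]/(sh 3 c 0).
    by have [b _ _|] := @LOdecP G r (sh 3 c) u (c 1) (c 2).
  by rewrite /isblV; dfn.
- apply: (@def_eq _ _ _ (fun G r c => [&& isblV r (c 6) (c 0) (c 1), isblV r (c 6) (c 3) (c 4),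
     ~~ sameV r (c 0) (c 3) & edgeV r (c 6) (c 0) (c 3)])).
    move=> G r c hG hc; move: (hc 0 isT) (hc 3 isT); case: (c 0) => [u|//] _; case: (c 3) => [u'|//] _.
    rewrite /= -[c 6]/(sh 6 c 0).
    have [b hu hb|] := @LOdecP G r (sh 6 c) u (c 1) (c 2); have [b' hu' hb'|] := @LOdecP G r (sh 6 c) u' (c 4) (c 5) => //=.
    by rewrite (edgeVE hb hb') sameVE -hb -hb' /relV /=.
  by rewrite /isblV; apply: def_and; [dfn|apply: def_and; [dfn|apply: def_and; [apply: def_not; exact: def_sameV|exact: def_edgeV]]].
- apply: (@def_eq _ _ _ (fun G r c => ~~ isblV r (c 3) (c 0) (c 1))).
    move=> G r c hG hc; move: (hc 0 isT); case: (c 0) => [u|//] _.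
    rewrite /= -[c 3]/(sh 3 c 0).
    by have [b _ _|] := @LOdecP G r (sh 3 c) u (c 1) (c 2).
  by rewrite /isblV; dfn.
- apply: (@def_eq _ _ _ (fun G r c => [&& ~~ isblV r (c 6) (c 0) (c 1), ~~ isblV r (c 6) (c 3) (c 4) &
     nv (c 2) <= nv (c 5)])).
    move=> G r c hG hc; move: (hc 0 isT) (hc 3 isT); case: (c 0) => [u|//] _; case: (c 3) => [u'|//] _.
    rewrite /= -[c 6]/(sh 6 c 0).
    have [b hu hb|] := @LOdecP G r (sh 6 c) u (c 1) (c 2); have [b' hu' hb'|] := @LOdecP G r (sh 6 c) u' (c 4) (c 5) => //=.
    by rewrite /relV /= !inordK ?nv_lt.
  by rewrite /isblV; dfn.
- apply: (@def_eq _ _ _ (fun G r c => [&& isblV r (c 9) (c 0) (c 1), ~~ isblV r (c 9) (c 3) (c 4),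
     ~~ isblV r (c 9) (c 6) (c 7) & colV r (c 9) (c 0) (c 5) (c 8)])).
    move=> G r c hG hc; move: (hc 0 isT) (hc 3 isT) (hc 6 isT) (hc 5 isT) (hc 8 isT).
    case: (c 0) => [u|//] _; case: (c 3) => [u'|//] _; case: (c 6) => [u''|//] _ /= h5 h8.
    rewrite /= -[c 9]/(sh 9 c 0).
    have [b hu hb|] := @LOdecP G r (sh 9 c) u (c 1) (c 2); have [b' hu' hb'|] := @LOdecP G r (sh 9 c) u' (c 4) (c 5) => //=;
      have [b'' hu'' hb''|] := @LOdecP G r (sh 9 c) u'' (c 7) (c 8) => //=.
    by rewrite (colVE h5 h8 hb).
  rewrite /isblV /colV; apply: def_and; [by dfn|apply: def_and; [by dfn|apply: def_and; [by dfn|]]].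
  by apply: def_exV; apply: def_and; [dfn|apply: def_and; [exact: def_sameV|dfn]].
Qed.
End QuotientRelations.

(** * Counting in the quotient structure *)

Section QuotientCounting.
Variable tau : seq nat.
Hypothesis tau_adj : (0 < size tau) && (arity tau 0 == 2).

Definition hitV A (R : seq (value A) -> bool) (r : rvs A) (v u : value A) :=
  exV SE (fun x => exV SN (fun y => exV SN (fun z => [&& nv y == 0, r 0 [:: v; x], sameV r u x & R [:: x; y; z]]))).
Definition hit_colV A (R : seq (value A) -> bool) (r : rvs A) (v i : value A) :=
  exV SE (fun x => exV SN (fun y => exV SN (fun z => [&& ~~ isblV r v x y, nv z == nv i & R [:: x; y; z]]))).

(** Blocks and colours are counted apart: a block is hit if some code of one of its vertices belongs
    to [R], which is a class count, and the colours are summed over the numbers. The bound on the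
    blocks keeps that count within the numbers of [G]. *)
Lemma LO_count G (R : seq (value G) -> bool) (r : rvs G) c :
  #|[pred a : car (LO r c) | exS cd (fun cs => R cs && (dec3 (LOdec r c) SE cs == inl a))]| =
  ccntV r (c 0) (hitV R r (c 0)) + \sum_(i < #|car G|.+1) hit_colV R r (c 0) (nval G i) /\
  ccntV r (c 0) (hitV R r (c 0)) <= #|blocks (Sset r c) (e1 r)|.
Proof.
have H a : exS cd (fun cs => R cs && (dec3 (LOdec r c) SE cs == inl a)) <->
    exists u y z, [/\ matches SN y, matches SN z, R [:: inl u; y; z] & LOdec r c SE (inl u) y z = inl a].
  split=> [/exSP [cs hcs /andP [h1 /eqP h2]]|[u [y [z [hy hz h1 h2]]]]].
    have [x [y [z E]]] := wsort_cd hcs; move: hcs h1 h2; rewrite {}E.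
    rewrite !wsort_cons => /and4P [hx hy hz _]; case: x hx => [u|//] _ h1 h2.
    by exists u, y, z.
  apply/exSP; exists [:: inl u; y; z]; first by rewrite !wsort_cons hy hz.
  by rewrite h1 /dec3 /= h2.
pose q b := [exists b' : block (Sset r c) (e1 r), (val b' == b) &&
   exS cd (fun cs => R cs && (dec3 (LOdec r c) SE cs == inl (inl b')))].
have hq : ccntV r (c 0) (hitV R r (c 0)) = #|[set b in blocks (Sset r c) (e1 r) | q b]|.
  apply: ccntVE => u hu; apply/idP/existsP.
    move=> /exVP [[x|//] _ /exVP [y hy /exVP [z hz /and4P [h1 h2 h3 h4]]]].
    have hb : isblV r (c 0) (inl x) y by rewrite /isblV h1.
    have [b [hx hbx E]] := LOdec_block z hb.
    exists b; rewrite hbx eq_sym -sameVE h3; apply/H.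
    by exists x, y, z.
  move=> [b /andP [/eqP hb /H [x [y [z [hy hz h1 h2]]]]]].
  apply/exVP; exists (inl x) => //; apply/exVP; exists y => //; apply/exVP; exists z => //.
  have [/andP [h3 h4] h5] := LOdec_blockI h2.
  by rewrite sameVE -hb -h5 eqxx h3 h4.
split; last by rewrite hq; apply: subset_leq_card; apply/subsetP => b; rewrite inE => /andP [].
rewrite card_sum_pred hq; congr (_ + _); last first.
  apply: eq_bigr => i _; congr nat_of_bool; apply/idP/idP => [/H [u [y [z [hy hz h1 h2]]]]|].
    apply/exVP; exists (inl u) => //; apply/exVP; exists y => //; apply/exVP; exists z => //.
    have := h2; have [b _ _ //|[E]] := @LOdecP _ r c u y z.
    by rewrite -E inordK ?nv_lt // nval_nv // eqxx h1.
  move=> /exVP [[u|//] _ /exVP [y hy /exVP [z hz /and3P [h1 /eqP h2 h3]]]].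
  apply/H; exists u, y, z; split=> //; move: h1.
  case: (@LOdecP _ r c u y z) => // _; rewrite h2 nv_nval ?inord_val //.
  by rewrite -ltnS.
rewrite -(card_imset _ val_inj); apply: eq_card => b; rewrite inE; apply/imsetP/andP.
  move=> [b']; rewrite inE => hb ->; split; first exact: (valP b').
  by apply/existsP; exists b'; rewrite eqxx.
by move=> [_ /existsP [b' /andP [/eqP <- h]]]; exists b'.
Qed.

Definition rs4 := rs3 ++ [:: cd].
Lemma def_hit_count ss v k : isv ss SE v -> isv ss SN k ->
  Def tau rs4 ss (fun A r c => ccntV r (c v) (hitV (r 3) r (c v)) == nv (c k)).
Proof.
move=> hv hk; case/andP: (hv) => v1 /eqP v2.
apply: (def_ccntV (p := fun A r c u => hitV (r 3) r (c v) u)) => //.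
apply: def_exV; apply: def_exV; apply: def_exV.
apply: def_and; first by dfn.
apply: def_and; first by apply: def_rv2; rewrite /= v2 !ltnS v1.
by apply: def_and; [exact: def_sameV|dfn].
Qed.
Lemma def_hit_col_count ss v k : isv ss SE v -> isv ss SN k ->
  Def tau rs4 ss (fun A r c => \sum_(i < #|car A|.+1) hit_colV (r 3) r (c v) (nval A i) == nv (c k)) /\
  Def tau rs4 ss (fun A r c => \sum_(i < #|car A|.+1) ~~ hit_colV (r 3) r (c v) (nval A i) == nv (c k)).
Proof.
move=> hv hk; case/andP: (hv) => v1 /eqP v2.
have H : Def tau rs4 (SN :: ss) (fun A r c => hit_colV (r 3) r (c v.+1) (c 0)).
  apply: def_exV; apply: def_exV; apply: def_exV.
  apply: def_and; last by dfn.
  apply: def_not; rewrite /isblV; apply: def_and; first by dfn.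
  by apply: def_rv2; rewrite /= v2 !ltnS v1.
split; first by apply: (def_cntN (P := fun A r c d => hit_colV (r 3) r (c v) d)).
by apply: (def_cntN (P := fun A r c d => ~~ hit_colV (r 3) r (c v) d)) => //; apply: def_not.
Qed.

Lemma sum_negb n (P : pred 'I_n) : \sum_(i < n) P i + \sum_(i < n) ~~ P i = n.
Proof. by rewrite -big_split /= -[RHS]card_ord -sum1_card; apply: eq_bigr => i _; case: (P i). Qed.

(** A total beyond n is not a number of the graph. Let X count the blocks hit, Y the colours hit and
    Z the colours not hit, so Y + Z = n + 1. Then X + Y = n + 1 + m is equivalent to m + Z = X,
    which can be tested with the numbers available. *)
Definition count_code A (r : rvs A) (c : ctx A) :=
  if nv (c 1) == 0 then exV SN (fun a : value A => exV SN (fun b : value A =>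
    [&& ccntV r (c 3) (hitV (r 3) r (c 3)) == nv a,
        \sum_(i < #|car A|.+1) hit_colV (r 3) r (c 3) (nval A i) == nv b & nv a + nv b == nv (c 2)]))
  else exV SN (fun k : value A => exV SN (fun a : value A => exV SN (fun b : value A => exV SN (fun m : value A =>
    [&& ccntV r (c 3) (fun _ => true) == nv k,
        ccntV r (c 3) (hitV (r 3) r (c 3)) == nv a,
        \sum_(i < #|car A|.+1) ~~ hit_colV (r 3) r (c 3) (nval A i) == nv b,
        nv m + nv b == nv a &
        if nv (c 2) <= nv k then nv m == nv (c 2) else nv m == nv k])))).
Lemma def_count_code : Def tau rs4 (cd ++ [:: SE]) count_code.
Proof.
apply: def_if; first by dfn.
  apply: def_exV; apply: def_exV; apply: def_and; first exact: def_hit_count.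
  by apply: def_and; [have [] := @def_hit_col_count [:: SN, SN & cd ++ [:: SE]] 5 0 isT isT|dfn2].
apply: def_exV; apply: def_exV; apply: def_exV; apply: def_exV.
apply: def_and; first by apply: (def_ccntV (p := fun _ _ _ _ => true)) => //; apply: def_true.
apply: def_and; first exact: def_hit_count.
apply: def_and; first by have [] := @def_hit_col_count [:: SN, SN, SN, SN & cd ++ [:: SE]] 7 1 isT isT.
by dfn2.
Qed.

Lemma LO_cnt : Def tau (cd :: rs3) (cd ++ [:: SE]) (fun G r c =>
  #|[pred a | exS cd (fun cs => r 0 cs && (dec3 (LOdec (fun k => r k.+1) (sh 3 c)) SE cs == inl a))]|
   == nv (LOdec (fun k => r k.+1) (sh 3 c) SN (c 0) (c 1) (c 2))).
Proof.
(* The set of codes is the last relation variable in [rs4], but [dec_cnt] expects it first. *)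
pose g k := if k is k'.+3 then 0 else k.+1.
apply: (@def_eq _ _ _ (fun A r c => count_code (fun k => r (g k)) c)); last first.
  by apply: (@def_rename tau g rs4 (cd :: rs3) _ count_code); [case=> [|[|[|[|k]]]]|exact: def_count_code].
move=> G r c hG hc; have [-> ] := LO_count (r 0) (fun k => r k.+1) (sh 3 c); rewrite nv_lo_dec /num_code /count_code.
set r' := fun k => r k.+1.
rewrite -[ccntV (fun k => r (g k)) (c 3) (hitV _ _ _)]/(ccntV r' (sh 3 c 0) (hitV (r 0) r' (sh 3 c 0))).
rewrite -[ccntV (fun k => r (g k)) (c 3) (fun _ => true)]/(ccntV r' (sh 3 c 0) (fun _ => true)).
rewrite ccntV_true; set X := ccntV _ _ _; set k := #|blocks _ _| => hX.
have hk : k <= #|car G| by exact: card_blocks.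
have hX' := leq_trans hX hk.
rewrite -[hit_colV (r (g 3)) _ (c 3)]/(hit_colV (r 0) r' (sh 3 c 0)).
have := sum_negb (fun i : 'I_#|car G|.+1 => hit_colV (r 0) r' (sh 3 c 0) (nval G i)).
set Y := \sum_(i < _) _; set Z := \sum_(i < _) _ => hYZ.
have h2 := nv_lt (c 2).
case: eqP => _.
  apply/exNP/eqP => [[a ha /exNP [b hb]]|E].
    by rewrite !nv_nval // => /and3P [/eqP -> /eqP -> /eqP].
  have hY : Y <= #|car G| by lia.
  by exists X => //; apply/exNP; exists Y => //; rewrite !nv_nval // !eqxx E /=.
apply/exNP/eqP => [[k' hk' /exNP [a ha /exNP [b hb /exNP [m hm]]]]|E].
  rewrite !nv_nval // => /and5P [/eqP <- /eqP <- /eqP h3 /eqP h4].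
  by rewrite /minn; case: leqP => h5 /eqP; case: ltnP; lia.
have hZ : Z <= #|car G| by lia.
have hm : minn (nv (c 2)) k <= #|car G| by lia.
exists k => //; apply/exNP; exists X => //; apply/exNP; exists Z => //.
apply/exNP; exists (minn (nv (c 2)) k) => //; rewrite !nv_nval // !eqxx /=; apply/andP; split.
  by apply/eqP; lia.
by rewrite /minn; case: leqP => h5; case: ltnP => h6; apply/eqP; lia.
Qed.
End QuotientCounting.

Section QuotientPullback.
Variables (tau : seq nat) (T : transduction).
Hypothesis tau_adj : (0 < size tau) && (arity tau 0 == 2).
Hypothesis wfT : wf_transduction (lo_voc ++ [:: 2]) T.

Definition LOnum A (r : rvs A) (c : ctx A) (z : value A) : value (LO r c) := inr (inord (nv z)).
(** The constant context is sufficient because the quotient structure reads only index 0, the vertex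
    that names the class. *)
Definition WG A (r : rvs A) (v b x y z : value A) :=
  W T (A := LO r (fun _ => v)) [seq LOnum r (fun _ => v) a | a <- [:: b; x; y; z]].

Lemma LO_match G (r : rvs G) (c : ctx G) s x y z : matches s (LOdec r c s x y z).
Proof. by case: s. Qed.
Lemma LO_nonempty G (r : rvs G) (c : ctx G) : 0 < #|car (LO r c)|.
Proof. by rewrite card_lo addnS. Qed.

Lemma def_WG ss v i j k l : isv ss SE v -> isv ss SN i -> isv ss SN j -> isv ss SN k -> isv ss SN l ->
  Def tau rs3 ss (fun A r c => WG r (c v) (c i) (c j) (c k) (c l)).
Proof.
move=> hv hi hj hk hl.
have [/(_ [::] erefl) [f f1 f2]] := def_W wfT.
(* The names 4 to 1 are those of the four arguments according to [stdb]; the fifth is the reserved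
   number variable 0, which needs a code as well. *)
pose xs : seq var := [:: (SN, 4); (SN, 3); (SN, 2); (SN, 1); (SN, 0)].
have H : Def tau rs3 (cds 5 ++ [:: SE]) (fun G r c =>
   eval lo_voc (LO r (sh3 5 c)) f (envX (LOdec r (sh3 5 c)) xs [::] r c)).
  apply: (@pull_formula tau lo_voc rs3 [:: SE] (fun G r c => LO r c) (fun G r c => LOdec r c)
    _ _ _ _ _ _ _ f xs [::]).
  - by move=> G r c s x y z _; apply: LO_match.
  - by move=> G r c hG _ s u hu; apply: lo_dec_surj.
  - by move=> G r c hG _; apply: lo_size.
  - exact: LO_eq.
  - exact: LO_le.
  - exact: LO_rel.
  - exact: LO_cnt.
(* A number up to n is coded by an arbitrary element, here [v], the flag 0 and the number itself.
   Index 0 is a new variable of value 0. The fifth code is that of 0, and the last entry is the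
   parameter [v]. *)
pose js := [:: v.+1; 0; i.+1; v.+1; 0; j.+1; v.+1; 0; k.+1; v.+1; 0; l.+1; v.+1; 0; 0; v.+1].
have hjs : isvs (SN :: ss) (cds 5 ++ [:: SE]) js.
  case/andP: hv => v1 /eqP v2; case/andP: hi => i1 /eqP i2; case/andP: hj => j1 /eqP j2.
  case/andP: hk => k1 /eqP k2; case/andP: hl => l1 /eqP l2.
  by rewrite /isvs /= v2 i2 j2 k2 l2 eqxx /= !ltnS v1 i1 j1 k1 l1.
apply: (@def_eq _ _ _ (fun A r c => exV SN (fun z : value A => (nv z == 0) &&
  (fun A (r : rvs A) (c : ctx A) => eval lo_voc (LO r (sh3 5 c)) f (envX (LOdec r (sh3 5 c)) xs [::] r c))
   A r (catc [seq scons z c a | a <- js] c)))); last first.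
  apply: def_exV; apply: def_and; first by dfn.
  apply: (@def_eq _ _ _ (fun A r c => 
  (fun A (r : rvs A) (c : ctx A) => eval lo_voc (LO r (sh3 5 c)) f (envX (LOdec r (sh3 5 c)) xs [::] r c))
   A r (catc [seq c a | a <- js] (fun i => c i.+1)))) => //.
  exact: (def_call (fun A (c : ctx A) i => c i.+1) hjs H).
move=> G r c hG hc.
have key (z : value G) : nv z = 0 ->
  (fun A (r : rvs A) (c : ctx A) => eval lo_voc (LO r (sh3 5 c)) f (envX (LOdec r (sh3 5 c)) xs [::] r c))
   G r (catc [seq scons z c a | a <- js] c) = WG r (c v) (c i) (c j) (c k) (c l).
  move=> hz; cbv beta; set c' := catc _ c; set u := sh3 5 c'.
  have E a : num_code (Sset r u) (e1 r) z a = nv a by rewrite /num_code hz eqxx.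
  rewrite (f2 _ _ (fun _ _ => false) (catc [seq LOnum r u a | a <- [:: c i; c j; c k; c l]] (fun _ => nz))) //.
    exact: LO_nonempty.
  rewrite /= /c' /= !E hz; split=> //; split=> //; split=> //; split=> //.
  by congr Some; apply: val_inj; rewrite /= inordK.
apply/exNP/idP => [[z0 hz0 /andP []]|h].
  by rewrite nv_nval // => /eqP hz; rewrite key // hz nv_nval.
by exists 0 => //; rewrite nv_nval // eqxx key // nv_nval.
Qed.
End QuotientPullback.

(** * Assembling the canons of the blocks *)

Section Concatenation.
Variables (V : finType) (adj : rel V).
Local Notation n := #|V|.
(* The diagonal of R encodes the number of vertices of the canon. *)
Definition isCanon (S : {set V}) (R : nat -> nat -> bool) := exists h : nat -> V,
  [/\ forall i, i < #|S| -> h i \in S,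
      forall i j, i < #|S| -> j < #|S| -> h i = h j -> i = j &
      forall i j, i <= n -> j <= n ->
        R i j = [&& i < #|S|, j < #|S| & (i == j) || adj (h i) (h j)]].

Lemma sum_lt m k : k <= m -> \sum_(i < m) (i < k) = k.
Proof.
move=> hk; transitivity (\sum_(i < k) 1); last by rewrite sum_nat_const card_ord muln1.
by rewrite (big_ord_widen m (fun _ => 1)) // [RHS]big_mkcond; apply: eq_bigr => i _; case: ifP.
Qed.

Lemma canon_diag S R i : isCanon S R -> i <= n -> R i i = (i < #|S|).
Proof. by move=> [h [_ _ H]] hi; rewrite H // eqxx /= andbT andbb. Qed.
Lemma canon_size S R : isCanon S R -> \sum_(i < n.+1) R i i = #|S|.
Proof.
move=> hR; rewrite -[RHS](@sum_lt n.+1) ?leqW ?max_card //.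
by apply: eq_bigr => i _; rewrite (canon_diag hR) // -ltnS.
Qed.

Variables (S : {set V}) (k : nat) (B : nat -> {set V}).
Variables (Y : nat -> nat -> nat -> bool) (Q R : nat -> nat -> bool).
Hypothesis k_gt0 : 0 < k.
Hypothesis k_le : k <= n.
Hypothesis B_sub : forall b x, b < k -> x \in B b -> x \in S.
Hypothesis B_disj : forall b b' x, b < k -> b' < k -> x \in B b -> x \in B b' -> b = b'.
Hypothesis B_cover : forall x, x \in S -> exists2 b, b < k & x \in B b.
Hypothesis Y_canon : forall b, b < k -> isCanon (B b) (Y b).
Hypothesis Y_out : forall b i, b <= n -> k <= b -> i <= n -> Y b i i = false.
Hypothesis Q_adj : forall b b' x x', b < k -> b' < k -> b != b' -> x \in B b -> x' \in B b' ->
  Q b b' = adj x x'.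
(** The size of a block is read off the diagonal of its canon. The sums range over all numbers with
    a condition inside, since definable sums have this form. *)
Definition off b := \sum_(b' < n.+1) (if b' < b then \sum_(i < n.+1) Y b' i i else 0).
Definition locates b r i := Y b r r && (off b + r == i).
Hypothesis RE : forall i j, i <= n -> j <= n -> R i j <->
  exists b r b' r', [/\ [/\ b <= n, r <= n, b' <= n & r' <= n],
    locates b r i, locates b' r' j & if b == b' then Y b r r' else Q b b'].

Lemma card_blocks_sum : \sum_(b < k) #|B b| = #|S|.
Proof.
transitivity (\sum_(b < k) \sum_(x in S) (x \in B b)).
  apply: eq_bigr => b _; rewrite -sum1_card big_mkcond [in RHS]big_mkcond; apply: eq_bigr => x _.
  by case: (boolP (x \in B b)) => [/(B_sub (ltn_ord b)) -> //|_]; case: ifP.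
rewrite exchange_big -sum1_card; apply: eq_bigr => x /B_cover [b hb hx] /=.
rewrite (bigD1 (Ordinal hb)) //= hx big1 // => b' hb'.
by case: (boolP (x \in B b')) => // h; case/eqP: hb'; apply: val_inj; apply: B_disj h hx.
Qed.

Let shp := [seq #|B b| | b <- iota 0 k].
Lemma size_shp : size shp = k. Proof. by rewrite size_map size_iota. Qed.
Lemma sumn_shp : sumn shp = #|S|.
Proof. by rewrite sumnE big_map -card_blocks_sum -(big_mkord xpredT (fun b => #|B b|)) /index_iota subn0. Qed.
Lemma nth_shp b : b < k -> nth 0 shp b = #|B b|.
Proof. by move=> hb; rewrite (nth_map 0) ?size_iota // nth_iota. Qed.

Lemma off_shp b : b <= k -> off b = sumn (take b shp).
Proof.
move=> hb; rewrite /off -big_mkcond -(big_ord_widen n.+1 (fun b' => \sum_(i < n.+1) Y b' i i)); last first.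
  exact: leq_trans hb (leqW k_le).
have -> : take b shp = [seq #|B b'| | b' <- iota 0 b].
  by rewrite -map_take take_iota (minn_idPl hb).
rewrite sumnE big_map -[X in iota 0 X]subn0 -/(index_iota 0 b) big_mkord.
apply: eq_bigr => i _; rewrite (canon_size (Y_canon (leq_trans (ltn_ord i) hb))) //.
Qed.

(** For the list of block sizes, [reshape_index] and [reshape_offset] give the block and the place
    within it of a position of the concatenation. [Y_out] excludes indices beyond the last block. *)
Lemma locatesE b r i : b <= n -> r <= n -> locates b r i <->
  [/\ i < #|S|, b = reshape_index shp i & r = reshape_offset shp i].
Proof.
move=> hb hr; split=> [/andP [h1 /eqP h2]|[hi E1 E2]].
  case: (leqP k b) => hk; first by rewrite Y_out in h1.
  rewrite (canon_diag (Y_canon hk)) // -nth_shp // in h1.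
  have E : i = flatten_index shp b r by rewrite -h2 off_shp // ltnW.
  rewrite E flatten_indexKl // flatten_indexKr //; split=> //.
  by rewrite -sumn_shp flatten_indexP.
have hk : b < k by rewrite E1 -size_shp reshape_indexP // sumn_shp.
rewrite /locates (canon_diag (Y_canon hk)) // -nth_shp // off_shp ?(ltnW hk) // E2 E1.
rewrite reshape_offsetP ?sumn_shp //=; apply/eqP; exact: reshape_indexK.
Qed.

Lemma concat_canon : isCanon S R.
Proof.
have [H0 hH0] := fin_all_exists (fun b : 'I_k => Y_canon (ltn_ord b)).
pose H b := H0 (insubd (Ordinal k_gt0) b).
have hH b : b < k ->
   [/\ forall i, i < #|B b| -> H b i \in B b,
      forall i j, i < #|B b| -> j < #|B b| -> H b i = H b j -> i = j &
      forall i j, i <= n -> j <= n ->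
        Y b i j = [&& i < #|B b|, j < #|B b| & (i == j) || adj (H b i) (H b j)]].
  by move=> hb; rewrite /H; have := hH0 (insubd (Ordinal k_gt0) b); rewrite val_insubd hb.
pose bi := reshape_index shp; pose ri := reshape_offset shp.
have hbi i : i < #|S| -> bi i < k by move=> hi; rewrite -size_shp reshape_indexP ?sumn_shp.
have hri i : i < #|S| -> ri i < #|B (bi i)|.
  by move=> hi; rewrite -nth_shp ?hbi // reshape_offsetP ?sumn_shp.
have hrn i : i < #|S| -> ri i <= n by move=> hi; apply: leq_trans (ltnW (hri _ hi)) (max_card _).
have hin i : i < #|S| -> H (bi i) (ri i) \in B (bi i).
  by move=> hi; have [h _ _] := hH _ (hbi _ hi); apply: h; apply: hri.
have inj i j : i < #|S| -> j < #|S| -> bi i = bi j -> ri i = ri j -> i = j.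
  by move=> hi hj E1 E2; have := reshape_indexK shp j; rewrite -/(bi j) -/(ri j) -E1 -E2 reshape_indexK.
exists (fun i => H (bi i) (ri i)); split.
- by move=> i hi; apply: B_sub (hin _ hi); apply: hbi.
- move=> i j hi hj E.
  have Eb : bi i = bi j by apply: (B_disj (x := H (bi i) (ri i))); rewrite ?hbi ?hin // E hin.
  apply: inj => //; have [_ h _] := hH _ (hbi _ hi); apply: h; rewrite ?hri //.
    by rewrite Eb hri.
  by rewrite E Eb.
move=> i j hi hj; apply/idP/idP.
  move/RE => /(_ hi hj) [b [r [b' [r' [[hb hr hb' hr'] /locatesE L /locatesE L' E]]]]].
  have [hiS Eb Er] := L hb hr; have [hjS Eb' Er'] := L' hb' hr'.
  rewrite hiS hjS /=; case: eqP => //= hij.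
  move: E; rewrite Eb Eb' Er Er' -!/(bi _) -!/(ri _); case: eqP => E.
    have [_ _ ->] := hH _ (hbi _ hiS); rewrite ?hrn // => /and3P [_ _ /orP [/eqP E2|]].
      by case: hij; apply: inj.
    by rewrite {2}E.
  by move/eqP: E => E; rewrite (Q_adj (hbi _ hiS) (hbi _ hjS) E (hin _ hiS) (hin _ hjS)).
move=> /and3P [hiS hjS h]; apply/RE => //.
have hbn x : x < #|S| -> bi x <= n by move=> hx; apply: leq_trans (ltnW (hbi _ hx)) k_le.
exists (bi i), (ri i), (bi j), (ri j); split.
- by rewrite !hbn ?hrn.
- by apply/locatesE; rewrite ?hbn ?hrn.
- by apply/locatesE; rewrite ?hbn ?hrn.
case: eqP => E.
  have [_ _ ->] := hH _ (hbi _ hiS); rewrite ?hrn // hri // {1}E hri //=.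
  by case/orP: h => [/eqP -> | h]; rewrite ?eqxx // {2}E h orbT.
move/eqP: E => E; rewrite (Q_adj (hbi _ hiS) (hbi _ hjS) E (hin _ hiS) (hin _ hjS)).
by case/orP: h => // /eqP E2; rewrite E2 eqxx in E.
Qed.
End Concatenation.

(** * The formula for the canon of a class *)

Section CanonFormula.
Variables (tau : seq nat) (T : transduction).
Hypothesis tau_adj : (0 < size tau) && (arity tau 0 == 2).
Hypothesis wfT : wf_transduction (lo_voc ++ [:: 2]) T.

Section Semantics.
Variables (A : structure) (r : rvs A) (v : value A).
Implicit Types u w b i j k : value A.
Definition canlt u w := precedes [:: SN; SN] (fun s => r 2 (u :: s)) (fun s => r 2 (w :: s)).
(** In the sorted sequence of blocks, those with the same canon as the block of [u] occupy the
    positions from [cntlt u] up to, but excluding, [cntle u]. *)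
Definition cntlt u := ccntV r v (fun w => canlt w u).
Definition cntle u := ccntV r v (fun w => ~~ canlt u w).
(* The b-th block in the order of the canons is not definable, but its canon is:
   blocks that cannot be distinguished have equal canons. *)
Definition sortedV b i j := exV SE (fun u => [&& r 0 [:: v; u],
  exV SN (fun k : value A => (cntlt u == nv k) && (nv k <= nv b)),
  exV SN (fun k : value A => (cntle u == nv k) && (nv b < nv k)) & r 2 [:: u; i; j]]).
Definition E0V (x y : value A) := r 0 [:: x; y].
(** Singleton classes are neither disconnected nor co-disconnected and do not have a prime quotient
    with 4 vertices. The sorted branch copies their canon unchanged. *)
Definition oneV := allV SE (fun u => allV SE (fun w => r 0 [:: v; u] && r 0 [:: v; w] ==> r 1 [:: u; w])).
Definition inV b i j :=
  if [|| oneV, discV E0V true v | discV E0V false v] then sortedV b i j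
  else exV SN (fun f : value A => (nv f != 0) && WG T r v f b i j).
(** For flag 0 the relation of [WG] gives the edges of the ordered quotient; its last argument is
    then a filler. *)
Definition betweenV b b' :=
  if discV E0V true v then false else if discV E0V false v then true
  else exV SN (fun f : value A => (nv f == 0) && WG T r v f b b' f).
Definition sizeV b := \sum_(i < #|car A|.+1) inV b (nval A i) (nval A i).
Definition offV b := \sum_(d < #|car A|.+1) (if d < nv b then sizeV (nval A d) else 0).
Definition locV b k i := inV b k k && exV SN (fun o : value A => (offV b == nv o) && (nv o + nv k == nv i)).
Definition canonV i j := exV SN (fun b : value A => exV SN (fun k : value A => exV SN (fun b' : value A => exV SN (fun k' : value A =>
  [&& locV b k i, locV b' k' j & if nv b == nv b' then inV b k k' else betweenV b b'])))).
End Semantics.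

Lemma def_E0V ss i j : isv ss SE i -> isv ss SE j -> Def tau rs3 ss (fun A r c => E0V r (c i) (c j)).
Proof. by case/andP=> h1 /eqP h2 /andP [h3 /eqP h4]; apply: def_rv2; rewrite /= h2 h4 h1 h3. Qed.
Lemma def_r2 ss i j k : isv ss SE i -> isv ss SN j -> isv ss SN k ->
  Def tau rs3 ss (fun A r c => r 2 [:: c i; c j; c k]).
Proof.
move=> /andP [h1 /eqP h2] /andP [h3 /eqP h4] /andP [h5 /eqP h6].
by apply: def_rv3; rewrite /= h2 h4 h6 h1 h3 h5.
Qed.

Lemma def_canlt ss i j : isv ss SE i -> isv ss SE j -> Def tau rs3 ss (fun A r c => canlt r (c i) (c j)).
Proof.
move=> hi hj; rewrite /canlt /precedes.
apply: def_exS => /=; apply: def_and; first exact: def_r2.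
apply: def_and; first by apply: def_not; apply: def_r2.
apply: def_allS => /=; apply: def_imp; first by dfn2.
by apply: def_eqb; apply: def_r2.
Qed.

Lemma def_cntlt ss v i k : isv ss SE v -> isv ss SE i -> isv ss SN k ->
  Def tau rs3 ss (fun A r c => cntlt r (c v) (c i) == nv (c k)).
Proof.
by move=> hv hi hk; apply: (def_ccntV (p := fun A r c w => canlt r w (c i))) => //; apply: def_canlt.
Qed.
Lemma def_cntle ss v i k : isv ss SE v -> isv ss SE i -> isv ss SN k ->
  Def tau rs3 ss (fun A r c => cntle r (c v) (c i) == nv (c k)).
Proof.
move=> hv hi hk; apply: (def_ccntV (p := fun A r c w => ~~ canlt r (c i) w)) => //.
by apply: def_not; apply: def_canlt.
Qed.

Lemma def_le' ss i j : isv ss SN i -> isv ss SN j -> Def tau rs3 ss (fun A r c => nv (c i) <= nv (c j)).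
Proof. by move=> hi hj; apply: def_le; rewrite hi. Qed.
Lemma def_lt' ss i j : isv ss SN i -> isv ss SN j -> Def tau rs3 ss (fun A r c => nv (c i) < nv (c j)).
Proof. by move=> hi hj; apply: def_lt; rewrite hi. Qed.

Lemma def_sortedV ss v b i j : isv ss SE v -> isv ss SN b -> isv ss SN i -> isv ss SN j ->
  Def tau rs3 ss (fun A r c => sortedV r (c v) (c b) (c i) (c j)).
Proof.
move=> hv hb hi hj; apply: def_exV; apply: def_and; first exact: (@def_E0V (SE :: ss) v.+1 0).
apply: def_and; first by apply: def_exV; apply: def_and; [exact: (@def_cntlt [:: SN, SE & ss] v.+2)|apply: def_le'].
apply: def_and; last exact: def_r2.
by apply: def_exV; apply: def_and; [exact: (@def_cntle [:: SN, SE & ss] v.+2)|apply: def_lt'].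
Qed.

Lemma def_discV ss v (b : bool) : isv ss SE v -> Def tau rs3 ss (fun A r c => discV (E0V r) b (c v)).
Proof.
move=> hv; apply: def_exV; apply: def_and; first exact: (@def_E0V (SE :: ss) v.+1 0).
apply: def_exV; apply: def_and; first exact: (@def_E0V [:: SE, SE & ss] v.+2 0).
apply: def_not; rewrite /connV; apply: def_reachV => //.
apply: def_and; first exact: (@def_E0V [:: SE, SE, SE, SE & ss] v.+4 0).
apply: def_and; first exact: (@def_E0V [:: SE, SE, SE, SE & ss] v.+4 1).
by apply: def_eqb; [exact: def_adjV|apply: def_cst].
Qed.

Lemma def_inV ss v b i j : isv ss SE v -> isv ss SN b -> isv ss SN i -> isv ss SN j ->
  Def tau rs3 ss (fun A r c => inV r (c v) (c b) (c i) (c j)).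
Proof.
move=> hv hb hi hj; apply: def_if; last 1 first.
- apply: def_exV; apply: def_and; first by dfn.
  exact: (@def_WG tau T tau_adj wfT (SN :: ss) v.+1 0 b.+1 i.+1 j.+1).
- apply: def_or; last by apply: def_or; apply: def_discV.
  apply: def_allV; apply: def_allV; apply: def_imp; last by dfn.
  by apply: def_and; [exact: (@def_E0V [:: SE, SE & ss] v.+2 1)|exact: (@def_E0V [:: SE, SE & ss] v.+2 0)].
- exact: def_sortedV.
Qed.

Lemma def_betweenV ss v b b' : isv ss SE v -> isv ss SN b -> isv ss SN b' ->
  Def tau rs3 ss (fun A r c => betweenV r (c v) (c b) (c b')).
Proof.
move=> hv hb hb'; apply: def_if; [exact: def_discV|exact: def_false|].
apply: def_if; [exact: def_discV|exact: def_true|].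
apply: def_exV; apply: def_and; first by dfn.
exact: (@def_WG tau T tau_adj wfT (SN :: ss) v.+1 0 b.+1 b'.+1 0).
Qed.

Lemma def_sizeV ss v b k : isv ss SE v -> isv ss SN b -> isv ss SN k ->
  Def tau rs3 ss (fun A r c => sizeV r (c v) (c b) == nv (c k)).
Proof.
move=> hv hb hk; apply: (def_cntN (P := fun A r c i => inV r (c v) (c b) i i)) => //.
exact: (@def_inV (SN :: ss) v.+1 b.+1 0 0).
Qed.

Lemma def_offV ss v b k : isv ss SE v -> isv ss SN b -> isv ss SN k ->
  Def tau rs3 ss (fun A r c => offV r (c v) (c b) == nv (c k)).
Proof.
move=> hv hb hk.
apply: (def_sum (f := fun A r c d => if d < nv (c b) then sizeV r (c v) (nval A d) else 0)) => //.
apply: (@def_eq _ _ _ (fun A r c => if nv (c 0) < nv (c b.+2) then sizeV r (c v.+2) (c 0) == nv (c 1)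
  else nv (c 1) == 0)).
  move=> A r c hA hc; rewrite nval_nv; last exact: (hc 0).
  by case: ifP => // _; rewrite eq_sym.
apply: def_if; first by apply: def_lt'.
  exact: (@def_sizeV [:: SN, SN & ss] v.+2 0 1).
by dfn.
Qed.

Lemma def_locV ss v b k i : isv ss SE v -> isv ss SN b -> isv ss SN k -> isv ss SN i ->
  Def tau rs3 ss (fun A r c => locV r (c v) (c b) (c k) (c i)).
Proof.
move=> hv hb hk hi; apply: def_and; first exact: def_inV.
apply: def_exV; apply: def_and; first exact: (@def_offV (SN :: ss) v.+1 b.+1 0).
by apply: def_add; rewrite /= (hk : isv (SN :: ss) SN k.+1) (hi : isv (SN :: ss) SN i.+1).
Qed.

Lemma def_canonV ss v i j : isv ss SE v -> isv ss SN i -> isv ss SN j ->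
  Def tau rs3 ss (fun A r c => canonV r (c v) (c i) (c j)).
Proof.
move=> hv hi hj; apply: def_exV; apply: def_exV; apply: def_exV; apply: def_exV.
apply: def_and; first exact: (@def_locV [:: SN, SN, SN, SN & ss] v.+4 3 2 i.+4).
apply: def_and; first exact: (@def_locV [:: SN, SN, SN, SN & ss] v.+4 1 0 j.+4).
apply: def_if; first by dfn.
  exact: (@def_inV [:: SN, SN, SN, SN & ss] v.+4 3 2 0).
exact: (@def_betweenV [:: SN, SN, SN, SN & ss] v.+4 3 1).
Qed.

(* The element v enters canonV only through the class r 0 [:: v; _]. *)
Lemma canonV_class A (r : rvs A) v v' i j : 0 < #|car A| -> wsort cd [:: v; i; j] ->
  (forall w, matches SE w -> r 0 [:: v; w] = r 0 [:: v'; w]) -> canonV r v i j = canonV r v' i j.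
Proof.
move=> hA hw E.
(* [r1 x] replaces the first argument of relation 0 by [x]. So the vertex argument can be kept
   fixed, and the change from [v] to [v'] becomes a change of a relation variable, to which
   [def_ext] applies. *)
pose r1 x k ts := if k is 0 then r 0 [:: x; nth nz ts 1] else r k ts.
have C x y : canonV (r1 x) y =2 canonV r x.
  have h1 : oneV (r1 x) y = oneV r x by [].
  have h2 b : discV (E0V (r1 x)) b y = discV (E0V r) b x by [].
  have h3 : inV (r1 x) y = inV r x.
    by do 3 apply: functional_extensionality => ?; rewrite /inV h1 !h2; case: ifP.
  have h4 : betweenV (r1 x) y = betweenV r x.
    by do 2 apply: functional_extensionality => ?; rewrite /betweenV !h2; case: ifP => // _; case: ifP.
  by move=> a b; rewrite /canonV /locV /offV /sizeV h3 h4.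
rewrite -(C v v) -(C v' v).
have hd := @def_canonV cd 0 1 2 isT isT isT.
apply: (def_ext (c := catc [:: v; i; j] (fun _ => nz)) hd hA).
  by move: hw; rewrite !wsort_cons => /and4P [h1 h2 h3 _] [|[|[|k]]].
move=> [|[|[|k]]] //= _ ts; case: ts => [|a [|b [|]]] //; rewrite !wsort_cons => /and3P [_ hb _].
exact: E.
Qed.
End CanonFormula.

(** * Primality of the quotient *)

Section PrimeQuotient.
Variables (C : structure -> Prop) (G : structure) (S : {set car G}) (e' : rel (car G)).
Variable X : car G -> 'I_#|car G|.+1 -> 'I_#|car G|.+1 -> bool.
Hypothesis closedC : closed_induced_subgraphs C.
Hypothesis CG : C G.
Hypothesis grG : is_graph G.
Hypothesis e'_sub : forall u w, u \in S -> e' u w -> w \in S.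
Hypothesis e'_blk : forall u w, u \in S -> w \in S -> e' u w = blk (adj G) S u w.
Hypothesis S2 : 1 < #|S|.
Local Notation L := (lo_struct S e' X).
Local Notation block := (block S e').
Let asym : symmetric (adj G). Proof. by case: grG. Qed.

Lemma bl_eq u w : u \in S -> w \in S -> (bl e' u == bl e' w) = blk (adj G) S u w.
Proof.
move=> hu hw; apply/eqP/idP => [E|h].
  have : w \in bl e' u by rewrite E inE e'_blk // blk_refl.
  by rewrite inE e'_blk.
apply/setP => z; rewrite !inE; apply/idP/idP => hz.
  have hz' := e'_sub hu hz; rewrite e'_blk //; rewrite e'_blk // in hz.
  by apply: (blk_trans asym S2) hz => //; rewrite blk_sym.
have hz' := e'_sub hw hz; rewrite e'_blk //; rewrite e'_blk // in hz.
by apply: (blk_trans asym S2) hz.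
Qed.

Lemma block_rep (b : block) : exists u, (u \in S) && (bl e' u == val b).
Proof. by have /imsetP [u hu ->] := valP b; exists u; rewrite hu eqxx. Qed.
Definition repB (b : block) := xchoose (block_rep b).
Lemma repB_in b : repB b \in S. Proof. by case/andP: (xchooseP (block_rep b)). Qed.
Lemma repB_bl b : bl e' (repB b) = val b. Proof. by case/andP: (xchooseP (block_rep b)) => _ /eqP. Qed.
Lemma blockE u : u \in S -> exists b : block, val b = bl e' u.
Proof. by move=> hu; have [b hb _] := to_blockE (inr ord0 : car L) hu; exists b. Qed.
Lemma repB_blk b b' : blk (adj G) S (repB b) (repB b') = (b == b').
Proof. by rewrite -bl_eq ?repB_in // !repB_bl. Qed.

Lemma loE_adj (b b' : block) u w : u \in S -> w \in S -> bl e' u = val b -> bl e' w = val b' ->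
  loE L (inl b) (inl b') = (b != b') && adj G u w.
Proof.
move=> hu hw hb hb'; rewrite /loE /= val_eqE; case: eqP => //= hne.
apply/existsP/idP => [[u' /andP [hu' /existsP [w' /andP [hw' /and3P [h1 h2 h3]]]]]|h].
  rewrite -(@blk_uniform _ _ asym S S2 u' u w' w) // -bl_eq //.
  - by rewrite (eqP h1) hb.
  - by rewrite (eqP h2) hb'.
  - by rewrite (eqP h1) (eqP h2) val_eqE; apply/eqP.
by exists u; rewrite hu; apply/existsP; exists w; rewrite hw hb hb' !eqxx.
Qed.
Lemma loE_rep b b' : loE L (inl b) (inl b') = (b != b') && adj G (repB b) (repB b').
Proof. by apply: loE_adj; rewrite ?repB_in ?repB_bl. Qed.

Lemma lo_colored : is_LO_colored L.
Proof.
have [u hu] : exists u, u \in S by apply/card_gt0P; exact: ltnW.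
have [b _] := blockE hu.
split; first by case.
split; first by exists (inl b).
split; first by exists (inr ord0).
split; first by case=> x [y|y]; rewrite /loE /loV //= => _.
split; first by case=> x [y|y]; rewrite ?loE_rep 1?eq_sym 1?asym.
split; first by case=> x //; rewrite loE_rep eqxx.
split; last by case=> x [y|y] [z|z].
split.
- by case=> x [y|y].
- by case=> x //= _; apply: leqnn.
- by case=> x [y|y] //; rewrite /loLe /= => h1 h2; congr inr; apply: val_inj; apply/eqP; rewrite eqn_leq h1.
- by case=> x [y|y] [z|z] //; apply: leq_trans.
- by case=> x [y|y] // _ _; apply/orP; apply: leq_total.
Qed.

Lemma loV_card : #|loV L| = #|blocks S e'|.
Proof.
rewrite (card_sum_pred (loV L)) big1 // addn0 card_sig; exact: eq_card.
Qed.

Lemma rkM_colour i : rkM (A := L) (inr i) = i.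
Proof.
rewrite /rkM /rank (card_sum_pred (X := block)) eq_card0 // add0n -[RHS](@sum_lt #|car G|.+1 i) ?(ltnW (ltn_ord i)) //.
by apply: eq_bigr => j _; rewrite /= -ltnNge.
Qed.

Hypothesis nd : forall c, ~~ disc (adj G) S c.

Definition repU (x : car (under_graph L)) : car G :=
  if val x is inl b then repB b else xchoose (card_gt0P (ltnW S2)).
Lemma underP (x : car (under_graph L)) : exists b : block, val x = inl b.
Proof. by case: x => [[b|b] h] //; exists b. Qed.
Lemma repU_in x : repU x \in S.
Proof. by rewrite /repU; have [b ->] := underP x; apply: repB_in. Qed.
Lemma repU_blk x y : blk (adj G) S (repU x) (repU y) = (x == y).
Proof.
rewrite /repU -val_eqE; have [b ->] := underP x; have [b' ->] := underP y.
by rewrite repB_blk; apply/eqP/eqP => [->|[]].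
Qed.
Lemma under_onto u : u \in S -> exists x, blk (adj G) S u (repU x).
Proof.
move=> hu; have [b hb] := blockE hu.
exists (exist _ (inl b : car L) isT); rewrite /repU /= -bl_eq ?repB_in //.
by rewrite repB_bl hb.
Qed.
Lemma under_adj x y : adj (under_graph L) x y = adj G (repU x) (repU y).
Proof.
have -> : adj (under_graph L) x y = loE L (val x) (val y) by [].
case: (altP (x =P y)) => [->|hne].
  have [_ _ h] := grG; rewrite (negPf (h _)).
  by have [b ->] := underP y; rewrite loE_rep eqxx.
have : ~~ (val x == val y) by rewrite val_eqE.
rewrite /repU; have [b ->] := underP x; have [b' ->] := underP y.
by rewrite loE_rep => h; have -> : b != b' by apply: contraNneq h => ->.
Qed.

(** Choosing a vertex in each block embeds the quotient into the graph as an induced subgraph. A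
    module of the quotient lifts to a module of [S], and adjacent and non-adjacent blocks are
    combined to find four of them. *)
Lemma lo_prime : C_prim_star C L.
Proof.
have irr x : ~~ adj G x x by case: grG.
have [u0 hu0] : exists u, u \in S by apply/card_gt0P; exact: ltnW.
have [x0 _] := under_onto hu0.
have gU : is_graph (under_graph L).
  split; first by apply/card_gt0P; exists x0.
    by move=> x y; rewrite !under_adj asym.
  by move=> x; rewrite under_adj.
split; first exact: lo_colored.
- apply: closedC CG gU _; exists repU; split; last exact: under_adj.
  by move=> x y E; apply/eqP; rewrite -repU_blk E blk_refl // repU_in.
- move=> M [/set0Pn [m hm] hM].
  (* The union of the blocks in [M] is a module of [S]: by [prime_quotient] it is either all of [S]
     or contained in one block. *)
  pose Y := [set u in S | [exists x in M, blk (adj G) S u (repU x)]].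
  have hY : module_in (adj G) S Y.
    split; first by apply/subsetP => u; rewrite inE => /andP [].
    move=> z u u' hz; rewrite !inE hz /= => /existsPn hn /andP [hu /existsP [x /andP [hx h1]]]
      /andP [hu' /existsP [x' /andP [hx' h2]]].
    have [y hy] := under_onto hz.
    have hyM : y \notin M by apply/negP => h; have := hn y; rewrite h hy.
    have U t t' : t \in S -> t' \in M -> blk (adj G) S t (repU t') -> adj G z t = adj (under_graph L) y t'.
      move=> ht ht' h3; rewrite under_adj; apply: (blk_uniform asym S2) => //; rewrite ?repU_in //.
      apply/negP => h4; have := hn t'; rewrite ht' /=; case/negP.
      by apply: (blk_trans asym S2) h4 h3; rewrite ?repU_in.
    rewrite (U u x) // (U u' x') //.
    by have [h|h] := hM _ hyM; rewrite ?h //; rewrite (negPf (h _ hx)) (negPf (h _ hx')).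
  have hmY x : x \in M -> repU x \in Y.
    by move=> hx; rewrite inE repU_in; apply/existsP; exists x; rewrite hx blk_refl ?repU_in.
  have Yne : exists x, x \in Y by exists (repU m); apply: hmY.
  have [E|h] := prime_quotient S2 nd hY Yne.
    left; apply/setP => x; rewrite inE; have : repU x \in Y by rewrite E repU_in.
    by rewrite inE => /andP [_ /existsP [y /andP [hy]]]; rewrite repU_blk => /eqP ->.
  right; exists m; apply/setP => x; rewrite inE; apply/idP/eqP => [hx|-> //].
  by apply/eqP; rewrite -repU_blk; apply: h; apply: hmY.
pose u := repU x0; have hu : u \in S by apply: repU_in.
have nb c t : t \in S -> exists w, [/\ w \in S, ~~ blk (adj G) S t w & adj G t w = c].
  exact: (prime_neighbour asym S2 c nd).
have far t w c : t \in S -> w \in S -> ~~ blk (adj G) S t w -> adj G t w = c ->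
  forall w', w' \in S -> blk (adj G) S w w' -> adj G t w' = c.
  move=> ht hw hn <- w' hw' h; apply/esym; apply: (blk_uniform asym S2) => //; exact: blk_refl.
have [w0 [h0 n0 a0]] := nb false u hu.
have [w1 [h1 n1 a1]] := nb true u hu.
have n01 : ~~ blk (adj G) S w0 w1.
  by apply/negP => h; have := far _ _ _ hu h0 n0 a0 _ h1 h; rewrite a1.
(* Take [z] adjacent to [w0] and outside its block; it is not in the block of [u], which is not
   adjacent to [w0]. If it falls into the block of [w1], then [w0] and [w1] are adjacent, and a
   vertex outside the block of [w1] that is not adjacent to [w1] lies in a fourth block. *)
have [z [hz nz az]] : exists z, [/\ z \in S, ~~ blk (adj G) S u z & ~~ blk (adj G) S w0 z && ~~ blk (adj G) S w1 z].
  have [z [hz nz az]] := nb true w0 h0.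
  have nuz : ~~ blk (adj G) S u z.
    apply/negP => h; have := far _ _ _ h0 hz nz az _ hu.
    by rewrite blk_sym // => /(_ h); rewrite asym a0.
  case: (boolP (blk (adj G) S w1 z)) => h; last by exists z; rewrite nz h.
  have a01 : adj G w0 w1 by apply: (far _ _ _ h0 hz nz az _ h1); rewrite blk_sym.
  have [y [hy ny ay]] := nb false w1 h1.
  exists y; split=> //; last rewrite ny andbT.
    apply/negP => h'; have := far _ _ _ h1 hy ny ay _ hu.
    by rewrite blk_sym // => /(_ h'); rewrite asym a1.
  apply/negP => h'; have := far _ _ _ h1 hy ny ay _ h0.
  by rewrite blk_sym // => /(_ h'); rewrite asym a01.
have [x1 e1] := under_onto h0; have [x2 e2] := under_onto h1; have [x3 e3] := under_onto hz.
have D t t' x x' : t \in S -> t' \in S -> ~~ blk (adj G) S t t' -> blk (adj G) S t (repU x) -> 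
   blk (adj G) S t' (repU x') -> x != x'.
  move=> ht ht' hn h h'; apply: contraNneq hn => E; rewrite -E in h'.
  by apply: (blk_trans asym S2) h _ => //; rewrite ?repU_in // blk_sym // repU_in.
have hs : uniq [:: x0; x1; x2; x3].
  case/andP: az => n0z n1z.
  have e0 : blk (adj G) S u (repU x0) by apply: blk_refl.
  rewrite /= !inE !negb_or (D _ _ _ _ hu h0 n0 e0 e1) (D _ _ _ _ hu h1 n1 e0 e2) (D _ _ _ _ hu hz nz e0 e3).
  by rewrite (D _ _ _ _ h0 h1 n01 e1 e2) (D _ _ _ _ h0 hz n0z e1 e3) (D _ _ _ _ h1 hz n1z e2 e3).
by rewrite -[4]/(size [:: x0; x1; x2; x3]) -(card_uniqP hs) max_card.
Qed.
End PrimeQuotient.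

(** Ties are allowed, so positions inside a group of tied elements depend on the sort. The last
    clause holds for every such choice and is the one that counting can express. *)
Lemma sort_count (T : finType) (D : {set T}) (lt : rel T) (x0 : T) :
  (forall x, ~~ lt x x) -> (forall x y, lt x y -> ~~ lt y x) -> (forall x y z, ~~ lt y x -> ~~ lt z y -> ~~ lt z x) ->
  exists f : nat -> T, [/\ forall b, b < #|D| -> f b \in D,
    forall b b', b < #|D| -> b' < #|D| -> f b = f b' -> b = b',
    forall x, x \in D -> exists2 b, b < #|D| & f b = x &
    forall b, b < #|D| -> #|[set x in D | lt x (f b)]| <= b < #|[set x in D | ~~ lt (f b) x]|].
Proof.
move=> irr asym tr; pose le x y := ~~ lt y x.
have le_tr : transitive le by move=> y x z; apply: tr.
have le_tot : total le.
  by move=> x y; rewrite /le; case: (boolP (lt y x)) => //= /asym.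
pose s := path.sort le (enum D).
have hs : size s = #|D| by rewrite size_sort cardE.
have us : uniq s by rewrite sort_uniq enum_uniq.
have ms x : (x \in s) = (x \in D) by rewrite mem_sort mem_enum.
have ss : sorted le s := path.sort_sorted le_tot _.
pose f := nth x0 s.
have fle i j : i <= j -> j < #|D| -> le (f i) (f j).
  move=> hij hj; have hi := leq_ltn_trans hij hj.
  by apply: (sorted_leq_nth le_tr) => //; rewrite ?inE ?hs // => x; apply: irr.
exists f; split.
- by move=> b hb; rewrite -ms mem_nth // hs.
- by move=> b b' hb hb' /eqP; rewrite nth_uniq ?hs // => /eqP.
- by move=> x; rewrite -ms => hx; exists (index x s); [rewrite -hs index_mem|exact: nth_index].
move=> b hb; apply/andP; split.
  apply: (@leq_trans #|[set f i | i : 'I_b]|); last by rewrite -[X in _ <= X]card_ord leq_imset_card.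
  apply: subset_leq_card; apply/subsetP => x; rewrite inE -ms => /andP [hx hlt].
  have hj : index x s < #|D| by rewrite -hs index_mem.
  case: (ltnP (index x s) b) => h; first by apply/imsetP; exists (Ordinal h) => //=; rewrite /f nth_index.
  by have := fle _ _ h hj; rewrite /f nth_index // /le hlt.
apply: (@leq_trans #|[set f i | i : 'I_b.+1]|).
  rewrite card_imset ?card_ord // => i j /eqP; rewrite nth_uniq ?hs //; first by move/eqP/val_inj.
    exact: leq_trans (ltn_ord i) hb.
  exact: leq_trans (ltn_ord j) hb.
apply: subset_leq_card; apply/subsetP => x /imsetP [i _ ->]; rewrite inE -ms mem_nth ?hs; last first.
  exact: leq_trans (ltn_ord i) hb.
by apply: fle => //; rewrite -ltnS.
Qed.

Lemma precedes_ext A us (R R' Q Q' : seq (value A) -> bool) :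
  (forall s, wsort us s -> R s = Q s) -> (forall s, wsort us s -> R' s = Q' s) ->
  precedes us R R' = precedes us Q Q'.
Proof.
move=> h h'; apply/exSP/exSP => [] [s hs /and3P [h1 h2 /allSP h3]]; exists s => //.
  rewrite -h // h1 -h' // h2; apply/allSP => t ht; rewrite -h // -h' //; exact: h3.
rewrite h // h1 h' // h2; apply/allSP => t ht; rewrite h // h' //; exact: h3.
Qed.

(** * Correctness of one step *)

Section CanonStep.
Variables (C : structure -> Prop) (T : transduction) (G : structure) (r : rvs G) (d : nat).
Hypothesis wfT : wf_transduction (lo_voc ++ [:: 2]) T.
Hypothesis canT : forall L, C_prim_star C L -> canonizes lo_voc T L.
Hypothesis closedC : closed_induced_subgraphs C.
Hypothesis CG : C G.
Hypothesis grG : is_graph G.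
Hypothesis r0E : forall u w, r 0 [:: inl u; inl w] = level d u w.
Hypothesis r1E : forall u w, r 1 [:: inl u; inl w] = level d.+1 u w.
Definition cls e (u : car G) := [set w | level e u w].
Hypothesis r2_canon : forall u, isCanon (adj G) (cls d.+1 u) (fun i j => r 2 [:: inl u; nval G i; nval G j]).
Hypothesis r2_class : forall u w s, level d.+1 u w -> wsort [:: SN; SN] s -> r 2 (inl u :: s) = r 2 (inl w :: s).
Local Notation n := #|car G|.

Lemma n_gt0 : 0 < n. Proof. by case: grG. Qed.
Lemma lev_refl e u : @level G e u u. Proof. by have [h _ _] := level_equiv grG e. Qed.
Lemma lev_sym e u w : @level G e u w = level e w u. Proof. by have [_ h _] := level_equiv grG e. Qed.
Lemma lev_trans e u w z : @level G e u w -> level e w z -> level e u z.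
Proof. by have [_ _ h] := level_equiv grG e; apply: h. Qed.
Lemma lev_down u w : @level G d.+1 u w -> level d u w. Proof. by case/andP. Qed.
Lemma e1E u w : e1 r u w = level d.+1 u w. Proof. exact: r1E. Qed.
Lemma bl_cls u : bl (e1 r) u = cls d.+1 u. Proof. by apply/setP => w; rewrite !inE e1E. Qed.
Lemma cls_eq u w : (cls d.+1 u == cls d.+1 w) = level d.+1 u w.
Proof.
apply/eqP/idP => [/setP /(_ w)|h]; first by rewrite !inE lev_refl.
apply/setP => z; rewrite !inE; apply/idP/idP => h'; last exact: lev_trans h h'.
by apply: lev_trans h'; rewrite lev_sym.
Qed.

Variable v : car G.
Local Notation S := (cls d v).
Local Notation rv := (inl v : value G).
Lemma SsetE : Sset r (fun _ => rv) = S. Proof. by apply/setP => w; rewrite !inE r0E. Qed.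
Local Notation bks := (blocks S (e1 r)).
Lemma inblocks u : u \in S -> cls d.+1 u \in bks.
Proof. by move=> hu; rewrite -bl_cls; apply: imset_f. Qed.
Lemma blocksP B : B \in bks -> exists2 u, u \in S & B = cls d.+1 u.
Proof. by case/imsetP => u hu ->; exists u; rewrite // bl_cls. Qed.
Lemma S_cls u w : u \in S -> w \in cls d.+1 u -> w \in S.
Proof. by rewrite !inE => h /lev_down; apply: lev_trans. Qed.
Lemma level_blk u w : u \in S -> w \in S -> level d.+1 u w = blk (adj G) S u w.
Proof.
rewrite !inE => hu hw /=; have -> : level d u w by apply: lev_trans hw; rewrite lev_sym.
congr (blk _ _ u w); apply/setP => z; rewrite !inE; apply/idP/idP => h; first exact: lev_trans hu h.
by apply: lev_trans h; rewrite lev_sym.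
Qed.
Lemma discVS c : discV (E0V r) c rv = disc (adj G) S c.
Proof. exact: (discVE _ _ r0E). Qed.
Lemma oneVE : oneV r rv = [forall u in S, forall w in S, level d.+1 u w].
Proof.
apply/allVP/forallP => [h u|h [u|//] _].
  apply/implyP => hu; apply/forallP => w; apply/implyP => hw.
  have /allVP /(_ (inl w) isT) := h (inl u) isT.
  by rewrite !r0E r1E; rewrite !inE in hu hw; rewrite hu hw.
apply/allVP => -[w|//] _; apply/implyP; rewrite !r0E r1E => /andP [hu hw].
have := h u; rewrite inE hu => /forallP /(_ w); by rewrite inE hw.
Qed.

Local Notation Y := (fun b i j => inV T r rv (nval G b) (nval G i) (nval G j)).
Local Notation Q := (fun b b' => betweenV T r rv (nval G b) (nval G b')).
Local Notation R := (fun i j => canonV T r rv (nval G i) (nval G j)).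

Lemma blocks_gt0 : 0 < #|bks|.
Proof. by apply/card_gt0P; exists (cls d.+1 v); apply: inblocks; rewrite inE lev_refl. Qed.

Lemma offVE b : b <= n -> offV T r rv (nval G b) = off (car G) Y b.
Proof. by move=> hb; rewrite /offV nv_nval. Qed.
Lemma locVE b k i : b <= n -> k <= n -> i <= n ->
  locV T r rv (nval G b) (nval G k) (nval G i) = locates (car G) Y b k i.
Proof.
move=> hb hk hi; rewrite /locV /locates offVE //; congr andb.
apply/exNP/eqP => [[o ho]|E]; first by rewrite !nv_nval // => /andP [/eqP -> /eqP].
have ho : off (car G) Y b <= n by rewrite (leq_trans _ hi) // -E leq_addr.
by exists (off (car G) Y b); rewrite // !nv_nval // eqxx E eqxx.
Qed.
Lemma canonVE i j : i <= n -> j <= n -> R i j <->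
  exists b k b' k', [/\ [/\ b <= n, k <= n, b' <= n & k' <= n],
    locates (car G) Y b k i, locates (car G) Y b' k' j & if b == b' then Y b k k' else Q b b'].
Proof.
move=> hi hj; split.
  move=> /exNP [b hb /exNP [k hk /exNP [b' hb' /exNP [k' hk' /and3P [h1 h2 h3]]]]].
  by exists b, k, b', k'; rewrite -!locVE // h1 h2; move: h3; rewrite !nv_nval.
move=> [b [k [b' [k' [[hb hk hb' hk'] h1 h2 h3]]]]].
apply/exNP; exists b => //; apply/exNP; exists k => //; apply/exNP; exists b' => //; apply/exNP; exists k' => //.
by rewrite !locVE // h1 h2 !nv_nval.
Qed.

(** The common part of both cases: it remains to give an enumeration of the blocks that matches
    [inV] and [betweenV]. *)
Lemma step_concat (B : nat -> {set car G}) :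
  (forall b, b < #|bks| -> B b \in bks) ->
  (forall b b', b < #|bks| -> b' < #|bks| -> B b = B b' -> b = b') ->
  (forall X, X \in bks -> exists2 b, b < #|bks| & B b = X) ->
  (forall b i j u, b < #|bks| -> i <= n -> j <= n -> u \in S -> B b = cls d.+1 u ->
     Y b i j = r 2 [:: inl u; nval G i; nval G j]) ->
  (forall b i, b <= n -> #|bks| <= b -> i <= n -> Y b i i = false) ->
  (forall b b' u u', b < #|bks| -> b' < #|bks| -> b != b' -> u \in S -> u' \in S ->
     B b = cls d.+1 u -> B b' = cls d.+1 u' -> Q b b' = adj G u u') ->
  isCanon (adj G) S R.
Proof.
move=> hB inj onto hY hY0 hQ.
have rep x b : b < #|bks| -> x \in B b -> x \in S /\ B b = cls d.+1 x.
  move=> hb; have [u hu E] := blocksP (hB b hb); rewrite E => hx; split; first exact: S_cls hx.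
  by apply/eqP; rewrite cls_eq; rewrite inE in hx.
apply: (@concat_canon _ (adj G) S #|bks| B Y Q R); first exact: blocks_gt0.
- exact: card_blocks.
- by move=> b x hb /(rep _ _ hb) [].
- move=> b b' x hb hb' /(rep _ _ hb) [_ E] /(rep _ _ hb') [_ E'].
  by apply: inj; rewrite // E E'.
- move=> x hx; have [b hb E] := onto _ (inblocks hx).
  by exists b; rewrite // E inE lev_refl.
- move=> b hb; have [u hu E] := blocksP (hB b hb).
  have [h [h1 h2 h3]] := r2_canon u; rewrite E; exists h; split=> // i j hi hj.
  by rewrite (hY b i j u) // h3.
- exact: hY0.
- move=> b b' x x' hb hb' hne /(rep _ _ hb) [hx E] /(rep _ _ hb') [hx' E'].
  exact: hQ E E'.
- exact: canonVE.
Qed.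

Section SortedCase.
Definition repc (B : {set car G}) := odflt v [pick u in B].
Lemma repc_level u : level d.+1 u (repc (cls d.+1 u)).
Proof.
rewrite /repc; case: pickP => [w|/(_ u)] /=; first by rewrite inE.
by rewrite !inE lev_refl.
Qed.
Lemma canlt_class u u' w w' : level d.+1 u u' -> level d.+1 w w' ->
  canlt r (inl u) (inl w) = canlt r (inl u') (inl w').
Proof. by move=> h h'; apply: precedes_ext => s hs; apply: r2_class. Qed.
Definition ltS (B B' : {set car G}) := canlt r (inl (repc B)) (inl (repc B')).
Lemma ltSE u w : ltS (cls d.+1 u) (cls d.+1 w) = canlt r (inl u) (inl w).
Proof. by apply/esym/canlt_class; apply: repc_level. Qed.
Lemma ltS_irr B : ~~ ltS B B. Proof. exact: (@precedes_irr G 2). Qed.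
Lemma ltS_trans B B' B'' : ltS B B' -> ltS B' B'' -> ltS B B''.
Proof. exact: (@precedes_trans G 2). Qed.
Lemma ltS_asym B B' : ltS B B' -> ~~ ltS B' B.
Proof. by move=> h; apply/negP => h'; have := ltS_irr B; rewrite (ltS_trans h h'). Qed.
(** If neither of two canons precedes the other, they agree on all well-sorted pairs and are
    interchangeable in every comparison. *)
Lemma ltS_ntrans B B' B'' : ~~ ltS B' B -> ~~ ltS B'' B' -> ~~ ltS B'' B.
Proof.
move=> h h'; apply/negP => h3.
have [h1|h1|h1] := @precedes_total G 2 (fun s => r 2 (inl (repc B'') :: s)) (fun s => r 2 (inl (repc B') :: s)).
- by case/negP: h'.
- by case/negP: h; apply: ltS_trans h3.
case/negP: h; suff -> : ltS B' B = ltS B'' B by [].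
by apply: precedes_ext => // s hs; exact/esym/h1.
Qed.

Local Notation lowS X := #|[set B in bks | ltS B X]|.
Local Notation highS X := #|[set B in bks | ~~ ltS X B]|.
Lemma cntltE u : cntlt r rv (inl u) = lowS (cls d.+1 u).
Proof.
rewrite /cntlt -SsetE; apply: (@ccntVE G r (fun _ => rv)) => w _.
by rewrite bl_cls ltSE.
Qed.
Lemma cntleE u : cntle r rv (inl u) = highS (cls d.+1 u).
Proof.
rewrite /cntle -SsetE; apply: (@ccntVE G r (fun _ => rv) _ (fun B => ~~ ltS (cls d.+1 u) B)) => w _.
by rewrite bl_cls ltSE.
Qed.
Lemma sub_bks (q : pred {set car G}) : #|[set B in bks | q B]| <= #|bks|.
Proof. by apply: subset_leq_card; apply/subsetP => B; rewrite inE => /andP []. Qed.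
Lemma bks_n : #|bks| <= n. Proof. exact: card_blocks. Qed.

Lemma sortedVE b i j : b <= n -> sortedV r rv (nval G b) i j <->
  exists u, [/\ u \in S, lowS (cls d.+1 u) <= b < highS (cls d.+1 u) & r 2 [:: inl u; i; j]].
Proof.
move=> hb; split=> [/exVP [[u|//] _ /and4P [h1 /exNP [k hk h2] /exNP [k' hk' h3] h4]]|[u [h1 /andP [h2 h3] h4]]].
  exists u; split=> //; first by rewrite inE -r0E.
  move: h2 h3; rewrite !nv_nval // cntltE cntleE => /andP [/eqP -> ->] /andP [/eqP -> ->] //.
apply/exVP; exists (inl u) => //; apply/and4P; split=> //; first by rewrite r0E; rewrite inE in h1.
  apply/exNP; exists (lowS (cls d.+1 u)); first exact: leq_trans (sub_bks _) bks_n.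
  by rewrite cntltE !nv_nval ?eqxx // (leq_trans (sub_bks _) bks_n).
apply/exNP; exists (highS (cls d.+1 u)); first exact: leq_trans (sub_bks _) bks_n.
by rewrite cntleE !nv_nval ?eqxx // (leq_trans (sub_bks _) bks_n).
Qed.

Lemma high_low B B' : ltS B B' -> highS B <= lowS B'.
Proof.
move=> h; apply: subset_leq_card; apply/subsetP => B''; rewrite !inE => /andP [-> hB] /=.
by apply: contraLR h => h; apply: ltS_ntrans h hB.
Qed.

Lemma step_sorted : [|| oneV r rv, discV (E0V r) true rv | discV (E0V r) false rv] -> isCanon (adj G) S R.
Proof.
move=> hc; have [f [f1 f2 f3 f4]] := @sort_count _ bks ltS set0 ltS_irr ltS_asym ltS_ntrans.
have hin b i j : inV T r rv (nval G b) i j = sortedV r rv (nval G b) i j by rewrite /inV hc.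
apply: (@step_concat f) => //.
- move=> b i j u hb hi hj hu E; rewrite hin.
  have hbn : b <= n by apply: leq_trans (ltnW hb) bks_n.
  have := f4 _ hb; rewrite E => /andP [l1 l2].
  apply/idP/idP => [/(sortedVE _ _ hbn) [w [hw /andP [h1 h2] h3]]|h]; last first.
    by apply/(sortedVE _ _ hbn); exists u; rewrite l1.
  (* The formula accepted some [w] at position [b], where the enumeration has the block of [u].
     Overlapping intervals leave only equal canons. *)
  have [h|h|h] := @precedes_total G 2 (fun s => r 2 (inl u :: s)) (fun s => r 2 (inl w :: s)).
  - rewrite -/(canlt r (inl u) (inl w)) -ltSE in h.
    by have := leq_trans (leq_trans l2 (high_low h)) h1; rewrite ltnn.
  - rewrite -/(canlt r (inl w) (inl u)) -ltSE in h.
    by have := leq_trans (leq_trans h2 (high_low h)) l1; rewrite ltnn.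
  - by rewrite (h [:: nval G i; nval G j]).
- move=> b i hb hk hi; rewrite hin; apply/negbTE/negP => /(sortedVE _ _ hb) [u [_ /andP [_ h] _]].
  by have := leq_trans h (leq_trans (sub_bks _) hk); rewrite ltnn.
move=> b b' u u' hb hb' hne hu hu' E E'.
have nl : ~~ level d.+1 u u' by rewrite -cls_eq -E -E'; apply: contra hne => /eqP /f2 ->.
rewrite /betweenV !discVS; case: ifP => hd.
  by rewrite (blk_disc hd hu hu') // -level_blk.
case: ifP => hd'; first by rewrite (blk_codisc hd hd' hu hu') // -level_blk.
move: hc; rewrite !discVS hd hd' !orbF oneVE => /forallP /(_ u) /implyP /(_ hu) /forallP /(_ u').
by rewrite hu' (negPf nl).
Qed.
End SortedCase.

Section PrimeCase.
Hypothesis nd : forall c, ~~ disc (adj G) S c.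
Hypothesis S2 : 1 < #|S|.
Local Notation S0 := (Sset r (fun _ => rv)).
Local Notation L := (LO r (fun _ => rv)).
Lemma S0_sub u w : u \in S0 -> e1 r u w -> w \in S0.
Proof. by rewrite SsetE e1E !inE => hu /lev_down; apply: lev_trans. Qed.
Lemma S0_blk u w : u \in S0 -> w \in S0 -> e1 r u w = blk (adj G) S0 u w.
Proof. by rewrite SsetE e1E; apply: level_blk. Qed.
Lemma S0_card : 1 < #|S0|. Proof. by rewrite SsetE. Qed.
Lemma L_prime : C_prim_star C L.
Proof. by apply: (lo_prime _ closedC CG grG S0_sub S0_blk S0_card) => c; rewrite SsetE. Qed.

Lemma L_large : n <= #|car L|. Proof. by rewrite card_lo addnS ltnW // ltnS leq_addl. Qed.

(** The enumeration of [W_numbering], expressed with numbers of the graph. They are not truncated in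
    the quotient structure, whose colours alone are n + 1 elements. *)
Lemma WG_numbering : exists fV : nat -> car L, 
  [/\ forall b, b < #|bks| -> exists2 u, u \in S & exists2 b' : block S0 (e1 r), fV b = inl b' & val b' = cls d.+1 u,
      forall b b', b < #|bks| -> b' < #|bks| -> fV b = fV b' -> b = b',
      forall B, B \in bks -> exists2 b, b < #|bks| & exists2 b' : block S0 (e1 r), fV b = inl b' & val b' = B,
      forall f b b' j, f <= n -> b <= n -> b' <= n -> j <= n -> f = 0 -> 
        WG T r rv (nval G f) (nval G b) (nval G b') (nval G j) =
        [&& b < #|bks|, b' < #|bks| & loE L (fV b) (fV b')] &
      forall f b i j, f <= n -> b <= n -> i <= n -> j <= n -> f != 0 -> 
        WG T r rv (nval G f) (nval G b) (nval G i) (nval G j) =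
        (b < #|bks|) && loL L (fV b) (inr (inord i)) (inr (inord j))].
Proof.
have LP := L_prime; have [loL_ _ _ _] := LP.
have [fV [h1 h2 h3 h4]] := W_numbering wfT loL_ (canT LP).
have Ek : #|loV L| = #|bks| by rewrite loV_card SsetE.
rewrite Ek in h1 h2 h3 h4; exists fV.
have hV x : loV L x -> exists b' : block S0 (e1 r), x = inl b' by case: x => // b' _; exists b'.
have hWG f b x y : f <= n -> b <= n -> x <= n -> y <= n ->
  WG T r rv (nval G f) (nval G b) (nval G x) (nval G y) =
  W T (A := L) [:: inr (inord f); inr (inord b); inr (inord x); inr (inord y)].
  by move=> *; rewrite /WG /= /LOnum !nv_nval.
have hi x : x <= n -> x < #|car L|.+1 by move=> hx; rewrite ltnS (leq_trans hx L_large).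
split=> //.
- move=> b hb; have [b' E] := hV _ (h1 _ hb).
  have hb' : val b' \in bks by rewrite -SsetE; apply: (valP b').
  have [u hu Eu] := blocksP hb'.
  by exists u => //; exists b'.
- move=> B hB'; have hB : B \in blocks S0 (e1 r) by rewrite SsetE.
  have [b hb E] := h3 (inl (exist _ B hB)) isT.
  by exists b => //; exists (exist _ B hB).
- by move=> f b x y hf hb hx hy E; rewrite hWG // h4 !inordK ?hi // E eqxx.
move=> f b x y hf hb hx hy E; rewrite hWG // h4 !inordK ?hi // (negPf E); congr andb.
apply/existsP/idP => [[m /existsP [m' /and5P [hm /eqP Em hm' /eqP Em' h]]]|h].
  case: m m' hm Em hm' Em' h => [//|m] [//|m'] _ Em _ Em'.
  rewrite /= in Em Em'.
  by rewrite rkM_colour in Em; rewrite rkM_colour in Em'; rewrite -Em -Em' !inord_val.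
exists (inr (inord x)); apply/existsP; exists (inr (inord y)).
by rewrite !rkM_colour !inordK ?ltnS // !eqxx.
Qed.

Lemma step_prime : oneV r rv = false -> isCanon (adj G) S R.
Proof.
move=> h1; have [fV [g1 g2 g3 g4 g5]] := WG_numbering.
have hd c : discV (E0V r) c rv = false by rewrite discVS (negPf (nd c)).
pose B b : {set car G} := if fV b is inl b' then val b' else set0.
have YE b i j : b <= n -> i <= n -> j <= n -> Y b i j =
   (b < #|bks|) && loL L (fV b) (inr (inord i)) (inr (inord j)).
  move=> hb hi hj; rewrite /inV h1 !hd /=; apply/exNP/idP => [[f hf /andP []]|h].
    by rewrite nv_nval // => hf0; rewrite g5.
  by exists 1; rewrite ?nv_nval ?n_gt0 // g5 ?n_gt0.
apply: (@step_concat B).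
- by move=> b hb; rewrite /B; have [u hu [b' -> ->]] := g1 _ hb; apply: inblocks.
- move=> b b' hb hb'; rewrite /B; have [u hu [c E _]] := g1 _ hb; have [u' hu' [c' E' _]] := g1 _ hb'.
  rewrite E E' => /val_inj Ec; apply: g2 => //; by rewrite E E' Ec.
- by move=> X hX; have [b hb [c E Ec]] := g3 _ hX; exists b; rewrite // /B E.
- move=> b i j u hb hi hj hu; rewrite /B YE ?(leq_trans (ltnW hb) bks_n) // hb.
  have [_ _ [c E _]] := g1 _ hb; rewrite E => Ec; rewrite /loL /= Ec.
  (* The colour of a block collects the relations carried by all its vertices, and these coincide by
     [r2_class]. *)
  apply/existsP/idP => [[w /andP [hw /andP [/eqP E1 E2]]]|h].
    move/eqP: E1; rewrite bl_cls cls_eq => h.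
    by rewrite -(r2_class (s := [:: nval G i; nval G j]) h).
  by exists u; rewrite SsetE hu bl_cls eqxx.
- by move=> b i hb hk hi; rewrite YE // ltnNge hk.
move=> b b' u u' hb hb' hne hu hu'; rewrite /B; have [_ _ [c E _]] := g1 _ hb; have [_ _ [c' E' _]] := g1 _ hb'.
rewrite E E' => Ec Ec'.
have hbn : b <= n by rewrite (leq_trans (ltnW hb) bks_n).
have hbn' : b' <= n by rewrite (leq_trans (ltnW hb') bks_n).
have -> : Q b b' = loE L (fV b) (fV b').
  rewrite /betweenV !hd; apply/exNP/idP => [[f hf /andP []]|h].
    by rewrite nv_nval // => /eqP f0; rewrite g4 // => /and3P [].
  by exists 0; rewrite ?nv_nval // g4 // hb hb'.
rewrite -SsetE in hu hu'.
rewrite E E' (loE_adj (Xr r) grG S0_sub S0_blk S0_card hu hu') ?bl_cls //.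
suff -> : c != c' by [].
by apply: contra hne => /eqP Ecc; apply/eqP; apply: g2; rewrite // E E' Ecc.
Qed.
End PrimeCase.

Theorem canon_step : isCanon (adj G) S R.
Proof.
case: (boolP [|| oneV r rv, discV (E0V r) true rv | discV (E0V r) false rv]); first exact: step_sorted.
rewrite !negb_or !discVS => /and3P [h1 h2 h3].
apply: step_prime; last exact: negbTE.
  by case.
(* Two vertices in different blocks show that the class is not a singleton. *)
move: h1; rewrite oneVE => /forallPn [u]; rewrite negb_imply => /andP [hu /forallPn [w]].
rewrite negb_imply => /andP [hw h].
apply: (@leq_trans #|[set u; w]|); last first.
  by apply: subset_leq_card; apply/subsetP => z; rewrite in_set2 => /orP [/eqP ->|/eqP ->].
by rewrite cards2; case: eqP h => // ->; rewrite lev_refl.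
Qed.
End CanonStep.

(** * Iteration over the levels *)

Lemma assign_congr A (e e' : env A) vs t w : lookup e w = lookup e' w ->
  lookup (assign e vs t) w = lookup (assign e' vs t) w.
Proof.
elim: vs t e e' => [|u vs IH] [|a t] e e' // h; rewrite !assign_cons; apply: IH.
case: u a w h => [[] x] [a|a] [[] y] //=; by case: eqP.
Qed.

(** The reserved number variable 0 is free in the formula of a definition. It is bound by a
    quantifier and pinned to the least number by [z]. *)
Lemma query_of tau ss (P : forall A, rvs A -> ctx A -> bool) : Def tau [::] ss P ->
  exists q, wf_query q ss /\ forall A t, 0 < #|car A| -> wsort ss t ->
    qeval tau A q t = P A (fun _ _ => false) (catc t (fun _ => nz)).
Proof.
case=> /(_ [::] erefl) [f f1 f2].
pose z := FNot (FExN 1 (FNot (FLeN (TVar 0) (TVar 1)))).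
exists (stdb ss 0, FExN 0 (FAnd z f)); split.
  split; first exact: map_fst_stdb.
  split; first exact: uniq_stdb.
  move=> w; rewrite mem_filter mem_cat => /andP [/= h /orP [|/f1]].
    by rewrite inE => /eqP E; rewrite E eqxx in h.
  by rewrite inE (negPf h).
move=> A t hA ht; rewrite /qeval map_fst_stdb ht /= evalE.
have hz (e : env A) (i : 'I_#|car A|.+1) : eval tau A z (set_num e 0 i) = (i == ord0).
  rewrite /z !evalE; apply/negP/eqP => [h|-> /existsP [j]]; last by rewrite !evalE.
  case: (posnP i) => hi; first exact: val_inj.
  case: h; apply/existsP; exists ord0; by rewrite !evalE /= -ltnNge hi.
have hP : eval tau A f (set_num (assign (@env0 A) (stdb ss 0) t) 0 ord0) =
    P A (fun _ _ => false) (catc t (fun _ => nz)).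
  apply: f2 => //.
  have h0 : ematch [::] (set_num (@env0 A) 0 ord0) (fun _ => nz) by [].
  have := ematch_assign h0 ht; rewrite cats0; apply: ematch_ext.
    have E : lookup (assign (set_num (@env0 A) 0 ord0) (stdb ss 0) t) (SN, 0) = Some (inr ord0).
      by rewrite lookup_assign //; apply/negP => /stdb_bound.
    by move: E; rewrite /=; case: (num _ _) => //= i [->].
  move=> w /andP [hw _].
  have -> : lookup (set_num (assign (@env0 A) (stdb ss 0) t) 0 ord0) w = lookup (assign (@env0 A) (stdb ss 0) t) w.
    by case: w hw => [[] [|x]].
  by apply: assign_congr; case: w hw => [[] [|x]].
rewrite -hP; apply/existsP/idP => [[i]|h]; first by rewrite evalE hz => /andP [/eqP ->].
by exists ord0; rewrite evalE hz eqxx.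
Qed.

Section Iteration.
Variables (tau : seq nat) (T : transduction).
Hypothesis tau_adj : (0 < size tau) && (arity tau 0 == 2).
Hypothesis wfT : wf_transduction (lo_voc ++ [:: 2]) T.

Definition maxV A (m : value A) := allV SN (fun k : value A => nv k <= nv m).
Lemma maxVE A (m : value A) : matches SN m -> maxV m = (nv m == #|car A|).
Proof.
move=> hm; apply/allVP/eqP => [h|E v hv]; last by rewrite E -ltnS nv_lt.
by apply/eqP; rewrite eqn_leq -{1}ltnS nv_lt /=; have := h (nval A #|car A|) isT; rewrite nv_nval.
Qed.

Definition lev A (d : value A) (ts : seq (value A)) := levelV (nv d) (nth nz ts 0) (nth nz ts 1).
(* Step t passes from level n - t to level n - t - 1. *)
Definition stepF A (r : rvs A) (t : value A) (Z : seq (value A) -> bool) (ts : seq (value A)) :=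
  exV SN (fun m : value A => maxV m && exV SN (fun d : value A => exV SN (fun d1 : value A =>
    [&& nv t + nv d1 == nv m, nv d1 == (nv d).+1 &
     canonV T (scons (lev d) (scons (lev d1) (scons Z r))) (nth nz ts 0) (nth nz ts 1) (nth nz ts 2)]))).
(** The canon of a single vertex: no edge, and one diagonal entry at position 0. *)
Definition startF A (ts : seq (value A)) := (nv (nth nz ts 1) == 0) && (nv (nth nz ts 2) == 0).
Definition XG A (r : rvs A) (u i j : value A) := exV SN (fun m : value A =>
  maxV m && iterV (stepF r) (@startF A) (nv m) [:: u; i; j]).

Lemma scons_eta X (r : nat -> X) : scons (r 0) (fun k => r k.+1) = r.
Proof. by apply: functional_extensionality => -[|k]. Qed.

Lemma def_maxV rs ss m : isv ss SN m -> Def tau rs ss (fun A r c => maxV (c m)).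
Proof. by move=> hm; apply: def_allV; apply: def_le. Qed.

(** [canonV] refers to relation variables. The two partitions are definable relations, which
    [def_let] puts in their place one after the other. *)
Lemma def_stepcanon ss d d1 v i j : isv ss SN d -> isv ss SN d1 -> isv ss SE v -> isv ss SN i -> isv ss SN j ->
  Def tau [:: cd] ss (fun A r c => canonV T (scons (lev (c d)) (scons (lev (c d1)) r)) (c v) (c i) (c j)).
Proof.
move=> hd hd1 hv hi hj; case/andP: (tau_adj) => t0 /eqP t1.
apply: (def_let (us := [:: SE; SE]) (P := fun A r c L1 => canonV T (scons (lev (c d)) (scons L1 r)) (c v) (c i) (c j))
  (Q := fun A r c => lev (c d1))); last exact: (@def_levelV tau _ [:: SE, SE & ss] d1.+2 0 1).
apply: (@def_eq _ _ _ (fun A r c => canonV T (scons (lev (c d)) r) (c v) (c i) (c j))).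
  by move=> A r c _ _; rewrite scons_eta.
apply: (def_let (us := [:: SE; SE]) (P := fun A r c L0 => canonV T (scons L0 r) (c v) (c i) (c j))
  (Q := fun A r c => lev (c d))); last exact: (@def_levelV tau _ [:: SE, SE & ss] d.+2 0 1).
apply: (@def_eq _ _ _ (fun A r c => canonV T r (c v) (c i) (c j))).
  by move=> A r c _ _; rewrite scons_eta.
exact: def_canonV.
Qed.

Lemma def_XG ss u i j : isv ss SE u -> isv ss SN i -> isv ss SN j ->
  Def tau [::] ss (fun A r c => XG r (c u) (c i) (c j)).
Proof.
move=> hu hi hj; apply: def_exV; apply: def_and; first exact: def_maxV.
apply: (@def_iter tau [::] (SN :: ss) cd (fun A r c => stepF r) (fun A r c => @startF A) 0 [:: u.+1; i.+1; j.+1]) => //.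
- by case/andP: hu => h1 /eqP h2; case/andP: hi => h3 /eqP h4; case/andP: hj => h5 /eqP h6; 
     rewrite /isvs /= h2 h4 h6 eqxx !ltnS h1 h3 h5.
- by rewrite /startF /=; dfn.
rewrite /stepF /=; apply: def_exV; apply: def_and; first exact: def_maxV.
apply: def_exV; apply: def_exV; apply: def_and; first by dfn2.
apply: def_and; first by dfn2.
apply: (@def_eq _ _ _ (fun A r c => canonV T (scons (lev (c 1)) (scons (lev (c 0)) r)) (c 3) (c 4) (c 5))).
  by move=> A r c _ _; rewrite scons_eta.
exact: def_stepcanon.
Qed.
End Iteration.

Section IterationCorrect.
Variables (C : structure -> Prop) (T : transduction) (G : structure) (r : rvs G).
Hypothesis wfT : wf_transduction (lo_voc ++ [:: 2]) T.
Hypothesis canT : forall L, C_prim_star C L -> canonizes lo_voc T L.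
Hypothesis closedC : closed_induced_subgraphs C.
Hypothesis CG : C G.
Hypothesis grG : is_graph G.
Local Notation n := #|car G|.

Lemma stepFE t d (Z : seq (value G) -> bool) u i j : t + d.+1 = n ->
  stepF T r (nval G t) Z [:: u; i; j] =
  canonV T (scons (lev (nval G d)) (scons (lev (nval G d.+1)) (scons Z r))) u i j.
Proof.
move=> E; have ht : t <= n by rewrite -E leq_addr.
have hd1 : d.+1 <= n by rewrite -E leq_addl.
apply/exNP/idP => [[m hm /andP [h1 /exNP [d0 hd0 /exNP [d1 hd1' /and3P [h2 h3 h4]]]]]|h].
  have Em : m = n by apply/eqP; rewrite -{1}(nv_nval hm) -maxVE.
  have e1 : t + d1 = n by apply/eqP; move: h2; rewrite !nv_nval // Em.
  have e2 : d1 = d0.+1 by apply/eqP; move: h3; rewrite !nv_nval.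
  have e3 : d0 = d by lia.
  by rewrite e3 in e2; rewrite e3 e2 in h4; exact: h4.
exists n; first exact: leqnn.
apply/andP; split; first by rewrite maxVE // nv_nval.
apply/exNP; exists d; first exact: ltnW.
apply/exNP; exists d.+1; first exact: hd1.
by apply/and3P; split; [rewrite !nv_nval ?E|rewrite !nv_nval ?(ltnW hd1)|exact: h].
Qed.

(** The second claim is part of the induction because the next step requires it as [r2_class]: a
    canon belongs to the class, not to the vertex that names it. *)
Lemma iter_canon t : t <= n ->
  (forall u, isCanon (adj G) (cls (n - t) u)
     (fun i j => iterV (stepF T r) (@startF G) t [:: inl u; nval G i; nval G j])) /\
  (forall u w s, level (n - t) u w -> wsort [:: SN; SN] s ->
     iterV (stepF T r) (@startF G) t (inl u :: s) = iterV (stepF T r) (@startF G) t (inl w :: s)).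
Proof.
elim: t => [|t IH] ht.
  split=> [u|u w s]; last by rewrite subn0 (level_last grG) => /eqP ->.
  have E : cls (n - 0) u = [set u] by apply/setP => w; rewrite !inE subn0 (level_last grG) eq_sym.
  rewrite E /isCanon cards1; exists (fun _ => u); split=> [i|[|i] [|j]|i j hi hj] //; first by rewrite inE.
  rewrite /= /startF /= !nv_nval //; have [_ _ /(_ u) /negPf ->] := grG.
  by case: i {hi} => [|i]; case: j {hj} => [|j].
have [H1 H2] := IH (ltnW ht).
pose d := n - t.+1; have Ed : n - t = d.+1 by rewrite /d subnSK.
have Ed' : t + d.+1 = n by rewrite -Ed subnKC // ltnW.
rewrite Ed in H1 H2; rewrite -/d.
have hdn : d.+1 <= n by rewrite -Ed leq_subr.
set Z := iterV _ _ t in H1 H2.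
pose rr := scons (lev (nval G d)) (scons (lev (nval G d.+1)) (scons Z r)).
have r0E u w : rr 0 [:: inl u; inl w] = level d u w by rewrite /rr /= /lev /= nv_nval ?levelVE // ltnW.
have r1E u w : rr 1 [:: inl u; inl w] = level d.+1 u w by rewrite /rr /= /lev /= nv_nval // levelVE.
split=> [u|u w s hl hs].
  have [h [h1 h2 h3]] := canon_step wfT canT closedC CG grG r0E r1E H1 H2 u.
  by exists h; split=> // i j hi hj; rewrite -h3 //= (stepFE _ _ _ _ Ed').
have [i [j Es]] : exists i j, s = [:: i; j].
  by have := wsort_size hs; clear hs; case: s => [|i [|j [|]]] // _; exists i, j.
rewrite Es in hs *.
have key : canonV T rr (inl u) i j = canonV T rr (inl w) i j.
  apply: (@canonV_class graph_voc T isT wfT); first by case: grG.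
    by move: hs; rewrite !wsort_cons.
  move=> [z|//] _; rewrite !r0E; have [_ h3 h4] := level_equiv grG d.
  by apply/idP/idP => h; [apply: h4 h; rewrite h3|apply: h4 h].
have F x : iterV (stepF T r) (@startF G) t.+1 [:: inl x; i; j] = canonV T rr (inl x) i j.
  exact: (stepFE Z (inl x) i j Ed').
exact: (etrans (F u) (etrans key (esym (F w)))).
Qed.

Lemma XGE u i j : XG T r u i j = iterV (stepF T r) (@startF G) n [:: u; i; j].
Proof.
apply/exNP/idP => [[m hm /andP []]|h]; first by rewrite maxVE // nv_nval // => /eqP ->.
exists n; first exact: leqnn.
by apply/andP; split; [rewrite maxVE // nv_nval|rewrite nv_nval].
Qed.

(** At level 0 all vertices form one class and carry the same relation, so the quantifier removes
    the choice of a vertex. *)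
Definition someX (i j : value G) := exV SE (fun u => XG T r u i j).
Lemma someX_canon : isCanon (adj G) [set: car G] (fun i j => someX (nval G i) (nval G j)).
Proof.
have [/card_gt0P [u _] _ _] := grG; have [H H'] := iter_canon (leqnn n).
have [h] := H u; have -> : cls (n - n) u = [set: car G] by apply/setP => w; rewrite !inE subnn.
move=> [h1 h2 h3]; exists h; split=> // i j hi hj; rewrite -h3 //.
have same w : XG T r (inl w) (nval G i) (nval G j) = XG T r (inl u) (nval G i) (nval G j).
  by rewrite !XGE; apply: H'; rewrite ?subnn.
rewrite -XGE; apply/exVP/idP => [[[w|//] _]|h4]; last by exists (inl u).
by rewrite same.
Qed.
End IterationCorrect.

Section Canonization.
Variable T : transduction.
Hypothesis wfT : wf_transduction (lo_voc ++ [:: 2]) T.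
(** The output lives on the number sort: the diagonal of the canon is its universe and has to be
    removed from the edges, and the order is that of the numbers. *)
Lemma canon_transduction : exists Th, [/\ wf_transduction (graph_voc ++ [:: 2]) Th, t_par Th = [::], t_srt Th = [:: SN] &
  forall A, 0 < #|car A| -> let r := fun _ _ => false in [/\
    qeval graph_voc A (t_dom Th) [::],
    forall i, qeval graph_voc A (t_U Th) [:: inr i] = someX T (G := A) r (inr i) (inr i),
    forall i j, qeval graph_voc A (t_eq Th) [:: inr i; inr j] = (i == j),
    forall i j, qeval graph_voc A (nth dflt_query (t_rel Th) 0) [:: inr i; inr j] =
      (i != j) && someX T (G := A) r (inr i) (inr j) &
    forall i j : 'I_#|car A|.+1, qeval graph_voc A (nth dflt_query (t_rel Th) 1) [:: inr i; inr j] = (i <= j)]].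
Proof.
have dX ss i j : isv ss SN i -> isv ss SN j -> Def graph_voc [::] ss (fun A r c => someX T r (c i) (c j)).
  by move=> hi hj; apply: def_exV; exact: (@def_XG graph_voc T isT wfT (SE :: ss) 0 i.+1 j.+1).
have [q1 [w1 e1]] := query_of (def_true graph_voc [::] [::]).
have [q2 [w2 e2]] := query_of (dX [:: SN] 0 0 isT isT).
have [q3 [w3 e3]] := query_of (@def_eqn graph_voc [::] [:: SN; SN] 0 1 isT).
have [q4 [w4 e4]] := query_of (def_and (def_not (@def_eqn graph_voc [::] [:: SN; SN] 0 1 isT)) (dX [:: SN; SN] 0 1 isT isT)).
have [q5 [w5 e5]] := query_of (@def_le graph_voc [::] [:: SN; SN] 0 1 isT).
exists (Transduction [::] [:: SN] q1 q2 q3 [:: q4; q5]); split=> //.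
  by split=> // -[|[|]].
move=> A hA r; split=> [|i|i j|i j|i j].
- by rewrite e1.
- by rewrite e2.
- by rewrite e3.
- by rewrite e4.
- by rewrite e5.
Qed.
End Canonization.

(** * The final transduction *)

Section NumericOutput.
Variables (Th : transduction) (A : structure) (R : nat -> nat -> bool).
Hypothesis par0 : t_par Th = [::].
Hypothesis srt1 : t_srt Th = [:: SN].
Hypothesis grA : is_graph A.
Hypothesis R_canon : isCanon (adj A) [set: car A] R.
Hypothesis wfU : wf_query (t_U Th) (t_par Th ++ t_srt Th).
Local Notation n := #|car A|.
Implicit Types i j : 'I_n.+1.
Local Notation qv := (qeval graph_voc A).
Hypothesis domE : qv (t_dom Th) [::].
Hypothesis UE : forall i, qv (t_U Th) [:: inr i] = R i i.
Hypothesis eqE : forall i j, qv (t_eq Th) [:: inr i; inr j] = (i == j).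
Hypothesis edgeE : forall i j, qv (nth dflt_query (t_rel Th) 0) [:: inr i; inr j] = (i != j) && R i j.
Hypothesis leE : forall i j, qv (nth dflt_query (t_rel Th) 1) [:: inr i; inr j] = (i <= j).
Local Notation dom := (dom_t Th A).
Local Notation U := (Uset graph_voc Th A [::]).
Local Notation B := (out_struct graph_voc Th A [::]).

Lemma size_srt : size (t_srt Th) = 1. Proof. by rewrite srt1. Qed.
Lemma domP (a : dom) : a \in U -> exists2 i : 'I_n.+1, tval a = [:: inr i] & i < n.
Proof.
rewrite inE cat0s => h; have : wsort [:: SN] a.
  by case: wfU => E _; rewrite par0 srt1 /= in E; rewrite -E; case/andP: h.
case: (tval a) h (size_tuple a) => [|[x|i] [|y t]] //; rewrite ?size_srt // UE => h _ _.
by exists i => //; move: h; rewrite (canon_diag R_canon) ?cardsT // -ltnS.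
Qed.
Definition num_dom i : dom := tcast (esym size_srt) [tuple (inr i : value A)].
Lemma num_domE i : tval (num_dom i) = [:: inr i]. Proof. by rewrite val_tcast. Qed.
Lemma num_domU i : i < n -> num_dom i \in U.
Proof. by move=> hi; rewrite inE cat0s num_domE UE (canon_diag R_canon) ?cardsT // ltnW. Qed.

Lemma eqgen_eq (a b : dom) : eqgen graph_voc Th A [::] a b = (a == b).
Proof.
apply/idP/eqP => [/connectP [p hp ->]|->]; last exact: connect0.
elim: p a hp => //= c p IH a /andP [/and3P [ha hc h] /IH <-].
have [i Ei _] := domP ha; have [j Ej _] := domP hc; apply: val_inj; rewrite /= Ei Ej.
by move: h; rewrite !cat0s Ei Ej /= !eqE eq_sym orbb => /eqP ->.
Qed.

Lemma carP (x : car B) : exists2 a, a \in U & val x = [set a].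
Proof.
have /imsetP [a ha E] := valP x; exists a => //; rewrite E.
by apply/setP => b; rewrite !inE eqgen_eq eq_sym.
Qed.
Lemma set_car (a : dom) : a \in U -> exists x : car B, val x = [set a].
Proof.
move=> ha; have hc : [set b | eqgen graph_voc Th A [::] a b] \in classes graph_voc Th A [::] by apply: imset_f.
exists (exist (fun c => c \in classes graph_voc Th A [::]) _ hc) => /=; by apply/setP => b; rewrite !inE eqgen_eq eq_sym.
Qed.
Lemma out_pair k (x y : car B) (a b : dom) : val x = [set a] -> val y = [set b] ->
  srel B k [:: x; y] = qv (nth dflt_query (t_rel Th) k) (tval a ++ tval b).
Proof.
move=> ha hb; apply/existsP/idP => [[ts /andP []]|h].
  case: ts => -[|t [|u [|]]] //= hs; rewrite ha hb !inE => /and3P [/eqP -> /eqP -> _].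
  by rewrite cats0.
by exists [tuple a; b]; rewrite /= ha hb !inE !eqxx cats0.
Qed.

Lemma numeric_ordered_copy : ordered_copy graph_voc B A.
Proof.
have [h [_ h_inj hR]] := R_canon; rewrite cardsT in h_inj hR.
have hx (x : car B) : exists2 i : 'I_n.+1, val x = [set num_dom i] & i < n.
  have [a ha E] := carP x; have [i Ei hi] := domP ha; exists i => //; rewrite E.
  by have -> : a = num_dom i by apply: val_inj; exact: etrans Ei (esym (num_domE i)).
have hx2 (x : car B) : exists i : 'I_n.+1, val x = [set num_dom i] /\ i < n.
  by have [i h1 h2] := hx x; exists i.
have [g hg] := fin_all_exists hx2.
have g_inj : injective g.
  by move=> x y E; apply: val_inj; have [-> _] := hg x; have [-> _] := hg y; rewrite E.
have relE k x y : srel B k [:: x; y] = qv (nth dflt_query (t_rel Th) k) [:: inr (g x); inr (g y)].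
  have [Ex _] := hg x; have [Ey _] := hg y; rewrite (out_pair k Ex Ey).
  by rewrite !num_domE.
split; last first.
  split; first by move=> x; rewrite relE leE.
  split; first by move=> x y; rewrite !relE !leE => h1 h2; apply: g_inj; apply: val_inj; apply/eqP; rewrite eqn_leq h1.
  split; first by move=> x y z; rewrite !relE !leE; apply: leq_trans.
  by move=> x y; rewrite !relE !leE; apply/orP; apply: leq_total.
pose f (x : car B) := h (g x).
have f_inj : injective f.
  by move=> x y E; apply: g_inj; apply: val_inj; apply: h_inj E; have [] := hg x; have [] := hg y.
have f_surj y : exists x, f x = y.
  (* There are as many positions as vertices, so the injective enumeration is onto. *)
  have H_inj : injective (fun i : 'I_n => h i) by move=> i j E; apply: val_inj; apply: h_inj E.
  have : y \in codom (fun i : 'I_n => h i) by apply: inj_card_onto; rewrite ?card_ord.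
  case/codomP => i ->; have hi : i < n.+1 by apply: leq_trans (ltn_ord i) _.
  have [x Ex] := set_car (num_domU (i := Ordinal hi) (ltn_ord i)).
  exists x; rewrite /f; have [E _] := hg x.
  have : num_dom (g x) = num_dom (Ordinal hi) by apply: set1_inj; rewrite -E Ex.
  by move/(congr1 val); rewrite /= !num_domE => -[->].
have [f' hf'] := fin_all_exists f_surj.
exists f; split.
  by exists f' => // x; apply: f_inj; rewrite hf'.
move=> [|//] _ [|x [|y [|]]] // _; rewrite relE edgeE /= -/(adj A _ _) hR; last 2 first.
- by rewrite -ltnS.
- by rewrite -ltnS.
have [_ ->] := hg x; have [_ ->] := hg y; rewrite /= /f.
have -> : ((g x : nat) == g y) = (g x == g y) by [].
by have [_ _ irr] := grA; case: (eqVneq (g x) (g y)) => [->|_] //=; rewrite (negPf (irr _)).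
Qed.

Lemma numeric_canonizes : canonizes graph_voc Th A.
Proof.
split; last first.
  move=> p /and3P [hp _ _]; rewrite par0 in hp.
  by move: hp => /wsort_size /size0nil ->; exact: numeric_ordered_copy.
exists [::]; rewrite /in_domain par0 domE /=; apply/set0Pn.
by have [n0 _ _] := grA; exists (num_dom ord0); apply: num_domU.
Qed.
End NumericOutput.

Theorem theorem4p3 (C : structure -> Prop) :
  graph_class C ->
  closed_induced_subgraphs C ->
  (admits_canonization lo_voc (C_prim_star C) \/
   admits_param_canonization lo_voc (C_prim_star C)) ->
  admits_canonization graph_voc C.
Proof.
move=> grC closedC hT.
have [T [wfT canT]] : admits_param_canonization lo_voc (C_prim_star C).
  by case: hT => // -[T [wfT _ canT]]; exists T.
have [Th [wf par srt spec]] := canon_transduction wfT.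
exists Th; split=> // A CA; have grA := grC A CA; have [n0 _ _] := grA.
have [s1 s2 s3 s4 s5] := spec A n0.
have [u _] := card_gt0P n0.
have hR := someX_canon (fun _ _ => false) wfT canT closedC CA grA.
apply: (numeric_canonizes par srt grA hR) => // [|i|i j].
- by case: wf.
- by rewrite s2 /nval !inord_val.
- by rewrite s4 /nval !inord_val.
Qed.
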